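(* Let $(T^2,g)$ be the two-dimensional torus with an arbitrary Riemannian metric $g$, let $p:\mathbb R^2\to T^2$ be the universal covering (with the lifted metric), and let $\phi^t$ be the geodesic flow on the unit tangent bundle $ST^2$. Let $$\tilde S\mathbb R^2:=\{v\in S\mathbb R^2 \mid c_v \text{ is a minimal geodesic}\},\qquad \tilde ST^2:=dp(\tilde S\mathbb R^2),$$ and let $\tilde\phi^t$ be the restriction of $\phi^t$ to $\tilde ST^2$. Then the topological entropy of $\tilde \phi^t$ vanishes: $h_{top}(\tilde\phi^t)=0$.
   Context: For $v$ a unit tangent vector, $c_v$ denotes the unit-speed geodesic with $\dot c_v(0)=v$, and $\phi^t(v)=\dot c_v(t)$. A geodesic $c:\mathbb R\to\mathbb R^2$ of the lifted metric is called minimal if it is globally minimizing, i.e. $d(c(s),c(t))=|s-t|$ for all $s,t$, where $d$ is the distance induced by $g$ on $\mathbb R^2$. The set $\tilde ST^2$ is a compact $\phi^t$-invariant subset of $ST^2$. Topological entropy is Bowen's: for a continuous flow $\phi^t$ on a compact metric space $(Y,d)$, with dynamical distance $d_T(v,w)=\max_{0\le t\le T}d(\phi^tv,\phi^tw)$, $h_{top}(\phi)=\lim_{\varepsilon\to0}\limsup_{T\to\infty}\frac1T\log s_T(\phi,\varepsilon)$, where $s_T(\phi,\varepsilon)$ is the minimal cardinality of a set $G\subset Y$ such that every $x\in Y$ has some $y\in G$ with $d_T(x,y)\le\varepsilon$. Here $Y=\tilde ST^2$ with the distance induced by the Sasaki metric. *)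

(* Defs.v *)
From Stdlib Require Import Reals List ZArith.
From Coquelicot Require Import Coquelicot.
Open Scope R_scope.

(* A Riemannian metric on T^2 = R^2/Z^2, given by its lifted (Z^2-periodic)
   coefficient functions g11, g12 (= g21), g22 on R^2. *)
Record metric2 := Metric2 { m11 : R -> R -> R; m12 : R -> R -> R; m22 : R -> R -> R }.

Definition gc (g : metric2) (i j : nat) : R -> R -> R :=
  match i, j with
  | O, O => m11 g
  | S _, S _ => m22 g
  | _, _ => m12 g
  end.

Definition pd (i : nat) (f : R -> R -> R) : R -> R -> R :=
  fun x y => match i with
             | O => Derive (fun t => f t y) x
             | S _ => Derive (fun t => f x t) y
             end.

Fixpoint dpart (l : list nat) (f : R -> R -> R) : R -> R -> R :=
  match l with
  | nil => f
  | i :: l' => pd i (dpart l' f)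
  end.

Definition smooth2 (f : R -> R -> R) : Prop :=
  forall l : list nat,
    (forall x y, continuous (fun p : R * R => dpart l f (fst p) (snd p)) (x, y)) /\
    (forall x y, ex_derive (fun t => dpart l f t y) x /\ ex_derive (fun t => dpart l f x t) y).

Definition periodic2 (f : R -> R -> R) : Prop :=
  forall x y, f (x + 1) y = f x y /\ f x (y + 1) = f x y.

Definition is_torus_metric (g : metric2) : Prop :=
  smooth2 (m11 g) /\ smooth2 (m12 g) /\ smooth2 (m22 g) /\
  periodic2 (m11 g) /\ periodic2 (m12 g) /\ periodic2 (m22 g) /\
  (forall x y, 0 < m11 g x y /\ 0 < m11 g x y * m22 g x y - (m12 g x y) ^ 2).

Definition detg (g : metric2) x y := m11 g x y * m22 g x y - (m12 g x y) ^ 2.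

Definition ginv (g : metric2) (k l : nat) (x y : R) : R :=
  match k, l with
  | O, O => m22 g x y / detg g x y
  | S _, S _ => m11 g x y / detg g x y
  | _, _ => - m12 g x y / detg g x y
  end.

Definition chr (g : metric2) (k i j : nat) (x y : R) : R :=
  / 2 * (ginv g k 0 x y * (pd i (gc g j 0) x y + pd j (gc g i 0) x y - pd 0 (gc g i j) x y)
       + ginv g k 1 x y * (pd i (gc g j 1) x y + pd j (gc g i 1) x y - pd 1 (gc g i j) x y)).

Definition cp (p : R * R) (i : nat) : R := match i with O => fst p | S _ => snd p end.

Definition gq (g : metric2) (x a b : R * R) : R :=
  gc g 0 0 (fst x) (snd x) * cp a 0 * cp b 0 + gc g 0 1 (fst x) (snd x) * cp a 0 * cp b 1
  + gc g 1 0 (fst x) (snd x) * cp a 1 * cp b 0 + gc g 1 1 (fst x) (snd x) * cp a 1 * cp b 1.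

Definition quad_chr (g : metric2) (k : nat) (x a b : R * R) : R :=
  chr g k 0 0 (fst x) (snd x) * cp a 0 * cp b 0 + chr g k 0 1 (fst x) (snd x) * cp a 0 * cp b 1
  + chr g k 1 0 (fst x) (snd x) * cp a 1 * cp b 0 + chr g k 1 1 (fst x) (snd x) * cp a 1 * cp b 1.

Definition geodesic (g : metric2) (c u : R -> R * R) : Prop :=
  forall t,
    is_derive (fun s => fst (c s)) t (fst (u t)) /\
    is_derive (fun s => snd (c s)) t (snd (u t)) /\
    is_derive (fun s => fst (u s)) t (- quad_chr g 0 (c t) (u t) (u t)) /\
    is_derive (fun s => snd (u s)) t (- quad_chr g 1 (c t) (u t) (u t)).

Definition C1curve (c c' : R -> R * R) : Prop :=
  forall t,
    is_derive (fun s => fst (c s)) t (fst (c' t)) /\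
    is_derive (fun s => snd (c s)) t (snd (c' t)) /\
    continuous (fun s => fst (c' s)) t /\ continuous (fun s => snd (c' s)) t.

Definition glength (g : metric2) (c c' : R -> R * R) : R :=
  RInt (fun t => sqrt (gq g (c t) (c' t) (c' t))) 0 1.

Definition dist (g : metric2) (p q : R * R) : R :=
  real (Glb_Rbar (fun L => exists c c', C1curve c c' /\ c 0 = p /\ c 1 = q /\ L = glength g c c')).

Definition minimal (g : metric2) (c : R -> R * R) : Prop :=
  forall s t, dist g (c s) (c t) = Rabs (s - t).

(* tangent vectors: (base point, vector) *)
Definition TB := ((R * R) * (R * R))%type.

Definition unitvec (g : metric2) (w : TB) : Prop := gq g (fst w) (snd w) (snd w) = 1.

Definition inSR (g : metric2) (w : TB) : Prop :=
  unitvec g w /\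
  forall c u, geodesic g c u -> c 0 = fst w -> u 0 = snd w -> minimal g c.

Definition shift (k1 k2 : Z) (w : TB) : TB :=
  ((fst (fst w) + IZR k1, snd (fst w) + IZR k2), snd w).

(* A point of ST^2 is represented by any lift in SR^2 (mod Z^2 translations);
   \tilde S T^2 = dp(\tilde S R^2): some lift lies in \tilde S R^2. *)
Definition inST (g : metric2) (w : TB) : Prop := exists k1 k2, inSR g (shift k1 k2 w).

Definition cov (g : metric2) (k : nat) (x xdot V Vdot : R * R) : R :=
  cp Vdot k + quad_chr g k x xdot V.

Definition sasaki_len (g : metric2) (gam gam' V V' : R -> R * R) : R :=
  RInt (fun t =>
    let D := (cov g 0 (gam t) (gam' t) (V t) (V' t), cov g 1 (gam t) (gam' t) (V t) (V' t)) in
    sqrt (gq g (gam t) (gam' t) (gam' t) + gq g (gam t) D D)) 0 1.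

(* distance on ST^2 induced by the Sasaki metric (curves inside ST^2,
   endpoints taken modulo the deck group Z^2) *)
Definition distS (g : metric2) (w1 w2 : TB) : R :=
  real (Glb_Rbar (fun L => exists (k1 k2 : Z) (gam gam' V V' : R -> R * R),
    C1curve gam gam' /\ C1curve V V' /\
    (forall t, 0 <= t <= 1 -> unitvec g (gam t, V t)) /\
    (gam 0, V 0) = w1 /\ (gam 1, V 1) = shift k1 k2 w2 /\
    L = sasaki_len g gam gam' V V')).

(* d_T(v, w) <= eps, with phi^t(v) = (c_v(t), c_v'(t)) *)
Definition dyn_close (g : metric2) (T eps : R) (v w : TB) : Prop :=
  forall c u c2 u2, geodesic g c u -> (c 0, u 0) = v -> geodesic g c2 u2 -> (c2 0, u2 0) = w ->
    forall t, 0 <= t <= T -> distS g (c t, u t) (c2 t, u2 t) <= eps.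

Definition span_num (g : metric2) (T eps : R) : Rbar :=
  Glb_Rbar (fun r => exists G : list TB, r = INR (length G) /\
    (forall w, In w G -> inST g w) /\
    (forall v, inST g v -> exists w, In w G /\ dyn_close g T eps v w)).

Definition rate (g : metric2) (T eps : R) : Rbar :=
  match span_num g T eps with
  | Finite r => Finite (ln r / T)
  | p_infty => p_infty
  | m_infty => m_infty
  end.

Definition limsup_rate (g : metric2) (eps : R) : Rbar :=
  Rbar_glb (fun a => exists T0 : R, a = Rbar_lub (fun b => exists T, T0 <= T /\ b = rate g T eps)).

Definition htop_zero (g : metric2) : Prop :=
  forall e, 0 < e -> exists delta, 0 < delta /\
    forall eps, 0 < eps < delta ->
      Rbar_lt (Finite (- e)) (limsup_rate g eps) /\ Rbar_lt (limsup_rate g eps) (Finite e).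

(* Main.v *)
(** A globally minimal geodesic of the universal cover meets another one at most once: at a second meeting point
    the concatenation of the two would be a minimizer with a corner.  The minimal geodesics thus behave like an
    arrangement of pseudo-lines in the plane.  Each of them has two sides, and five of them have at most 31
    complementary regions; hence no 32 points are shattered by the family of left sides, and by Sauer--Shelah
    the number of ways in which a set of [m] points is split by minimal geodesics is polynomial in [m].

    Take as points a fine net, of cardinality quadratic in [T], of a disc of radius of order [T].  Two minimal
    geodesics that split the net in the same way are close as sets, since otherwise two net points on either side
    of the first would lie on the same side of the second.  As arc length equals distance along a minimal
    geodesic, closeness as sets together with closeness of the initial vectors gives closeness of the parametrized
    curves on [[0, T]], and the geodesic equation upgrades this to closeness of the velocities.  Hence the
    cardinality of an optimal spanning set grows at most polynomially in [T]. *)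
From Stdlib Require Import Reals Lra Lia List ZArith Classical ClassicalEpsilon.
From Coquelicot Require Import Coquelicot.
Require Import Defs.
Import ListNotations.
Open Scope R_scope.

(** Sides and regions are classes of polygonal connectedness, so arrangement arguments are
    inductions over segments. That the two sides of a curve differ is a winding number statement,
    with angles given by [atan] and viewed from the curve itself, whose ends go to infinity. Tube
    radius, time window and mesh depend only on the metric and on [eps], never on the geodesic or on
    [T].

    The region count charges both sides of every new arc, which gives [1 + k (k + 1)] for [k]
    curves; five is the least [k] for which this is below [2 ^ k]. The exponent 31 is one less than
    the 32 points that cannot be shattered, and 62 is its double because the net is quadratic.

    A trace is meaningful only at points off the curves, so the net is perturbed after a finite
    family has been fixed. Hence separated families are bounded, and a maximal one spans. Phase
    space is first cut into finitely many cells, independent of [T], so that the vectors compared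
    have close lifts. The geodesics themselves are extracted from the failure of [dyn_close]. *)

(** * Derivatives and bounds of smooth periodic functions *)

Lemma lipschitz_of_bounded_derive (f df : R -> R) (B : R) :
  (forall x, is_derive f x (df x)) -> (forall x, Rabs (df x) <= B) ->
  forall a b, Rabs (f a - f b) <= B * Rabs (a - b).
Proof.
  intros Hd Hb a b.
  destruct (MVT_gen f b a df) as [c [_ Hc]].
  - intros x _; apply Hd.
  - intros x _. apply continuity_pt_filterlim.
    apply (ex_derive_continuous f x). exists (df x); apply Hd.
  - rewrite Hc, Rabs_mult. apply Rmult_le_compat_r; [apply Rabs_pos | apply Hb].
Qed.

(** Total differentiability follows from existence of the first partial derivative nearby, its
    continuity at the point, and existence of the second one; then the two-variable chain rule
    applies. *)
Lemma is_derive_chain2 (f : R -> R -> R) (x y : R -> R) (x' y' t : R) :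
  smooth2 f -> is_derive x t x' -> is_derive y t y' ->
  is_derive (fun s => f (x s) (y s)) t (pd 0 f (x t) (y t) * x' + pd 1 f (x t) (y t) * y').
Proof.
  intros Hf Hx Hy.
  assert (Hd : differentiable_pt_lim f (x t) (y t) (pd 0 f (x t) (y t)) (pd 1 f (x t) (y t))).
  { apply filterdiff_differentiable_pt_lim.
    assert (H1 := proj1 (Hf (0 :: nil)%nat) (x t) (y t)).
    assert (H2 := Derive_correct _ _ (proj2 (proj2 (Hf nil) (x t) (y t)))).
    assert (H3 : locally (x t, y t) (fun u : R * R => is_derive (fun z => f z (snd u)) (fst u) (pd 0 f (fst u) (snd u)))).
    { exists (mkposreal 1 Rlt_0_1). intros [u v] _. 
        apply Derive_correct. apply (proj2 (Hf nil) u v). }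
    assert (H4 := is_derive_filterdiff f (x t) (y t) (fun u v => pd 0 f u v) (pd 1 f (x t) (y t)) H3 H2 H1).
    exact H4. }
  apply is_derive_Reals in Hx.  apply is_derive_Reals in Hy. apply is_derive_Reals.
  apply derivable_pt_lim_comp_2d; assumption.
Qed.

Lemma dpart_app (l1 l2 : list nat) f : dpart (l1 ++ l2) f = dpart l1 (dpart l2 f).
Proof. induction l1 as [|i l1 IH]; simpl; [reflexivity | now rewrite IH]. Qed.

Lemma smooth2_pd (i : nat) f : smooth2 f -> smooth2 (pd i f).
Proof.
  intros Hf l. change (pd i f) with (dpart (i :: nil) f).
  rewrite <- dpart_app. apply Hf.
Qed.

Lemma periodic2_pd (i : nat) f : smooth2 f -> periodic2 f -> periodic2 (pd i f).
Proof.
  intros Hf Hp x y.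
  assert (Hs : forall (h : R -> R) a, Derive h (a + 1) = Derive (fun t => h (t + 1)) a).
  { intros h a. unfold Derive. f_equal. apply Lim_ext. intros u.
    replace (a + 1 + u) with (a + u + 1) by ring. reflexivity. }
  destruct i; simpl; rewrite ?Hs; split; apply Derive_ext; intros t;
    try apply (Hp t y); try apply (Hp x t).
Qed.

Lemma periodic2_IZR f (x y : R) (k l : Z) : periodic2 f -> f (x + IZR k) (y + IZR l) = f x y.
Proof.
  intros Hp.
  assert (Hn : forall (n : nat) a b, f (a + INR n) b = f a b /\ f a (b + INR n) = f a b).
  { induction n as [|n IH]; intros a b.
    - simpl. now rewrite !Rplus_0_r.
    - rewrite S_INR. replace (a + (INR n + 1)) with (a + INR n + 1) by ring.
      replace (b + (INR n + 1)) with (b + INR n + 1) by ring.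
      split; [rewrite (proj1 (Hp _ _)) | rewrite (proj2 (Hp _ _))]; apply IH. }
  assert (Hz : forall (m : Z) a b, f (a + IZR m) b = f a b /\ f a (b + IZR m) = f a b).
  { intros m a b. destruct (Z_le_gt_dec 0 m) as [Hm|Hm].
    - rewrite <- (Z2Nat.id m Hm), <- INR_IZR_INZ. apply Hn.
    - assert (E : IZR m = - INR (Z.to_nat (- m))).
      { rewrite INR_IZR_INZ, Z2Nat.id, opp_IZR by lia. ring. }
      rewrite E.
      split; [rewrite <- (proj1 (Hn (Z.to_nat (-m)) (a + - INR (Z.to_nat (- m))) b))
             | rewrite <- (proj2 (Hn (Z.to_nat (-m)) a (b + - INR (Z.to_nat (- m)))))];
        f_equal; ring. }
  now rewrite (proj1 (Hz _ _ _)), (proj2 (Hz _ _ _)).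
Qed.

Lemma frac_in_unit (x : R) : exists k : Z, 0 <= x + IZR k <= 1.
Proof.
  exists (- (up x - 1))%Z. rewrite opp_IZR, minus_IZR.
  destruct (archimed x). lra.
Qed.

(** Uniform continuity on the unit square yields a step size at which [f] changes by less than 1.
    Each point of the square is reached from the origin along its ray in [n] such steps, so [f]
    differs from [f 0 0] by at most [n]. *)
Lemma periodic2_bounded f :
  periodic2 f -> (forall x y, continuity_2d_pt f x y) -> exists B, forall x y, Rabs (f x y) <= B.
Proof.
  intros Hp Hc.
  destruct (uniform_continuity_2d f 0 1 0 1) with (eps := mkposreal 1 Rlt_0_1) as [d Hd].
  { intros; apply Hc. }
  simpl in Hd.
  destruct (archimed_cor1 d (cond_pos d)) as [n [Hn Hn0]].
  assert (Hn1 : 0 < INR n) by (apply lt_0_INR; lia).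
  assert (Hi : 0 < / INR n) by now apply Rinv_0_lt_compat.
  assert (Hk : forall (k : nat) x y, 0 <= x <= 1 -> 0 <= y <= 1 -> (k <= n)%nat ->
            Rabs (f (x * (INR k / INR n)) (y * (INR k / INR n)) - f 0 0) <= INR k).
  { induction k as [|k IH]; intros x y Hx Hy Hkn.
    - simpl. unfold Rdiv. rewrite !Rmult_0_l, !Rmult_0_r, Rminus_diag, Rabs_R0. lra.
    - assert (Hin : forall j : nat, (j <= n)%nat -> 0 <= INR j / INR n <= 1).
      { intros j Hj. apply le_INR in Hj. pose proof (pos_INR j). split.
        - apply Rdiv_le_0_compat; lra.
        - apply Rmult_le_reg_r with (INR n); [lra|]. unfold Rdiv.
          rewrite Rmult_assoc, Rinv_l; lra. }
      specialize (IH x y Hx Hy ltac:(lia)).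
      pose proof (Hin k ltac:(lia)) as H1. pose proof (Hin (S k) Hkn) as H2.
      assert (E : INR (S k) / INR n - INR k / INR n = / INR n).
      { rewrite S_INR. field. lra. }
      assert (Hs : forall z, 0 <= z <= 1 ->
        Rabs (z * (INR (S k) / INR n) - z * (INR k / INR n)) < d).
      { intros z Hz. replace (z * (INR (S k) / INR n) - z * (INR k / INR n)) with (z * / INR n)
          by (rewrite <- E; ring).
        rewrite Rabs_pos_eq; [|apply Rmult_le_pos; lra].
        apply Rle_lt_trans with (1 * / INR n); [apply Rmult_le_compat_r|]; lra. }
      assert (Hr : forall z w, 0 <= z <= 1 -> 0 <= w <= 1 -> 0 <= z * w <= 1).
      { intros z w Hz Hw. split; [apply Rmult_le_pos; lra|].
        rewrite <- (Rmult_1_l 1). apply Rmult_le_compat; lra. }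
      specialize (Hd (x * (INR k / INR n)) (y * (INR k / INR n))
        (x * (INR (S k) / INR n)) (y * (INR (S k) / INR n))
        (Hr _ _ Hx H1) (Hr _ _ Hy H1) (Hr _ _ Hx H2) (Hr _ _ Hy H2) (Hs x Hx) (Hs y Hy)).
      rewrite S_INR at 3.
      replace (f (x * (INR (S k) / INR n)) (y * (INR (S k) / INR n)) - f 0 0) with
       ((f (x * (INR (S k) / INR n)) (y * (INR (S k) / INR n)) - f (x * (INR k / INR n)) (y * (INR k / INR n)))
        + (f (x * (INR k / INR n)) (y * (INR k / INR n)) - f 0 0)) by ring.
      eapply Rle_trans; [apply Rabs_triang | lra]. }
  exists (INR n + Rabs (f 0 0)). intros x y.
  destruct (frac_in_unit x) as [k Hkx]. destruct (frac_in_unit y) as [l Hly].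
  rewrite <- (periodic2_IZR f x y k l Hp).
  specialize (Hk n _ _ Hkx Hly (le_n n)).
  unfold Rdiv in Hk. rewrite Rinv_r, !Rmult_1_r in Hk by lra.
  replace (f (x + IZR k) (y + IZR l)) with ((f (x + IZR k) (y + IZR l) - f 0 0) + f 0 0) by ring.
  eapply Rle_trans; [apply Rabs_triang | lra].
Qed.

Lemma smooth2_continuity f : smooth2 f -> forall x y, continuity_2d_pt f x y.
Proof. intros Hf x y. apply continuity_2d_pt_filterlim. apply (Hf nil). Qed.

(** * Bounded Lipschitz functions of two variables *)

(** A class closed under sums, products and reciprocals bounded away from zero. The inverse metric
    and the Christoffel symbols inherit their bounds algebraically from the coefficients and their
    first derivatives. *)
Definition BL (f : R -> R -> R) : Prop :=
  exists B, 0 <= B /\ (forall x y, Rabs (f x y) <= B) /\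
    (forall x y x' y', Rabs (f x y - f x' y') <= B * (Rabs (x - x') + Rabs (y - y'))).

Lemma BL_smooth f : smooth2 f -> periodic2 f -> BL f.
Proof.
  intros Hf Hp.
  destruct (periodic2_bounded f Hp (smooth2_continuity f Hf)) as [B0 H0].
  destruct (periodic2_bounded (pd 0 f)) as [B1 H1].
  { now apply periodic2_pd. } { now apply smooth2_continuity, smooth2_pd. }
  destruct (periodic2_bounded (pd 1 f)) as [B2 H2].
  { now apply periodic2_pd. } { now apply smooth2_continuity, smooth2_pd. }
  pose proof (Rle_trans _ _ _ (Rabs_pos _) (H0 0 0)) as P0.
  pose proof (Rle_trans _ _ _ (Rabs_pos _) (H1 0 0)) as P1.
  pose proof (Rle_trans _ _ _ (Rabs_pos _) (H2 0 0)) as P2.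
  exists (B0 + B1 + B2). split; [lra|]. split.
  - intros x y. specialize (H0 x y). lra.
  - intros x y x' y'.
    assert (E1 := lipschitz_of_bounded_derive (fun t => f t y) (fun t => pd 0 f t y) B1
      (fun t => Derive_correct (fun s => f s y) t (proj1 (proj2 (Hf nil) t y)))
      (fun t => H1 t y) x x').
    assert (E2 := lipschitz_of_bounded_derive (fun t => f x' t) (fun t => pd 1 f x' t) B2
      (fun t => Derive_correct (fun s => f x' s) t (proj2 (proj2 (Hf nil) x' t)))
      (fun t => H2 x' t) y y').
    simpl in E1, E2.
    replace (f x y - f x' y') with ((f x y - f x' y) + (f x' y - f x' y')) by ring.
    eapply Rle_trans; [apply Rabs_triang|].
    pose proof (Rabs_pos (x - x')). pose proof (Rabs_pos (y - y')). nra.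
Qed.

Lemma BL_const c : BL (fun _ _ => c).
Proof.
  exists (Rabs c). pose proof (Rabs_pos c). split; [lra|split; intros; [lra|]].
  rewrite Rminus_diag, Rabs_R0. apply Rmult_le_pos; [lra|].
  pose proof (Rabs_pos (x - x')); pose proof (Rabs_pos (y - y')); lra.
Qed.

Lemma BL_plus f h : BL f -> BL h -> BL (fun x y => f x y + h x y).
Proof.
  intros [B [HB [H1 H2]]] [C [HC [H3 H4]]]. exists (B + C). split; [lra|split].
  - intros x y. eapply Rle_trans; [apply Rabs_triang|]. specialize (H1 x y); specialize (H3 x y); lra.
  - intros x y x' y'.
    replace (f x y + h x y - (f x' y' + h x' y')) with ((f x y - f x' y') + (h x y - h x' y')) by ring.
    eapply Rle_trans; [apply Rabs_triang|].
    specialize (H2 x y x' y'); specialize (H4 x y x' y'); lra.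
Qed.

Lemma BL_opp f : BL f -> BL (fun x y => - f x y).
Proof.
  intros [B [HB [H1 H2]]]. exists B. split; [lra|split].
  - intros x y. rewrite Rabs_Ropp. apply H1.
  - intros x y x' y'. replace (- f x y - - f x' y') with (- (f x y - f x' y')) by ring.
    rewrite Rabs_Ropp. apply H2.
Qed.

Lemma BL_minus f h : BL f -> BL h -> BL (fun x y => f x y - h x y).
Proof. intros Hf Hh. apply (BL_plus f (fun x y => - h x y) Hf (BL_opp h Hh)). Qed.

Lemma BL_mult f h : BL f -> BL h -> BL (fun x y => f x y * h x y).
Proof.
  intros [B [HB [H1 H2]]] [C [HC [H3 H4]]]. exists (2 * (B * C)).
  assert (0 <= B * C) by (apply Rmult_le_pos; lra).
  split; [lra|split].
  - intros x y. rewrite Rabs_mult.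
    assert (Rabs (f x y) * Rabs (h x y) <= B * C)
      by (apply Rmult_le_compat; auto using Rabs_pos).
    lra.
  - intros x y x' y'.
    replace (f x y * h x y - f x' y' * h x' y') with
      (f x y * (h x y - h x' y') + (f x y - f x' y') * h x' y') by ring.
    eapply Rle_trans; [apply Rabs_triang|]. rewrite !Rabs_mult.
    specialize (H2 x y x' y'); specialize (H4 x y x' y').
    specialize (H1 x y). specialize (H3 x' y').
    set (D := Rabs (x - x') + Rabs (y - y')) in *.
    assert (Rabs (f x y) * Rabs (h x y - h x' y') <= B * (C * D))
      by (apply Rmult_le_compat; auto using Rabs_pos).
    assert (Rabs (f x y - f x' y') * Rabs (h x' y') <= B * D * C)
      by (apply Rmult_le_compat; auto using Rabs_pos).
    lra.
Qed.

Lemma BL_inv f m : 0 < m -> (forall x y, m <= f x y) -> BL f -> BL (fun x y => / f x y).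
Proof.
  intros Hm Hf [B [HB [H1 H2]]].
  assert (Hi : forall x y, 0 < / f x y <= / m).
  { intros x y. specialize (Hf x y). split; [apply Rinv_0_lt_compat; lra | apply Rinv_le_contravar; lra]. }
  assert (0 < / m) by now apply Rinv_0_lt_compat.
  exists (/ m + B * (/ m * / m)).
  assert (0 <= B * (/ m * / m)) by (repeat apply Rmult_le_pos; lra).
  split; [lra|split].
  - intros x y. specialize (Hi x y). rewrite Rabs_pos_eq; lra.
  - intros x y x' y'. pose proof (Hf x y); pose proof (Hf x' y').
    replace (/ f x y - / f x' y') with ((f x' y' - f x y) * (/ f x y * / f x' y')) by (field; lra).
    rewrite Rabs_mult. rewrite (Rabs_pos_eq (/ f x y * / f x' y'))
      by (apply Rmult_le_pos; apply Rlt_le, Hi).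
    rewrite Rabs_minus_sym. specialize (H2 x y x' y').
    pose proof (Rabs_pos (x - x')); pose proof (Rabs_pos (y - y')).
    set (D := Rabs (x - x') + Rabs (y - y')) in *.
    assert (/ f x y * / f x' y' <= / m * / m).
    { apply Rmult_le_compat; try apply Hi; apply Rlt_le, Hi. }
    assert (Rabs (f x y - f x' y') * (/ f x y * / f x' y') <= B * D * (/ m * / m)).
    { apply Rmult_le_compat; auto using Rabs_pos. apply Rmult_le_pos; apply Rlt_le, Hi. }
    assert (0 <= / m * D) by (apply Rmult_le_pos; unfold D; lra). lra.
Qed.

Lemma continuity_of_BL f : BL f -> forall x y, continuity_2d_pt f x y.
Proof.
  intros [B [HB [_ H]]] x y eps.
  assert (Hd : 0 < eps / (2 * B + 1)) by (apply Rdiv_lt_0_compat; [apply cond_pos | lra]).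
  exists (mkposreal _ Hd). simpl. intros u v Hu Hv.
  eapply Rle_lt_trans; [apply H|].
  apply Rle_lt_trans with (B * (2 * (eps / (2 * B + 1)))).
  - apply Rmult_le_compat_l; lra.
  - apply Rlt_le_trans with ((2 * B + 1) * (eps / (2 * B + 1))); [lra|].
    right. field. lra.
Qed.

(** * The l1 distance on the plane *)

(** The l1 norm keeps estimates linear in absolute values of coordinates; comparison with Riemannian
    or Euclidean norms costs only constant factors. *)
Definition nrm (a : R * R) : R := Rabs (fst a) + Rabs (snd a).
Definition dl1 (p q : R * R) : R := Rabs (fst p - fst q) + Rabs (snd p - snd q).

Lemma nrm_pos a : 0 <= nrm a.
Proof. unfold nrm. pose proof (Rabs_pos (fst a)); pose proof (Rabs_pos (snd a)); lra. Qed.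

Lemma dl1_pos p q : 0 <= dl1 p q.
Proof. apply (nrm_pos (fst p - fst q, snd p - snd q)). Qed.

Lemma dl1_sym p q : dl1 p q = dl1 q p.
Proof. unfold dl1. now rewrite (Rabs_minus_sym (fst p)), (Rabs_minus_sym (snd p)). Qed.

Lemma dl1_triang p q r : dl1 p r <= dl1 p q + dl1 q r.
Proof.
  unfold dl1.
  replace (fst p - fst r) with ((fst p - fst q) + (fst q - fst r)) by ring.
  replace (snd p - snd r) with ((snd p - snd q) + (snd q - snd r)) by ring.
  pose proof (Rabs_triang (fst p - fst q) (fst q - fst r)).
  pose proof (Rabs_triang (snd p - snd q) (snd q - snd r)). lra.
Qed.

Lemma dl1_refl p : dl1 p p = 0.
Proof. unfold dl1. rewrite !Rminus_diag, Rabs_R0. lra. Qed.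

Lemma dl1_eq0 p q : dl1 p q <= 0 -> p = q.
Proof.
  unfold dl1. intros H. pose proof (Rabs_pos (fst p - fst q)). pose proof (Rabs_pos (snd p - snd q)).
  assert (E1 : fst p - fst q = 0) by (destruct (Req_dec (fst p - fst q) 0) as [|N]; [assumption|apply Rabs_pos_lt in N; lra]).
  assert (E2 : snd p - snd q = 0) by (destruct (Req_dec (snd p - snd q) 0) as [|N]; [assumption|apply Rabs_pos_lt in N; lra]).
  destruct p, q; simpl in *. f_equal; lra.
Qed.

Lemma bilinear_bound (q11 q12 q21 q22 B : R) (a b : R * R) :
  Rabs q11 <= B -> Rabs q12 <= B -> Rabs q21 <= B -> Rabs q22 <= B ->
  Rabs (q11 * cp a 0 * cp b 0 + q12 * cp a 0 * cp b 1 + q21 * cp a 1 * cp b 0 + q22 * cp a 1 * cp b 1)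
  <= B * nrm a * nrm b.
Proof.
  intros H1 H2 H3 H4. unfold nrm. simpl.
  assert (Ht : forall q u v, Rabs q <= B -> Rabs (q * u * v) <= B * (Rabs u * Rabs v)).
  { intros q u v Hq. rewrite !Rabs_mult, Rmult_assoc. apply Rmult_le_compat_r; [|assumption].
    apply Rmult_le_pos; apply Rabs_pos. }
  eapply Rle_trans; [apply Rabs_triang|]. eapply Rle_trans; [apply Rplus_le_compat_r, Rabs_triang|].
  eapply Rle_trans; [apply Rplus_le_compat_r, Rplus_le_compat_r, Rabs_triang|].
  pose proof (Ht q11 (fst a) (fst b) H1). pose proof (Ht q12 (fst a) (snd b) H2).
  pose proof (Ht q21 (snd a) (fst b) H3). pose proof (Ht q22 (snd a) (snd b) H4). nra.
Qed.

(** * Constants of a torus metric *)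

Lemma BL_gc g : is_torus_metric g -> forall i j, BL (gc g i j).
Proof. intros (S1 & S2 & S3 & P1 & P2 & P3 & _) [|i] [|j]; simpl; now apply BL_smooth. Qed.

Lemma BL_pd_gc g : is_torus_metric g -> forall i j k, BL (pd k (gc g i j)).
Proof.
  intros (S1 & S2 & S3 & P1 & P2 & P3 & _) [|i] [|j] k; simpl;
    apply BL_smooth; try apply smooth2_pd; try apply periodic2_pd; assumption.
Qed.

Lemma BL_ext f h : (forall x y, f x y = h x y) -> BL f -> BL h.
Proof.
  intros E [B [H1 [H2 H3]]]. exists B. split; [assumption|].
  split; intros; rewrite <- !E; auto.
Qed.

Lemma BL_detg g : is_torus_metric g -> BL (detg g).
Proof.
  intros Hg. apply (BL_ext (fun x y => m11 g x y * m22 g x y - m12 g x y * m12 g x y)).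
  { intros; unfold detg; ring. }
  apply BL_minus; apply BL_mult;
    [apply (BL_gc g Hg 0 0) | apply (BL_gc g Hg 1 1) | apply (BL_gc g Hg 0 1) | apply (BL_gc g Hg 0 1)].
Qed.

(** The reciprocal of the determinant is again continuous and periodic, hence bounded; its bound is
    turned over. *)
Lemma detg_lower_bound g : is_torus_metric g -> exists m, 0 < m /\ forall x y, m <= detg g x y.
Proof.
  intros Hg.
  assert (Hpos : forall x y, 0 < detg g x y) by (intros x y; apply Hg).
  destruct (periodic2_bounded (fun x y => / detg g x y)) as [B HB].
  - destruct Hg as (_ & _ & _ & P1 & P2 & P3 & _). intros x y. unfold detg.
    now rewrite (proj1 (P1 x y)), (proj1 (P2 x y)), (proj1 (P3 x y)),
      (proj2 (P1 x y)), (proj2 (P2 x y)), (proj2 (P3 x y)).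
  - intros x y. apply continuity_2d_pt_inv; [apply (continuity_of_BL _ (BL_detg g Hg))|].
    specialize (Hpos x y); lra.
  - assert (B0 : 0 < B).
    { specialize (HB 0 0). eapply Rlt_le_trans; [|apply HB].
      apply Rabs_pos_lt. apply Rinv_neq_0_compat. specialize (Hpos 0 0); lra. }
    exists (/ B). split; [now apply Rinv_0_lt_compat|].
    intros x y. specialize (HB x y). specialize (Hpos x y).
    rewrite <- (Rinv_inv (detg g x y)). apply Rinv_le_contravar.
    + now apply Rinv_0_lt_compat.
    + rewrite Rabs_pos_eq in HB; [assumption|]. now apply Rlt_le, Rinv_0_lt_compat.
Qed.

Lemma BL_ginv g : is_torus_metric g -> forall k l, BL (ginv g k l).
Proof.
  intros Hg k l. destruct (detg_lower_bound g Hg) as [m [Hm Hd]].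
  pose proof (BL_inv _ m Hm Hd (BL_detg g Hg)) as Hi.
  destruct k, l; unfold ginv, Rdiv; (apply BL_mult; [|exact Hi]);
    try (apply BL_opp); [apply (BL_gc g Hg 1 1) | apply (BL_gc g Hg 0 1) | apply (BL_gc g Hg 0 1) | apply (BL_gc g Hg 0 0)].
Qed.

Lemma BL_chr g : is_torus_metric g -> forall k i j, BL (chr g k i j).
Proof.
  intros Hg k i j. unfold chr.
  apply (BL_mult (fun _ _ => / 2)); [apply BL_const|].
  apply BL_plus; (apply BL_mult; [now apply BL_ginv|]);
    (apply BL_minus; [apply BL_plus|]); now apply BL_pd_gc.
Qed.

Lemma BL_common_bound (fs : list (R -> R -> R)) : (forall f, In f fs -> BL f) ->
  exists B, 0 <= B /\ forall f, In f fs -> (forall x y, Rabs (f x y) <= B) /\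
    (forall p q : R * R, Rabs (f (fst p) (snd p) - f (fst q) (snd q)) <= B * dl1 p q).
Proof.
  induction fs as [|f fs IH]; intros H.
  - exists 0. split; [lra|]. intros f [].
  - destruct IH as [B [HB H1]]; [intros; apply H; now right|].
    destruct (H f) as [C [HC [H2 H3]]]; [now left|].
    exists (B + C). split; [lra|]. intros h [<-|Hh].
    + split; [intros x y; specialize (H2 x y); lra|].
      intros p q. specialize (H3 (fst p) (snd p) (fst q) (snd q)). fold (dl1 p q) in H3.
      pose proof (dl1_pos p q). nra.
    + destruct (H1 h Hh) as [H4 H5]. split; [intros x y; specialize (H4 x y); lra|].
      intros p q. specialize (H5 p q). pose proof (dl1_pos p q). nra.
Qed.

(** The quantitative content of the compactness of the torus. Later estimates refer to [lam], [Lam]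
    and [K] only, and so are uniform over all geodesics and all times. *)
Record metric_bounds (g : metric2) (lam Lam K : R) : Prop := {
  mb_lam : 0 < lam;
  mb_Lam : 0 < Lam;
  mb_K : 0 < K;
  mb_low : forall x a, (lam * nrm a) ^ 2 <= gq g x a a;
  mb_up : forall x a, gq g x a a <= (Lam * nrm a) ^ 2;
  mb_gqlip : forall x y a, Rabs (gq g x a a - gq g y a a) <= K * dl1 x y * nrm a ^ 2;
  mb_gq : forall x a b, Rabs (gq g x a b) <= K * nrm a * nrm b;
  mb_pd : forall i j k x y, Rabs (pd k (gc g i j) x y) <= K;
  mb_chr : forall k x a b, Rabs (quad_chr g k x a b) <= K * nrm a * nrm b;
  mb_chrlip : forall k x y a b,
    Rabs (quad_chr g k x a a - quad_chr g k y b b) <= K * (dl1 x y * nrm a ^ 2 + dl1 a b * (nrm a + nrm b))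
}.

Arguments mb_lam {g lam Lam K}.
Arguments mb_Lam {g lam Lam K}.
Arguments mb_K {g lam Lam K}.
Arguments mb_low {g lam Lam K}.
Arguments mb_up {g lam Lam K}.
Arguments mb_gqlip {g lam Lam K}.
Arguments mb_gq {g lam Lam K}.
Arguments mb_pd {g lam Lam K}.
Arguments mb_chr {g lam Lam K}.
Arguments mb_chrlip {g lam Lam K}.

Lemma pd_S k f : pd (S k) f = pd 1 f.
Proof. reflexivity. Qed.

Lemma chr_S k i j g : chr g (S k) i j = chr g 1 i j.
Proof. reflexivity. Qed.

Lemma torus_metric_bounds g : is_torus_metric g -> exists lam Lam K, metric_bounds g lam Lam K.
Proof.
  intros Hg.
  set (fs := [gc g 0 0; gc g 0 1; gc g 1 1;
    pd 0 (gc g 0 0); pd 0 (gc g 0 1); pd 0 (gc g 1 1); pd 1 (gc g 0 0); pd 1 (gc g 0 1); pd 1 (gc g 1 1);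
    chr g 0 0 0; chr g 0 0 1; chr g 0 1 0; chr g 0 1 1; chr g 1 0 0; chr g 1 0 1; chr g 1 1 0; chr g 1 1 1]%nat).
  destruct (BL_common_bound fs) as [B [HB Hfs]].
  { intros f Hf. unfold fs in Hf. cbn [In] in Hf.
    repeat (destruct Hf as [<-|Hf];
      [first [now apply (BL_gc g Hg) | now apply (BL_pd_gc g Hg) | now apply (BL_chr g Hg)]|]).
    destruct Hf. }
  destruct (detg_lower_bound g Hg) as [m [Hm Hdet]].
  assert (Hgc : forall i j, In (gc g i j) fs).
  { intros [|i] [|j]; simpl; tauto. }
  assert (Hpd : forall i j k, In (pd k (gc g i j)) fs).
  { intros [|i] [|j] [|k]; rewrite ?pd_S; simpl; tauto. }
  assert (Hchr : forall k i j, (i <= 1)%nat -> (j <= 1)%nat -> In (chr g k i j) fs).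
  { intros [|k] i j Hi Hj; rewrite ?chr_S; destruct i as [|[|i]]; try lia; destruct j as [|[|j]]; try lia;
      simpl; tauto. }
  assert (Hc1 : forall k i j x y, (i <= 1)%nat -> (j <= 1)%nat -> Rabs (chr g k i j x y) <= B)
    by (intros k i j x y Hi Hj; apply (Hfs _ (Hchr k i j Hi Hj))).
  assert (Hc2 : forall k i j (p q : R * R), (i <= 1)%nat -> (j <= 1)%nat ->
    Rabs (chr g k i j (fst p) (snd p) - chr g k i j (fst q) (snd q)) <= B * dl1 p q)
    by (intros k i j x y Hi Hj; apply (Hfs _ (Hchr k i j Hi Hj))).
  assert (Hgq : forall x a b, Rabs (gq g x a b) <= B * nrm a * nrm b).
  { intros x a b. unfold gq. apply bilinear_bound; now apply (Hfs _ (Hgc _ _)). }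
  (* The smaller eigenvalue of the coefficient matrix is at least determinant over trace, hence at
     least [m / (2 * B + 1)]. The factor 4 absorbs the passage from the Euclidean to the l1 norm. *)
  exists (sqrt (m / (4 * (2 * B + 1)))), (sqrt (B + 1)), (B + 1).
  assert (Hr : 0 < m / (4 * (2 * B + 1))) by (apply Rdiv_lt_0_compat; lra).
  split; try lra.
  - now apply sqrt_lt_R0.
  - apply sqrt_lt_R0; lra.
  - intros x [a b]. rewrite Rpow_mult_distr, pow2_sqrt by lra.
    unfold nrm; simpl fst; simpl snd.
    assert (Hn : (Rabs a + Rabs b) ^ 2 <= 2 * (a ^ 2 + b ^ 2)).
    { rewrite (pow2_abs a), (pow2_abs b) || rewrite <- (pow2_abs a), <- (pow2_abs b).
      pose proof (pow2_ge_0 (Rabs a - Rabs b)). nra. }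
    unfold gq, gc, cp; cbn [fst snd].
    set (p := m11 g (fst x) (snd x)). set (q := m12 g (fst x) (snd x)). set (r := m22 g (fst x) (snd x)).
    assert (Hd : m <= p * r - q ^ 2) by apply (Hdet (fst x) (snd x)).
    assert (Hp : 0 < p) by apply Hg.
    assert (Hrr : 0 < r) by (pose proof (pow2_ge_0 q); nra).
    assert (Hpr : p + r <= 2 * B + 1).
    { pose proof (proj1 (Hfs _ (Hgc 0 0)%nat) (fst x) (snd x)) as E1. pose proof (proj1 (Hfs _ (Hgc 1 1)%nat) (fst x) (snd x)) as E2.
      simpl in E1, E2. fold p in E1. fold r in E2. pose proof (Rle_abs p). pose proof (Rle_abs r). lra. }
    (* Cayley-Hamilton: trace times the quadratic form equals the determinant times the squared
       Euclidean norm plus the squared norm of the image vector. *)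
    assert (Hq : m * (a ^ 2 + b ^ 2) <= (p + r) * (p * a * a + q * a * b + q * b * a + r * b * b)).
    { assert ((p * r - q ^ 2) * (a ^ 2 + b ^ 2) <= (p + r) * (p * a * a + q * a * b + q * b * a + r * b * b)).
      { assert (0 <= (p * a + q * b) ^ 2 + (q * a + r * b) ^ 2)
          by (pose proof (pow2_ge_0 (p * a + q * b)); pose proof (pow2_ge_0 (q * a + r * b)); lra). nra. }
      assert (0 <= a ^ 2 + b ^ 2) by (pose proof (pow2_ge_0 a); pose proof (pow2_ge_0 b); lra). nra. }
    set (Q := p * a * a + q * a * b + q * b * a + r * b * b) in *.
    assert (HQ : 0 <= Q).
    { assert (0 <= (p + r) * Q).
      { eapply Rle_trans; [|exact Hq]. apply Rmult_le_pos; [lra|].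
        pose proof (pow2_ge_0 a); pose proof (pow2_ge_0 b); lra. }
      apply Rmult_le_reg_l with (p + r); lra. }
    apply Rmult_le_reg_l with (4 * (2 * B + 1)); [lra|].
    replace (4 * (2 * B + 1) * (m / (4 * (2 * B + 1)) * (Rabs a + Rabs b) ^ 2))
      with (m * (Rabs a + Rabs b) ^ 2) by (field; lra).
    assert (m * (Rabs a + Rabs b) ^ 2 <= 2 * (m * (a ^ 2 + b ^ 2))) by nra.
    assert ((p + r) * Q <= (2 * B + 1) * Q) by (apply Rmult_le_compat_r; lra).
    assert (0 <= (p + r) * Q) by (apply Rmult_le_pos; lra).
    lra.
  - intros x a. rewrite Rpow_mult_distr, pow2_sqrt by lra.
    pose proof (Rle_abs (gq g x a a)). specialize (Hgq x a a). pose proof (pow2_ge_0 (nrm a)). nra.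
  - intros x y a.
    replace (gq g x a a - gq g y a a) with
     ((gc g 0 0 (fst x) (snd x) - gc g 0 0 (fst y) (snd y)) * cp a 0 * cp a 0 +
      (gc g 0 1 (fst x) (snd x) - gc g 0 1 (fst y) (snd y)) * cp a 0 * cp a 1 +
      (gc g 1 0 (fst x) (snd x) - gc g 1 0 (fst y) (snd y)) * cp a 1 * cp a 0 +
      (gc g 1 1 (fst x) (snd x) - gc g 1 1 (fst y) (snd y)) * cp a 1 * cp a 1)
      by (unfold gq; ring).
    eapply Rle_trans; [apply (bilinear_bound _ _ _ _ (B * dl1 x y)); now apply (Hfs _ (Hgc _ _))|].
    pose proof (dl1_pos x y). pose proof (pow2_ge_0 (nrm a)).
    assert (0 <= dl1 x y * nrm a ^ 2) by (apply Rmult_le_pos; lra). nra.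
  - intros x a b. specialize (Hgq x a b). pose proof (nrm_pos a). pose proof (nrm_pos b).
    assert (0 <= nrm a * nrm b) by (apply Rmult_le_pos; lra). nra.
  - intros i j k x y. pose proof (proj1 (Hfs _ (Hpd i j k)) x y). lra.
  - intros k x a b.
    assert (Rabs (quad_chr g k x a b) <= B * nrm a * nrm b).
    { unfold quad_chr. apply bilinear_bound; (apply Hc1 || apply Hc2); lia. }
    pose proof (nrm_pos a). pose proof (nrm_pos b).
    assert (0 <= nrm a * nrm b) by (apply Rmult_le_pos; lra). nra.
  - intros k x y a b.
    set (D := (fst a - fst b, snd a - snd b)).
    replace (quad_chr g k x a a - quad_chr g k y b b) with
     (((chr g k 0 0 (fst x) (snd x) - chr g k 0 0 (fst y) (snd y)) * cp a 0 * cp a 0 +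
      (chr g k 0 1 (fst x) (snd x) - chr g k 0 1 (fst y) (snd y)) * cp a 0 * cp a 1 +
      (chr g k 1 0 (fst x) (snd x) - chr g k 1 0 (fst y) (snd y)) * cp a 1 * cp a 0 +
      (chr g k 1 1 (fst x) (snd x) - chr g k 1 1 (fst y) (snd y)) * cp a 1 * cp a 1)
      + (quad_chr g k y D a + quad_chr g k y b D))
      by (unfold quad_chr, D; simpl; ring).
    assert (E : forall u v, Rabs (quad_chr g k y u v) <= B * nrm u * nrm v).
    { intros u v. unfold quad_chr. apply bilinear_bound; (apply Hc1 || apply Hc2); lia. }
    eapply Rle_trans; [apply Rabs_triang|].
    eapply Rle_trans; [apply Rplus_le_compat; [apply (bilinear_bound _ _ _ _ (B * dl1 x y));
       (apply Hc1 || apply Hc2); lia | apply Rabs_triang]|].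
    pose proof (E D a) as E1. pose proof (E b D) as E2.
    change (nrm D) with (dl1 a b) in E1, E2.
    pose proof (dl1_pos x y). pose proof (dl1_pos a b). pose proof (nrm_pos a). pose proof (nrm_pos b).
    assert (0 <= dl1 x y * nrm a ^ 2) by (apply Rmult_le_pos; [lra | apply pow2_ge_0]).
    assert (0 <= dl1 a b * (nrm a + nrm b)) by (apply Rmult_le_pos; lra). nra.
Qed.

(** * The Riemannian distance *)

Lemma continuous_comp_2d (f : R -> R -> R) (x y : R -> R) (t : R) :
  continuity_2d_pt f (x t) (y t) -> continuous x t -> continuous y t ->
  continuous (fun s => f (x s) (y s)) t.
Proof.
  intros Hf Hx Hy. apply (continuous_comp_2 x y f); [assumption | assumption |].
  now apply continuity_2d_pt_filterlim.
Qed.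

Lemma continuous_Rmult (f h : R -> R) (t : R) :
  continuous f t -> continuous h t -> continuous (fun s => f s * h s) t.
Proof. intros Hf Hh. apply (continuous_mult f h t Hf Hh). Qed.

Lemma continuous_Rplus (f h : R -> R) (t : R) :
  continuous f t -> continuous h t -> continuous (fun s => f s + h s) t.
Proof. intros Hf Hh. apply (continuous_plus f h t Hf Hh). Qed.

Lemma continuous_gq g (x a b : R -> R * R) (t : R) : is_torus_metric g ->
  continuous (fun s => fst (x s)) t -> continuous (fun s => snd (x s)) t ->
  continuous (fun s => fst (a s)) t -> continuous (fun s => snd (a s)) t ->
  continuous (fun s => fst (b s)) t -> continuous (fun s => snd (b s)) t ->
  continuous (fun s => gq g (x s) (a s) (b s)) t.
Proof.
  intros Hg Hx1 Hx2 Ha1 Ha2 Hb1 Hb2. unfold gq.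
  assert (Hc : forall i j, continuous (fun s => gc g i j (fst (x s)) (snd (x s))) t).
  { intros i j. apply continuous_comp_2d; [|assumption|assumption].
    apply continuity_of_BL. now apply BL_gc. }
  assert (Ht : forall i j (u v : R -> R), continuous u t -> continuous v t ->
    continuous (fun s => gc g i j (fst (x s)) (snd (x s)) * u s * v s) t).
  { intros i j u v Hu Hv.
    exact (continuous_Rmult _ _ _ (continuous_Rmult _ _ _ (Hc i j) Hu) Hv). }
  exact (continuous_Rplus _ _ _ (continuous_Rplus _ _ _ (continuous_Rplus _ _ _
    (Ht 0 0 _ _ Ha1 Hb1) (Ht 0 1 _ _ Ha1 Hb2)) (Ht 1 0 _ _ Ha2 Hb1)) (Ht 1 1 _ _ Ha2 Hb2))%nat.
Qed.

Lemma continuous_of_is_derive (f : R -> R) t l : is_derive f t l -> continuous f t.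
Proof. intros H. apply (ex_derive_continuous f t). now exists l. Qed.

Lemma continuous_length_density g c c' : is_torus_metric g -> C1curve c c' ->
  forall t, continuous (fun t => sqrt (gq g (c t) (c' t) (c' t))) t.
Proof.
  intros Hg Hc t. destruct (Hc t) as (D1 & D2 & C1 & C2).
  apply (continuous_comp (fun t => gq g (c t) (c' t) (c' t)) sqrt).
  - apply continuous_gq; try assumption; eapply continuous_of_is_derive; eassumption.
  - apply continuous_sqrt.
Qed.

Lemma ex_RInt_continuous_all (f : R -> R) a b : (forall t, continuous f t) -> ex_RInt f a b.
Proof. intros H. apply (ex_RInt_continuous f). intros; apply H. Qed.

Lemma is_RInt_continuous_all (f : R -> R) a b : (forall t, continuous f t) -> is_RInt f a b (RInt f a b).
Proof. intros H. exact (@RInt_correct R_CompleteNormedModule f a b (ex_RInt_continuous_all f a b H)). Qed.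

Definition curve_length (g : metric2) (p q : R * R) (L : R) : Prop :=
  exists c c', C1curve c c' /\ c 0 = p /\ c 1 = q /\ L = glength g c c'.

(** Each coordinate of the displacement is at most the integral of the absolute coordinate velocity,
    and the length density dominates [lam] times the l1 speed. *)
Lemma glength_ge g lam Lam K c c' : is_torus_metric g -> metric_bounds g lam Lam K ->
  C1curve c c' -> lam * dl1 (c 0) (c 1) <= glength g c c'.
Proof.
  intros Hg Hb Hc. pose proof (mb_lam Hb) as Hl.
  assert (Hcont : forall t, continuous (fun s => fst (c' s)) t /\ continuous (fun s => snd (c' s)) t)
    by (intros t; split; apply (Hc t)).
  assert (HI1 : is_RInt (fun s => fst (c' s)) 0 1 (fst (c 1) - fst (c 0))).
  { apply (is_RInt_derive (fun s => fst (c s)) (fun s => fst (c' s))); intros; apply (Hc x). }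
  assert (HI2 : is_RInt (fun s => snd (c' s)) 0 1 (snd (c 1) - snd (c 0))).
  { apply (is_RInt_derive (fun s => snd (c s)) (fun s => snd (c' s))); intros; apply (Hc x). }
  assert (Ha : forall f : R -> R, (forall t : R, continuous f t) -> forall t, continuous (fun s => Rabs (f s)) t).
  { intros f Hf t. apply (continuous_comp f Rabs); [apply Hf | apply continuous_Rabs]. }
  assert (Hn1 : forall t, continuous (fun s => Rabs (fst (c' s))) t) by (apply Ha; intros; apply Hcont).
  assert (Hn2 : forall t, continuous (fun s => Rabs (snd (c' s))) t) by (apply Ha; intros; apply Hcont).
  assert (B1 : Rabs (fst (c 1) - fst (c 0)) <= RInt (fun s => Rabs (fst (c' s))) 0 1).
  { rewrite <- (is_RInt_unique _ _ _ _ HI1).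
    apply (abs_RInt_le (fun s => fst (c' s))); [lra|]. now exists (fst (c 1) - fst (c 0)). }
  assert (B2 : Rabs (snd (c 1) - snd (c 0)) <= RInt (fun s => Rabs (snd (c' s))) 0 1).
  { rewrite <- (is_RInt_unique _ _ _ _ HI2).
    apply (abs_RInt_le (fun s => snd (c' s))); [lra|]. now exists (snd (c 1) - snd (c 0)). }
  apply Rle_trans with (RInt (fun s => lam * (Rabs (fst (c' s)) + Rabs (snd (c' s)))) 0 1).
  - assert (E : RInt (fun s => lam * (Rabs (fst (c' s)) + Rabs (snd (c' s)))) 0 1 =
      lam * (RInt (fun s => Rabs (fst (c' s))) 0 1 + RInt (fun s => Rabs (snd (c' s))) 0 1)).
    { apply is_RInt_unique. apply (is_RInt_scal (fun s => Rabs (fst (c' s)) + Rabs (snd (c' s)))).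
      apply (is_RInt_plus (fun s => Rabs (fst (c' s))) (fun s => Rabs (snd (c' s))));
        now apply is_RInt_continuous_all. }
    rewrite E. apply Rmult_le_compat_l; [lra|].
    unfold dl1. rewrite (Rabs_minus_sym (fst (c 0))), (Rabs_minus_sym (snd (c 0))). lra.
  - apply RInt_le; [lra | | |].
    + apply ex_RInt_continuous_all. intros t. apply continuous_Rmult; [apply continuous_const | now apply continuous_Rplus].
    + apply ex_RInt_continuous_all. now apply continuous_length_density.
    + intros t _. fold (nrm (c' t)). rewrite <- (sqrt_pow2 (lam * nrm (c' t))).
      2:{ apply Rmult_le_pos; [lra | apply nrm_pos]. }
      apply sqrt_le_1_alt. apply (mb_low Hb).
Qed.

Lemma C1curve_line p q : C1curve (fun t => (fst p + t * (fst q - fst p), snd p + t * (snd q - snd p)))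
   (fun _ => (fst q - fst p, snd q - snd p)).
Proof.
  intros t; simpl. split; [|split; [|split; apply continuous_const]]; auto_derive; trivial; ring.
Qed.

Lemma pair_line_0 (p q : R * R) : (fst p + 0 * (fst q - fst p), snd p + 0 * (snd q - snd p)) = p.
Proof. destruct p; simpl. f_equal; ring. Qed.

Lemma pair_line_1 (p q : R * R) : (fst p + 1 * (fst q - fst p), snd p + 1 * (snd q - snd p)) = q.
Proof. destruct q; simpl. f_equal; ring. Qed.

(** [dist] applies [real], which would turn an infinite bound into 0. Finiteness holds because
    lengths are nonnegative and the straight segment is a competitor. *)
Lemma dist_Glb g p q : is_torus_metric g -> is_glb_Rbar (curve_length g p q) (Finite (dist g p q)).
Proof.
  intros Hg. destruct (torus_metric_bounds g Hg) as (lam & Lam & K & Hb).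
  pose proof (Glb_Rbar_correct (curve_length g p q)) as HG. unfold dist. fold (curve_length g p q).
  assert (Hf : is_finite (Glb_Rbar (curve_length g p q))).
  { destruct HG as [H1 H2].
    assert (H0 : Rbar_le (Finite 0) (Glb_Rbar (curve_length g p q))).
    { apply H2. intros L (c & c' & Hc & E0 & E1 & ->). simpl.
      eapply Rle_trans; [|eapply glength_ge; eassumption].
      apply Rmult_le_pos; [apply Rlt_le, (mb_lam Hb) | apply dl1_pos]. }
    assert (H3 : Rbar_le (Glb_Rbar (curve_length g p q))
       (Finite (glength g (fun t => (fst p + t * (fst q - fst p), snd p + t * (snd q - snd p)))
               (fun _ => (fst q - fst p, snd q - snd p))))).
    { apply H1. do 2 eexists. split; [apply C1curve_line|].
      split; [apply pair_line_0|split; [apply pair_line_1|reflexivity]]. }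
    destruct (Glb_Rbar (curve_length g p q)); simpl in *; try easy. }
  rewrite Hf. exact HG.
Qed.

Lemma dist_le_glength g c c' : is_torus_metric g -> C1curve c c' -> dist g (c 0) (c 1) <= glength g c c'.
Proof.
  intros Hg Hc. apply (proj1 (dist_Glb g (c 0) (c 1) Hg)). exists c, c'. auto.
Qed.

Lemma dist_approx g p q eps : is_torus_metric g -> 0 < eps ->
  exists c c', C1curve c c' /\ c 0 = p /\ c 1 = q /\ glength g c c' < dist g p q + eps.
Proof.
  intros Hg He. apply NNPP. intros Hn.
  assert (H : Rbar_le (Finite (dist g p q + eps)) (Finite (dist g p q))).
  { apply (proj2 (dist_Glb g p q Hg)). intros L (c & c' & Hc & E0 & E1 & ->). simpl.
    apply Rnot_lt_le. intros Hlt. apply Hn. exists c, c'. auto. }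
  simpl in H. lra.
Qed.

Lemma dist_ge g lam Lam K p q : is_torus_metric g -> metric_bounds g lam Lam K -> lam * dl1 p q <= dist g p q.
Proof.
  intros Hg Hb. apply Rnot_lt_le. intros Hlt.
  destruct (dist_approx g p q (lam * dl1 p q - dist g p q) Hg) as (c & c' & Hc & <- & <- & Hl); [lra|].
  pose proof (glength_ge g lam Lam K c c' Hg Hb Hc). lra.
Qed.

(** The straight segment is the test curve; its speed bound is left to the application, a global
    constant in [dist_le] and a sharp local one in [no_corner]. *)
Lemma dist_le_segment g p q S : is_torus_metric g -> 0 <= S ->
  (forall t, 0 <= t <= 1 ->
    gq g (fst p + t * (fst q - fst p), snd p + t * (snd q - snd p))
      (fst q - fst p, snd q - snd p) (fst q - fst p, snd q - snd p) <= S ^ 2) ->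
  dist g p q <= S.
Proof.
  intros Hg HS H. pose proof (dist_le_glength g _ _ Hg (C1curve_line p q)) as HL.
  cbv beta in HL. rewrite pair_line_0, pair_line_1 in HL. eapply Rle_trans; [exact HL|].
  unfold glength. apply Rle_trans with (RInt (fun _ => S) 0 1).
  - apply RInt_le; [lra | | apply ex_RInt_const |].
    + apply ex_RInt_continuous_all. apply continuous_length_density; [assumption | apply C1curve_line].
    + intros t Ht. rewrite <- (sqrt_pow2 S) by assumption. apply sqrt_le_1_alt, H. lra.
  - rewrite RInt_const. unfold scal; simpl; unfold mult; simpl. lra.
Qed.

Lemma dist_le g lam Lam K p q : is_torus_metric g -> metric_bounds g lam Lam K -> dist g p q <= Lam * dl1 p q.
Proof.
  intros Hg Hb. apply dist_le_segment; [assumption | |].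
  - apply Rmult_le_pos; [apply Rlt_le, (mb_Lam Hb) | apply dl1_pos].
  - intros t _. rewrite dl1_sym. apply (mb_up Hb _ (fst q - fst p, snd q - snd p)).
Qed.

(** * Concatenation of C1 curves and the triangle inequality *)

(** Competitors for [dist] are C1, so two curves are joined after a reparametrization that comes to
    rest at both ends. Its speed is [6 t (1 - t)] cut off outside the unit interval; the 6 makes the
    integral 1. *)
Definition step' (t : R) : R := 6 * Rmax 0 t * Rmax 0 (1 - t).
Definition step (t : R) : R := RInt step' 0 t.

Lemma continuous_step' t : continuous step' t.
Proof.
  assert (Hm : forall s, continuous (fun x => Rmax 0 x) s).
  { intros s. apply (continuous_ext (fun x => (x + Rabs x) * / 2)).
    - intros x. unfold Rmax, Rabs. destruct (Rle_dec 0 x), (Rcase_abs x); lra.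
    - apply continuous_Rmult; [|apply continuous_const].
      apply continuous_Rplus; [apply continuous_id | apply continuous_Rabs]. }
  unfold step'. apply continuous_Rmult.
  - apply continuous_Rmult; [apply continuous_const | apply Hm].
  - apply (continuous_comp (fun x => 1 - x) (fun x => Rmax 0 x)); [|apply Hm].
    apply (continuous_minus (fun _ => 1) (fun x => x)); [apply continuous_const | apply continuous_id].
Qed.

Lemma is_derive_step t : is_derive step t (step' t).
Proof.
  apply (is_derive_RInt step' step 0 t); [|apply continuous_step'].
  exists (mkposreal 1 Rlt_0_1). intros y _. apply is_RInt_continuous_all, continuous_step'.
Qed.

Lemma step'_pos t : 0 <= step' t.
Proof.
  unfold step'. apply Rmult_le_pos; [apply Rmult_le_pos; [lra|]|]; apply Rmax_l.
Qed.

Lemma step'_le0 t : t <= 0 -> step' t = 0.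
Proof. intros H. unfold step'. rewrite (Rmax_left 0 t) by lra. ring. Qed.

Lemma step'_ge1 t : 1 <= t -> step' t = 0.
Proof. intros H. unfold step'. rewrite (Rmax_left 0 (1 - t)) by lra. ring. Qed.

Lemma step_le0 t : t <= 0 -> step t = 0.
Proof.
  intros H. unfold step. rewrite (RInt_ext _ (fun _ => 0)).
  - rewrite RInt_const. unfold scal; simpl; unfold mult; simpl. ring.
  - intros x Hx. apply step'_le0. rewrite Rmin_right, Rmax_left in Hx; lra.
Qed.

Lemma step_ge1 t : 1 <= t -> step t = 1.
Proof.
  intros H. unfold step.
  rewrite <- (RInt_Chasles step' 0 1 t) by (apply ex_RInt_continuous_all, continuous_step').
  replace (RInt step' 1 t) with 0.
  - unfold plus; simpl. rewrite Rplus_0_r.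
    rewrite (RInt_ext _ (fun x => 6 * x * (1 - x))).
    + apply is_RInt_unique.
      replace 1 with ((fun x => 3 * x ^ 2 - 2 * x ^ 3) 1 - (fun x => 3 * x ^ 2 - 2 * x ^ 3) 0) at 2 by (simpl; ring).
      apply (is_RInt_derive (fun x => 3 * x ^ 2 - 2 * x ^ 3)).
      * intros x _. auto_derive; trivial. ring.
      * intros x _. apply (ex_derive_continuous (fun x => 6 * x * (1 - x)) x). auto_derive; trivial.
    + intros x Hx. rewrite Rmin_left, Rmax_right in Hx by lra. unfold step'.
      rewrite !Rmax_right by lra. reflexivity.
  - rewrite (RInt_ext _ (fun _ => 0)).
    + rewrite RInt_const. unfold scal; simpl; unfold mult; simpl. ring.
    + intros x Hx. apply step'_ge1. rewrite Rmin_left, Rmax_right in Hx; lra.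
Qed.

Lemma gq_scal g x s a b : gq g x (s * a, s * b) (s * a, s * b) = s ^ 2 * gq g x (a, b) (a, b).
Proof. unfold gq; simpl. ring. Qed.

Lemma gq_nonneg g : is_torus_metric g -> forall x a, 0 <= gq g x a a.
Proof.
  intros Hg x a. destruct (torus_metric_bounds g Hg) as (lam & Lam & K & Hb).
  eapply Rle_trans; [apply pow2_ge_0 | apply (mb_low Hb)].
Qed.

Lemma RInt_length_reparam g c c' (phi phi' : R -> R) a b : is_torus_metric g -> C1curve c c' -> a <= b ->
  (forall t, is_derive phi t (phi' t)) -> (forall t, continuous phi' t) -> (forall t, 0 <= phi' t) ->
  phi a = 0 -> phi b = 1 ->
  RInt (fun t => sqrt (gq g (c (phi t)) (phi' t * fst (c' (phi t)), phi' t * snd (c' (phi t)))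
    (phi' t * fst (c' (phi t)), phi' t * snd (c' (phi t))))) a b = glength g c c'.
Proof.
  intros Hg Hc Hab Hd Hcont Hpos Ha Hb. unfold glength. rewrite <- Ha, <- Hb.
  rewrite <- (RInt_comp (fun t => sqrt (gq g (c t) (c' t) (c' t))) phi phi').
  - apply RInt_ext. intros t _. rewrite gq_scal, <- surjective_pairing.
    rewrite sqrt_mult; [|apply pow2_ge_0 | now apply gq_nonneg].
    rewrite sqrt_pow2 by apply Hpos. reflexivity.
  - intros t _. now apply continuous_length_density.
  - intros t _. split; [apply Hd | apply Hcont].
Qed.

Lemma dist_triangle g p q r : is_torus_metric g -> dist g p r <= dist g p q + dist g q r.
Proof.
  intros Hg. apply Rnot_lt_le. intros Hlt.
  set (e := (dist g p r - dist g p q - dist g q r) / 2). assert (He : 0 < e) by (unfold e; lra).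
  destruct (dist_approx g p q e Hg He) as (c & c' & Hc & Ec0 & Ec1 & Hlc).
  destruct (dist_approx g q r e Hg He) as (d & d' & Hd & Ed0 & Ed1 & Hld).
  assert (Hlt2 : glength g c c' + glength g d d' < dist g p r) by (unfold e in *; lra).
  set (f1 := fun t => step (2 * t)). set (f1' := fun t => 2 * step' (2 * t)).
  set (f2 := fun t => step (2 * t - 1)). set (f2' := fun t => 2 * step' (2 * t - 1)).
  assert (D1 : forall t, is_derive f1 t (f1' t)).
  { intros t. unfold f1, f1'. evar_last.
    - apply (is_derive_comp step (fun t => 2 * t)); [apply is_derive_step|].
      auto_derive; [trivial | reflexivity].
    - unfold scal; simpl; unfold mult; simpl. ring. }
  assert (D2 : forall t, is_derive f2 t (f2' t)).
  { intros t. unfold f2, f2'. evar_last.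
    - apply (is_derive_comp step (fun t => 2 * t - 1)); [apply is_derive_step|].
      auto_derive; [trivial | reflexivity].
    - unfold scal; simpl; unfold mult; simpl. ring. }
  assert (K1 : forall t, continuous f1' t).
  { intros t. apply continuous_Rmult; [apply continuous_const|].
    apply (continuous_comp (fun t => 2 * t) step'); [|apply continuous_step'].
    apply continuous_Rmult; [apply continuous_const | apply continuous_id]. }
  assert (K2 : forall t, continuous f2' t).
  { intros t. apply continuous_Rmult; [apply continuous_const|].
    apply (continuous_comp (fun t => 2 * t - 1) step'); [|apply continuous_step'].
    apply (continuous_minus (fun t => 2 * t) (fun _ => 1)); [|apply continuous_const].
    apply continuous_Rmult; [apply continuous_const | apply continuous_id]. }
  assert (P1 : forall t, 0 <= f1' t) by (intros t; unfold f1'; pose proof (step'_pos (2 * t)); lra).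
  assert (P2 : forall t, 0 <= f2' t) by (intros t; unfold f2'; pose proof (step'_pos (2 * t - 1)); lra).
  (* The sum of both curves minus the common point [q]: while one moves the other rests at [q], so
     this is the concatenation, written as one formula whose differentiability is immediate on the
     whole line. *)
  set (w := fun t => (fst (c (f1 t)) + fst (d (f2 t)) - fst q, snd (c (f1 t)) + snd (d (f2 t)) - snd q)).
  set (w' := fun t => (f1' t * fst (c' (f1 t)) + f2' t * fst (d' (f2 t)),
                       f1' t * snd (c' (f1 t)) + f2' t * snd (d' (f2 t)))).
  assert (Hcomp : forall (h h' : R -> R) (f f' : R -> R) t, (forall t, is_derive h t (h' t)) ->
      (forall t, is_derive f t (f' t)) -> is_derive (fun s => h (f s)) t (f' t * h' (f t))).
  { intros h h' f f' t Hh Hf. apply (is_derive_comp h f t (h' (f t)) (f' t)); [apply Hh | apply Hf]. }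
  assert (Hcc : forall (h : R -> R) f f' t, (forall t, is_derive f t (f' t)) -> (forall t, continuous h t) ->
      continuous (fun s : R => h (f s)) t).
  { intros h f f' t Hf Hh. apply (continuous_comp f h); [|apply Hh].
    eapply continuous_of_is_derive; apply Hf. }
  assert (Hw : C1curve w w').
  { intros t. unfold w, w'; simpl.
    assert (Q : forall u v z u' v', is_derive u t u' -> is_derive v t v' ->
        is_derive (fun s : R => u s + v s - z) t (u' + v')).
    { intros u v z u' v' Hu Hv. evar_last.
      - apply (is_derive_minus (fun s => u s + v s) (fun _ => z) t (u' + v') 0).
        + apply (is_derive_plus u v t u' v' Hu Hv).
        + apply (is_derive_const z).
      - unfold minus, plus, opp; simpl. ring. }
    split; [|split; [|split]].
    - apply Q; [apply (Hcomp (fun s => fst (c s)) (fun s => fst (c' s)) f1 f1') |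
                apply (Hcomp (fun s => fst (d s)) (fun s => fst (d' s)) f2 f2')]; try assumption; intros; apply Hc || apply Hd.
    - apply Q; [apply (Hcomp (fun s => snd (c s)) (fun s => snd (c' s)) f1 f1') |
                apply (Hcomp (fun s => snd (d s)) (fun s => snd (d' s)) f2 f2')]; try assumption; intros; apply Hc || apply Hd.
    - apply continuous_Rplus; apply continuous_Rmult; try apply K1; try apply K2.
      + apply (Hcc (fun s => fst (c' s)) f1 f1'); [assumption | intros; apply Hc].
      + apply (Hcc (fun s => fst (d' s)) f2 f2'); [assumption | intros; apply Hd].
    - apply continuous_Rplus; apply continuous_Rmult; try apply K1; try apply K2.
      + apply (Hcc (fun s => snd (c' s)) f1 f1'); [assumption | intros; apply Hc].
      + apply (Hcc (fun s => snd (d' s)) f2 f2'); [assumption | intros; apply Hd]. }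
  assert (Z0 : f1 0 = 0) by (apply step_le0; lra).
  assert (Z1 : f1 (1 / 2) = 1) by (apply step_ge1; lra).
  assert (Z2 : f1 1 = 1) by (apply step_ge1; lra).
  assert (Y0 : f2 0 = 0) by (apply step_le0; lra).
  assert (Y1 : f2 (1 / 2) = 0) by (apply step_le0; lra).
  assert (Y2 : f2 1 = 1) by (apply step_ge1; lra).
  assert (W0 : w 0 = p).
  { unfold w. rewrite Z0, Y0, Ec0, Ed0. destruct p; simpl; f_equal; ring. }
  assert (W1 : w 1 = r).
  { unfold w. rewrite Z2, Y2, Ec1, Ed1. destruct r; simpl; f_equal; ring. }
  pose proof (dist_le_glength g w w' Hg Hw) as HL. rewrite W0, W1 in HL.
  assert (HE : glength g w w' = glength g c c' + glength g d d').
  { rewrite <- (RInt_length_reparam g c c' f1 f1' 0 (1 / 2)) by (assumption || lra).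
    rewrite <- (RInt_length_reparam g d d' f2 f2' (1 / 2) 1) by (assumption || lra).
    unfold glength.
    rewrite <- (RInt_Chasles (fun t => sqrt (gq g (w t) (w' t) (w' t))) 0 (1 / 2) 1)
      by (apply ex_RInt_continuous_all; now apply continuous_length_density).
    unfold plus; simpl. f_equal.
    - apply RInt_ext. intros t Ht. rewrite Rmin_left, Rmax_right in Ht by lra.
      assert (A : f2 t = 0) by (apply step_le0; lra).
      assert (A' : f2' t = 0) by (unfold f2'; rewrite step'_le0 by lra; ring).
      unfold w, w'. rewrite A, A', Ed0. f_equal. f_equal.
      + destruct (c (f1 t)); simpl; f_equal; ring.
      + f_equal; ring.
      + f_equal; ring.
    - apply RInt_ext. intros t Ht. rewrite Rmin_left, Rmax_right in Ht by lra.
      assert (A : f1 t = 1) by (apply step_ge1; lra).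
      assert (A' : f1' t = 0) by (unfold f1'; rewrite step'_ge1 by lra; ring).
      unfold w, w'. rewrite A, A', Ec1. f_equal. f_equal.
      + destruct (d (f2 t)); simpl; f_equal; ring.
      + f_equal; ring.
      + f_equal; ring. }
  lra.
Qed.

(** * Deck translations as isometries *)

Definition tr (k1 k2 : Z) (p : R * R) : R * R := (fst p + IZR k1, snd p + IZR k2).

Lemma tr_opp k1 k2 p : tr (- k1) (- k2) (tr k1 k2 p) = p.
Proof. unfold tr; destruct p; simpl. rewrite !opp_IZR. f_equal; ring. Qed.

Lemma gc_tr g k1 k2 i j x : is_torus_metric g ->
  gc g i j (fst (tr k1 k2 x)) (snd (tr k1 k2 x)) = gc g i j (fst x) (snd x).
Proof.
  intros (_ & _ & _ & P1 & P2 & P3 & _). unfold tr; simpl.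
  destruct i, j; simpl; now apply periodic2_IZR.
Qed.

Lemma gq_tr g k1 k2 x a b : is_torus_metric g -> gq g (tr k1 k2 x) a b = gq g x a b.
Proof. intros Hg. unfold gq. now rewrite !gc_tr. Qed.

Lemma is_derive_plus_const (f : R -> R) t l z : is_derive f t l -> is_derive (fun s => f s + z) t l.
Proof.
  intros H. evar_last.
  - apply (is_derive_plus f (fun _ => z) t l 0 H). apply (is_derive_const z).
  - unfold plus; simpl; ring.
Qed.

Lemma dist_tr g k1 k2 p q : is_torus_metric g -> dist g (tr k1 k2 p) (tr k1 k2 q) = dist g p q.
Proof.
  intros Hg.
  assert (H : forall k1 k2 p q, dist g (tr k1 k2 p) (tr k1 k2 q) <= dist g p q).
  { clear k1 k2 p q. intros k1 k2 p q. apply Rnot_lt_le. intros Hlt.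
    destruct (dist_approx g p q (dist g (tr k1 k2 p) (tr k1 k2 q) - dist g p q) Hg) as (c & c' & Hc & <- & <- & Hl); [lra|].
    assert (Hc2 : C1curve (fun t => tr k1 k2 (c t)) c').
    { intros t. destruct (Hc t) as (A1 & A2 & A3 & A4). unfold tr; simpl.
      split; [|split; [|split; assumption]]; now apply is_derive_plus_const. }
    pose proof (dist_le_glength g _ _ Hg Hc2) as HL. simpl in HL.
    assert (E : glength g (fun t => tr k1 k2 (c t)) c' = glength g c c').
    { unfold glength. apply RInt_ext. intros t _. now rewrite gq_tr. }
    lra. }
  apply Rle_antisym; [apply H|].
  rewrite <- (tr_opp k1 k2 p) at 1. rewrite <- (tr_opp k1 k2 q) at 1. apply H.
Qed.

(** * Unit speed geodesics *)

Lemma is_derive_Rmult (f h : R -> R) t f' h' : is_derive f t f' -> is_derive h t h' ->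
  is_derive (fun s => f s * h s) t (f' * h t + f t * h').
Proof. intros Hf Hh. apply (is_derive_mult f h t f' h' Hf Hh). intros; apply Rmult_comm. Qed.

Lemma is_derive_Rplus (f h : R -> R) t f' h' : is_derive f t f' -> is_derive h t h' ->
  is_derive (fun s => f s + h s) t (f' + h').
Proof. intros Hf Hh. apply (is_derive_plus f h t f' h' Hf Hh). Qed.

Lemma is_derive_gq g (x x' a a' : R -> R * R) t : is_torus_metric g ->
  is_derive (fun s => fst (x s)) t (fst (x' t)) -> is_derive (fun s => snd (x s)) t (snd (x' t)) ->
  is_derive (fun s => fst (a s)) t (fst (a' t)) -> is_derive (fun s => snd (a s)) t (snd (a' t)) ->
  is_derive (fun s => gq g (x s) (a s) (a s)) t
    (let P i j := pd 0 (gc g i j) (fst (x t)) (snd (x t)) * fst (x' t)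
                + pd 1 (gc g i j) (fst (x t)) (snd (x t)) * snd (x' t) in
     P 0%nat 0%nat * fst (a t) * fst (a t) + 2 * (P 0%nat 1%nat * fst (a t) * snd (a t))
       + P 1%nat 1%nat * snd (a t) * snd (a t) + 2 * gq g (x t) (a' t) (a t)).
Proof.
  intros (S1 & S2 & S3 & _) Hx Hy Ha Hb.
  pose proof (is_derive_chain2 (m11 g) _ _ _ _ t S1 Hx Hy) as D11.
  pose proof (is_derive_chain2 (m12 g) _ _ _ _ t S2 Hx Hy) as D12.
  pose proof (is_derive_chain2 (m22 g) _ _ _ _ t S3 Hx Hy) as D22.
  cbv beta in D11, D12, D22.
  assert (T : forall f u v f' u' v', is_derive f t f' -> is_derive u t u' -> is_derive v t v' ->
     is_derive (fun s => f s * u s * v s) t ((f' * u t + f t * u') * v t + f t * u t * v')).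
  { intros f u v f' u' v' Hf Hu Hv. apply (is_derive_Rmult (fun s => f s * u s) v); [|assumption].
    now apply is_derive_Rmult. }
  evar_last.
  - exact (is_derive_Rplus _ _ _ _ _ (is_derive_Rplus _ _ _ _ _ (is_derive_Rplus _ _ _ _ _
      (T _ _ _ _ _ _ D11 Ha Ha) (T _ _ _ _ _ _ D12 Ha Hb)) (T _ _ _ _ _ _ D12 Hb Ha)) (T _ _ _ _ _ _ D22 Hb Hb)).
  - unfold gq; simpl. ring.
Qed.

(** The Christoffel symbols are those of a connection compatible with the metric, so the derivative
    of the squared speed cancels. With coefficients and first derivatives replaced by free
    variables, this is a rational identity over the determinant. *)
Lemma geodesic_energy g c u : is_torus_metric g -> geodesic g c u ->
  forall t, gq g (c t) (u t) (u t) = gq g (c 0) (u 0) (u 0).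
Proof.
  intros Hg Hc.
  assert (HD : forall t, is_derive (fun s => gq g (c s) (u s) (u s)) t 0).
  { intros t. destruct (Hc t) as (A1 & A2 & A3 & A4).
    evar_last.
    - apply (is_derive_gq g c u u (fun t => (- quad_chr g 0 (c t) (u t) (u t), - quad_chr g 1 (c t) (u t) (u t))));
        assumption.
    - assert (Hdet : detg g (fst (c t)) (snd (c t)) <> 0).
      { assert (0 < detg g (fst (c t)) (snd (c t))) by apply Hg. lra. }
      unfold gq, quad_chr, chr, ginv, cp, gc. cbn [fst snd].
      generalize dependent (pd 0 (m11 g) (fst (c t)) (snd (c t))). intros p011.
      generalize dependent (pd 1 (m11 g) (fst (c t)) (snd (c t))). intros p111.
      generalize dependent (pd 0 (m12 g) (fst (c t)) (snd (c t))). intros p012.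
      generalize dependent (pd 1 (m12 g) (fst (c t)) (snd (c t))). intros p112.
      generalize dependent (pd 0 (m22 g) (fst (c t)) (snd (c t))). intros p022.
      generalize dependent (pd 1 (m22 g) (fst (c t)) (snd (c t))). intros p122.
      unfold detg in *.
      generalize dependent (m11 g (fst (c t)) (snd (c t))). intros a11.
      generalize dependent (m12 g (fst (c t)) (snd (c t))). intros a12.
      generalize dependent (m22 g (fst (c t)) (snd (c t))). intros a22.
      intros Hdet. field. exact Hdet. }
  intros t.
  pose proof (lipschitz_of_bounded_derive (fun s => gq g (c s) (u s) (u s)) (fun _ => 0) 0 HD) as HL.
  specialize (HL ltac:(intros x; cbv beta; rewrite Rabs_R0; lra) t 0). cbv beta in HL. rewrite Rmult_0_l in HL.
  pose proof (Rabs_pos (gq g (c t) (u t) (u t) - gq g (c 0) (u 0) (u 0))).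
  apply Rminus_diag_uniq. apply NNPP. intros Hne. apply Rabs_pos_lt in Hne. lra.
Qed.

Lemma nrm_unit g lam Lam K x a : metric_bounds g lam Lam K -> gq g x a a = 1 -> nrm a <= / lam.
Proof.
  intros Hb H1. pose proof (mb_lam Hb) as Hl. pose proof (mb_low Hb x a) as H.
  rewrite H1 in H. pose proof (nrm_pos a).
  assert (0 <= lam * nrm a) by (apply Rmult_le_pos; lra).
  assert (lam * nrm a <= 1) by nra.
  apply Rmult_le_reg_l with lam; [assumption|]. rewrite Rinv_r by lra. assumption.
Qed.

Definition unit_geodesic g c u := geodesic g c u /\ forall t, gq g (c t) (u t) (u t) = 1.

Lemma unit_geodesic_intro g c u : is_torus_metric g -> geodesic g c u -> gq g (c 0) (u 0) (u 0) = 1 ->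
  unit_geodesic g c u.
Proof. intros Hg Hc H1. split; [assumption|]. intros t. now rewrite (geodesic_energy g c u Hg Hc). Qed.

Lemma geodesic_accel g lam Lam K c u : metric_bounds g lam Lam K -> unit_geodesic g c u ->
  forall k t, Rabs (- quad_chr g k (c t) (u t) (u t)) <= K * / lam * / lam.
Proof.
  intros Hb [Hc H1] k t. rewrite Rabs_Ropp. eapply Rle_trans; [apply (mb_chr Hb)|].
  pose proof (nrm_unit g lam Lam K _ _ Hb (H1 t)). pose proof (nrm_pos (u t)). pose proof (mb_K Hb).
  apply Rmult_le_compat; try lra.
  - apply Rmult_le_pos; lra.
  - apply Rmult_le_compat_l; lra.
Qed.

Lemma geodesic_velocity_lipschitz g lam Lam K c u : metric_bounds g lam Lam K -> unit_geodesic g c u ->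
  forall s t, dl1 (u s) (u t) <= 2 * (K * / lam * / lam) * Rabs (s - t).
Proof.
  intros Hb Hu s t. pose proof (geodesic_accel g lam Lam K c u Hb Hu) as HA. destruct Hu as [Hc H1].
  pose proof (lipschitz_of_bounded_derive (fun t => fst (u t)) _ _
    (fun t => proj1 (proj2 (proj2 (Hc t)))) (HA 0%nat) s t).
  pose proof (lipschitz_of_bounded_derive (fun t => snd (u t)) _ _
    (fun t => proj2 (proj2 (proj2 (Hc t)))) (HA 1%nat) s t).
  unfold dl1. lra.
Qed.

(** The mean value theorem is used twice, for the remainder and for [f']; this gives the constant
    [M] instead of [M / 2]. *)
Lemma taylor_order1 (f f' f'' : R -> R) (M : R) : (forall t, is_derive f t (f' t)) ->
  (forall t, is_derive f' t (f'' t)) -> (forall t, Rabs (f'' t) <= M) ->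
  forall t h, Rabs (f (t + h) - f t - h * f' t) <= M * h ^ 2.
Proof.
  intros H1 H2 HM t h.
  assert (HD : forall s, is_derive (fun s => f (t + s) - s * f' t) s (f' (t + s) - f' t)).
  { intros s. evar_last.
    - apply (is_derive_minus (fun s => f (t + s)) (fun s => s * f' t)).
      + apply (is_derive_comp f (fun s => t + s)); [apply H1|]. auto_derive; [trivial | reflexivity].
      + auto_derive; [trivial | reflexivity].
    - unfold minus, plus, opp, scal; simpl; unfold mult; simpl. ring. }
  destruct (MVT_gen (fun s => f (t + s) - s * f' t) 0 h (fun s => f' (t + s) - f' t)) as [x [Hx E]].
  - intros x _. apply HD.
  - intros x _. apply continuity_pt_filterlim.
    apply (continuous_of_is_derive _ _ _ (HD x)).
  - rewrite Rplus_0_r in E.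
    replace (f (t + h) - f t - h * f' t) with ((f' (t + x) - f' t) * (h - 0)) by lra.
    rewrite Rabs_mult. rewrite Rminus_0_r.
    pose proof (lipschitz_of_bounded_derive f' f'' M H2 HM (t + x) t) as HL.
    replace (t + x - t) with x in HL by ring.
    assert (Rabs x <= Rabs h).
    { unfold Rmin, Rmax in Hx. destruct (Rle_dec 0 h); unfold Rabs; destruct (Rcase_abs x), (Rcase_abs h); lra. }
    pose proof (Rle_trans _ _ _ (Rabs_pos _) (HM 0)). pose proof (Rabs_pos x). pose proof (Rabs_pos h).
    apply Rle_trans with (M * Rabs h * Rabs h).
    + apply Rmult_le_compat_r; [assumption|]. eapply Rle_trans; [exact HL|]. apply Rmult_le_compat_l; lra.
    + rewrite <- (pow2_abs h). right; ring.
Qed.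

Lemma geodesic_taylor g lam Lam K c u : metric_bounds g lam Lam K -> unit_geodesic g c u ->
  forall t h, dl1 (c (t + h)) (fst (c t) + h * fst (u t), snd (c t) + h * snd (u t))
    <= 2 * (K * / lam * / lam) * h ^ 2.
Proof.
  intros Hb Hu t h. pose proof (geodesic_accel g lam Lam K c u Hb Hu) as HA. destruct Hu as [Hc H1].
  pose proof (taylor_order1 (fun t => fst (c t)) _ _ _ (fun t => proj1 (Hc t))
    (fun t => proj1 (proj2 (proj2 (Hc t)))) (HA 0%nat) t h) as E1.
  pose proof (taylor_order1 (fun t => snd (c t)) _ _ _ (fun t => proj1 (proj2 (Hc t)))
    (fun t => proj2 (proj2 (proj2 (Hc t)))) (HA 1%nat) t h) as E2.
  cbv beta in E1, E2. unfold dl1; simpl fst; simpl snd.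
  replace (fst (c (t + h)) - (fst (c t) + h * fst (u t))) with (fst (c (t + h)) - fst (c t) - h * fst (u t)) by ring.
  replace (snd (c (t + h)) - (snd (c t) + h * snd (u t))) with (snd (c (t + h)) - snd (c t) - h * snd (u t)) by ring.
  lra.
Qed.

(** Multiplied by [exp (- C * t)], [D] does not increase for positive times; multiplied by
    [exp (C * t)], it does not decrease along negative times towards 0. Both products vanish at
    0. *)
Lemma gronwall_zero (D D' : R -> R) (C : R) : (forall t, is_derive D t (D' t)) ->
  (forall t, 0 <= D t) -> (forall t, Rabs (D' t) <= C * D t) -> D 0 = 0 -> forall t, D t = 0.
Proof.
  intros HD Hpos HC H0 t.
  assert (HE : forall k s, is_derive (fun s => D s * exp (k * s)) s ((D' s + k * D s) * exp (k * s))).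
  { intros k s. evar_last.
    - apply is_derive_Rmult; [apply HD|]. auto_derive; [trivial | reflexivity].
    - cbv beta. ring. }
  assert (HM : forall k, exists x, Rmin 0 t <= x <= Rmax 0 t /\
     D t * exp (k * t) - D 0 * exp (k * 0) = (D' x + k * D x) * exp (k * x) * (t - 0)).
  { intros k. apply (MVT_gen (fun s => D s * exp (k * s)) 0 t (fun s => (D' s + k * D s) * exp (k * s))).
    - intros x _. apply HE.
    - intros x _. apply continuity_pt_filterlim. apply (continuous_of_is_derive _ _ _ (HE k x)). }
  apply Rle_antisym; [|apply Hpos].
  destruct (Rle_dec 0 t) as [Ht|Ht].
  - destruct (HM (- C)) as [x [_ E]]. rewrite H0 in E. pose proof (exp_pos (- C * t)). pose proof (exp_pos (- C * x)).
    specialize (HC x). pose proof (Rle_abs (D' x)).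
    assert (0 <= (C * D x - D' x) * exp (- C * x) * t)
      by (apply Rmult_le_pos; [apply Rmult_le_pos; lra | lra]).
    apply Rmult_le_reg_r with (exp (- C * t)); [lra|]. lra.
  - destruct (HM C) as [x [_ E]]. rewrite H0 in E. pose proof (exp_pos (C * t)). pose proof (exp_pos (C * x)).
    specialize (HC x). pose proof (Rle_abs (- D' x)) as Q. rewrite Rabs_Ropp in Q.
    assert (0 <= (C * D x + D' x) * exp (C * x) * (- t))
      by (apply Rmult_le_pos; [apply Rmult_le_pos; lra | lra]).
    apply Rmult_le_reg_r with (exp (C * t)); [lra|]. lra.
Qed.

(** Unit speed bounds both velocities by [/ lam], so the geodesic field is Lipschitz where it is
    evaluated, and the squared Euclidean difference [D] of the two solutions satisfies a Gronwall
    inequality. *)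
Lemma unit_geodesic_unique g c u c2 u2 : is_torus_metric g -> unit_geodesic g c u -> unit_geodesic g c2 u2 ->
  c 0 = c2 0 -> u 0 = u2 0 -> forall t, c t = c2 t /\ u t = u2 t.
Proof.
  intros Hg [Hc Hu] [Hc2 Hu2] E0 E0'.
  destruct (torus_metric_bounds g Hg) as (lam & Lam & K & Hb).
  pose proof (mb_lam Hb) as Hl. pose proof (mb_K Hb) as HK.
  set (V := / lam). assert (HV : 0 < V) by now apply Rinv_0_lt_compat.
  set (D := fun t => (fst (c t) - fst (c2 t)) ^ 2 + (snd (c t) - snd (c2 t)) ^ 2
     + (fst (u t) - fst (u2 t)) ^ 2 + (snd (u t) - snd (u2 t)) ^ 2).
  set (D' := fun t => 2 * ((fst (c t) - fst (c2 t)) * (fst (u t) - fst (u2 t))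
    + (snd (c t) - snd (c2 t)) * (snd (u t) - snd (u2 t))
    - (fst (u t) - fst (u2 t)) * (quad_chr g 0 (c t) (u t) (u t) - quad_chr g 0 (c2 t) (u2 t) (u2 t))
    - (snd (u t) - snd (u2 t)) * (quad_chr g 1 (c t) (u t) (u t) - quad_chr g 1 (c2 t) (u2 t) (u2 t)))).
  assert (HD : forall t, is_derive D t (D' t)).
  { intros t. destruct (Hc t) as (A1 & A2 & A3 & A4). destruct (Hc2 t) as (B1 & B2 & B3 & B4).
    assert (Q : forall f h f' h', is_derive f t f' -> is_derive h t h' ->
       is_derive (fun s => (f s - h s) ^ 2) t (2 * (f t - h t) * (f' - h'))).
    { intros f h f' h' Hf Hh. apply (is_derive_ext (fun s => (f s - h s) * (f s - h s))).
      { intros s; simpl; ring. }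
      evar_last.
      - apply (is_derive_Rmult (fun s => f s - h s) (fun s => f s - h s) t (f' - h') (f' - h'));
          apply (is_derive_minus f h t f' h' Hf Hh).
      - cbv beta. ring. }
    unfold D, D'. evar_last.
    - exact (is_derive_Rplus _ _ _ _ _ (is_derive_Rplus _ _ _ _ _ (is_derive_Rplus _ _ _ _ _
       (Q _ _ _ _ A1 B1) (Q _ _ _ _ A2 B2)) (Q _ _ _ _ A3 B3)) (Q _ _ _ _ A4 B4)).
    - cbv beta. ring. }
  assert (HZ : forall t, D t = 0).
  { apply (gronwall_zero D D' (2 * (1 + 2 * (K * V ^ 2) + 2 * (2 * K * (2 * V)))) HD).
    - intros t. unfold D.
      pose proof (pow2_ge_0 (fst (c t) - fst (c2 t))). pose proof (pow2_ge_0 (snd (c t) - snd (c2 t))).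
      pose proof (pow2_ge_0 (fst (u t) - fst (u2 t))). pose proof (pow2_ge_0 (snd (u t) - snd (u2 t))). lra.
    - intros t.
      pose proof (nrm_unit g lam Lam K _ _ Hb (Hu t)) as N1. pose proof (nrm_unit g lam Lam K _ _ Hb (Hu2 t)) as N2.
      fold V in N1, N2. pose proof (nrm_pos (u t)). pose proof (nrm_pos (u2 t)).
      assert (HF : forall k, Rabs (quad_chr g k (c t) (u t) (u t) - quad_chr g k (c2 t) (u2 t) (u2 t))
         <= K * V ^ 2 * dl1 (c t) (c2 t) + K * (2 * V) * dl1 (u t) (u2 t)).
      { intros k. eapply Rle_trans; [apply (mb_chrlip Hb)|].
        rewrite Rmult_plus_distr_l. pose proof (dl1_pos (c t) (c2 t)). pose proof (dl1_pos (u t) (u2 t)).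
        apply Rplus_le_compat.
        - rewrite Rmult_assoc, (Rmult_comm (V ^ 2)). apply Rmult_le_compat_l; [lra|].
          apply Rmult_le_compat_l; [lra|]. apply pow_incr; lra.
        - rewrite Rmult_assoc, (Rmult_comm (2 * V)). apply Rmult_le_compat_l; [lra|].
          apply Rmult_le_compat_l; lra. }
      pose proof (HF 0%nat) as F0. pose proof (HF 1%nat) as F1. unfold dl1 in F0, F1.
      unfold D, D'.
      set (f0 := quad_chr g 0 (c t) (u t) (u t) - quad_chr g 0 (c2 t) (u2 t) (u2 t)) in *.
      set (f1 := quad_chr g 1 (c t) (u t) (u t) - quad_chr g 1 (c2 t) (u2 t) (u2 t)) in *.
      rewrite <- (pow2_abs (fst (c t) - _)), <- (pow2_abs (snd (c t) - _)),
        <- (pow2_abs (fst (u t) - _)), <- (pow2_abs (snd (u t) - _)).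
      set (x := fst (c t) - fst (c2 t)) in *. set (y := snd (c t) - snd (c2 t)) in *.
      set (a := fst (u t) - fst (u2 t)) in *. set (b := snd (u t) - snd (u2 t)) in *.
      assert (HA : Rabs (2 * (x * a + y * b - a * f0 - b * f1)) <=
         2 * (Rabs x * Rabs a + Rabs y * Rabs b + Rabs a * Rabs f0 + Rabs b * Rabs f1)).
      { rewrite Rabs_mult, (Rabs_pos_eq 2) by lra. apply Rmult_le_compat_l; [lra|].
        unfold Rminus. eapply Rle_trans; [apply Rabs_triang|]. rewrite Rabs_Ropp, Rabs_mult.
        apply Rplus_le_compat_r. eapply Rle_trans; [apply Rabs_triang|]. rewrite Rabs_Ropp, Rabs_mult.
        apply Rplus_le_compat_r. eapply Rle_trans; [apply Rabs_triang|]. rewrite !Rabs_mult. lra. }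
      eapply Rle_trans; [exact HA|]. clear HA.
      pose proof (Rabs_pos x). pose proof (Rabs_pos y). pose proof (Rabs_pos a). pose proof (Rabs_pos b).
      set (X := Rabs x) in *. set (Y := Rabs y) in *. set (A := Rabs a) in *. set (B := Rabs b) in *.
      set (k1 := K * V ^ 2) in *. set (k2 := K * (2 * V)) in *.
      assert (Hk1 : 0 <= k1) by (unfold k1; apply Rmult_le_pos; [lra | apply pow2_ge_0]).
      assert (Hk2 : 0 <= k2) by (unfold k2; apply Rmult_le_pos; lra).
      replace (2 * K * (2 * V)) with (2 * k2) by (unfold k2; ring).
      assert (G0 : A * Rabs f0 + B * Rabs f1 <= (A + B) * (k1 * (X + Y) + k2 * (A + B))).
      { rewrite Rmult_plus_distr_r. apply Rplus_le_compat; apply Rmult_le_compat_l; assumption. }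
      pose proof (pow2_ge_0 (A - X)). pose proof (pow2_ge_0 (A - Y)).
      pose proof (pow2_ge_0 (B - X)). pose proof (pow2_ge_0 (B - Y)). pose proof (pow2_ge_0 (A - B)).
      pose proof (pow2_ge_0 X). pose proof (pow2_ge_0 Y). pose proof (pow2_ge_0 A). pose proof (pow2_ge_0 B).
      assert (G1 : (A + B) * (X + Y) <= 2 * (X ^ 2 + Y ^ 2 + A ^ 2 + B ^ 2)) by lra.
      assert (G2 : (A + B) * (A + B) <= 2 * (X ^ 2 + Y ^ 2 + A ^ 2 + B ^ 2)) by lra.
      assert (G3 : X * A + Y * B <= X ^ 2 + Y ^ 2 + A ^ 2 + B ^ 2) by lra.
      assert (G4 : k1 * ((A + B) * (X + Y)) <= k1 * (2 * (X ^ 2 + Y ^ 2 + A ^ 2 + B ^ 2))) by (apply Rmult_le_compat_l; lra).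
      assert (G5 : k2 * ((A + B) * (A + B)) <= k2 * (2 * (X ^ 2 + Y ^ 2 + A ^ 2 + B ^ 2))) by (apply Rmult_le_compat_l; lra).
      assert (0 <= k2 * (X ^ 2 + Y ^ 2 + A ^ 2 + B ^ 2)) by (apply Rmult_le_pos; lra).
      lra.
    - unfold D. rewrite E0, E0'. ring. }
  intros t. specialize (HZ t). unfold D in HZ.
  pose proof (pow2_ge_0 (fst (c t) - fst (c2 t))) as Q1. pose proof (pow2_ge_0 (snd (c t) - snd (c2 t))) as Q2.
  pose proof (pow2_ge_0 (fst (u t) - fst (u2 t))) as Q3. pose proof (pow2_ge_0 (snd (u t) - snd (u2 t))) as Q4.
  assert (Z : forall r, r ^ 2 = 0 -> r = 0) by (intros r Hr; apply Rsqr_0_uniq; unfold Rsqr; lra).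
  assert (R1 := Z (fst (c t) - fst (c2 t)) ltac:(lra)). assert (R2 := Z (snd (c t) - snd (c2 t)) ltac:(lra)).
  assert (R3 := Z (fst (u t) - fst (u2 t)) ltac:(lra)). assert (R4 := Z (snd (u t) - snd (u2 t)) ltac:(lra)).
  destruct (c t), (c2 t), (u t), (u2 t); simpl in *. split; f_equal; lra.
Qed.

(** * Minimal geodesics *)

Definition min_geodesic g c u := unit_geodesic g c u /\ minimal g c.

Lemma is_derive_shift (f : R -> R) s t l : is_derive f (t + s) l -> is_derive (fun r => f (r + s)) t l.
Proof.
  intros H. evar_last.
  - apply (is_derive_comp f (fun r => r + s)); [exact H|]. auto_derive; [trivial | reflexivity].
  - unfold scal; simpl; unfold mult; simpl. ring.
Qed.

Lemma is_derive_rev (f : R -> R) t l : is_derive f (- t) l -> is_derive (fun r => f (- r)) t (- l).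
Proof.
  intros H. evar_last.
  - apply (is_derive_comp f (fun r => - r)); [exact H|]. auto_derive; [trivial | reflexivity].
  - unfold scal; simpl; unfold mult; simpl. ring.
Qed.

Lemma min_geodesic_shift g c u s : min_geodesic g c u ->
  min_geodesic g (fun t => c (t + s)) (fun t => u (t + s)).
Proof.
  intros [[Hc Hu] Hm]. split; [split|].
  - intros t. destruct (Hc (t + s)) as (A1 & A2 & A3 & A4).
    split; [|split; [|split]].
    + now apply (is_derive_shift (fun r => fst (c r))).
    + now apply (is_derive_shift (fun r => snd (c r))).
    + now apply (is_derive_shift (fun r => fst (u r))).
    + now apply (is_derive_shift (fun r => snd (u r))).
  - intros t. apply Hu.
  - intros a b. rewrite Hm. f_equal. ring.
Qed.

Lemma min_geodesic_rev g c u : min_geodesic g c u ->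
  min_geodesic g (fun t => c (- t)) (fun t => (- fst (u (- t)), - snd (u (- t)))).
Proof.
  intros [[Hc Hu] Hm]. split; [split|].
  - intros t. destruct (Hc (- t)) as (A1 & A2 & A3 & A4).
    assert (E : forall k x a, quad_chr g k x (- fst a, - snd a) (- fst a, - snd a) = quad_chr g k x a a)
      by (intros; unfold quad_chr; simpl; ring).
    rewrite !E. simpl. split; [|split; [|split]].
    + now apply (is_derive_rev (fun r => fst (c r))).
    + now apply (is_derive_rev (fun r => snd (c r))).
    + rewrite <- (Ropp_involutive (quad_chr g 0 _ _ _)).
      apply (is_derive_opp (fun r => fst (u (- r)))). now apply (is_derive_rev (fun r => fst (u r))).
    + rewrite <- (Ropp_involutive (quad_chr g 1 _ _ _)).
      apply (is_derive_opp (fun r => snd (u (- r)))). now apply (is_derive_rev (fun r => snd (u r))).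
  - intros t. rewrite <- (Hu (- t)). unfold gq; simpl. ring.
  - intros a b. rewrite Hm. rewrite <- Rabs_Ropp. f_equal. ring.
Qed.

Lemma chr_tr g k1 k2 k i j x : is_torus_metric g ->
  chr g k i j (fst (tr k1 k2 x)) (snd (tr k1 k2 x)) = chr g k i j (fst x) (snd x).
Proof.
  intros Hg.
  assert (Hpd : forall l i j, pd l (gc g i j) (fst (tr k1 k2 x)) (snd (tr k1 k2 x)) = pd l (gc g i j) (fst x) (snd x)).
  { intros l a b. unfold tr; cbn [fst snd]. apply periodic2_IZR.
    destruct Hg as (S1 & S2 & S3 & P1 & P2 & P3 & _). destruct a, b; now apply periodic2_pd. }
  assert (Hi : forall l, ginv g k l (fst (tr k1 k2 x)) (snd (tr k1 k2 x)) = ginv g k l (fst x) (snd x)).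
  { intros l. pose proof (gc_tr g k1 k2 0 0 x Hg) as E1. pose proof (gc_tr g k1 k2 0 1 x Hg) as E2.
    pose proof (gc_tr g k1 k2 1 1 x Hg) as E3. cbn [gc] in E1, E2, E3.
    destruct k, l; unfold ginv, detg; now rewrite E1, E2, E3. }
  unfold chr. now rewrite !Hpd, !Hi.
Qed.

Lemma geodesic_tr g k1 k2 c u : is_torus_metric g -> geodesic g c u -> geodesic g (fun t => tr k1 k2 (c t)) u.
Proof.
  intros Hg Hc t. destruct (Hc t) as (A1 & A2 & A3 & A4).
  assert (E : forall k a b, quad_chr g k (tr k1 k2 (c t)) a b = quad_chr g k (c t) a b)
    by (intros; unfold quad_chr; now rewrite !chr_tr).
  rewrite !E. split; [|split; [|split]]; [| |assumption|assumption];
    unfold tr; cbn [fst snd]; now apply is_derive_plus_const.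
Qed.

Lemma min_geodesic_tr g k1 k2 c u : is_torus_metric g -> min_geodesic g c u ->
  min_geodesic g (fun t => tr k1 k2 (c t)) u.
Proof.
  intros Hg [[Hc Hu] Hm]. split; [split|].
  - now apply geodesic_tr.
  - intros t. now rewrite gq_tr.
  - intros a b. now rewrite dist_tr.
Qed.

Lemma unit_geodesic_taylor_vec g lam Lam K c u h : metric_bounds g lam Lam K -> unit_geodesic g c u ->
  exists e : R * R, nrm e <= 2 * (K * / lam * / lam) * h ^ 2 /\
    c h = (fst (c 0) + h * fst (u 0) + fst e, snd (c 0) + h * snd (u 0) + snd e).
Proof.
  intros Hb Hu. pose proof (geodesic_taylor g lam Lam K c u Hb Hu 0 h) as HT.
  rewrite Rplus_0_l in HT.
  exists (fst (c h) - (fst (c 0) + h * fst (u 0)), snd (c h) - (snd (c 0) + h * snd (u 0))).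
  split; [exact HT|]. destruct (c h); cbn [fst snd]. f_equal; ring.
Qed.

Lemma nrm_add a b : nrm (fst a + fst b, snd a + snd b) <= nrm a + nrm b.
Proof. unfold nrm; simpl. pose proof (Rabs_triang (fst a) (fst b)). pose proof (Rabs_triang (snd a) (snd b)). lra. Qed.

Lemma nrm_scal h a : nrm (h * fst a, h * snd a) = Rabs h * nrm a.
Proof. unfold nrm; simpl. rewrite !Rabs_mult. ring. Qed.

Lemma nrm_opp a : nrm (- fst a, - snd a) = nrm a.
Proof. unfold nrm; simpl. now rewrite !Rabs_Ropp. Qed.

(* The chord from [a (-h)] to [b h] has length at most [h |u + v| + O(h^2)], and [|u + v| < 2] unless [u = v]. *)
Lemma no_corner g a u b v : is_torus_metric g -> unit_geodesic g a u -> unit_geodesic g b v ->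
  a 0 = b 0 -> (exists h0, 0 < h0 /\ forall h, 0 < h <= h0 -> 2 * h <= dist g (a (- h)) (b h)) -> u 0 = v 0.
Proof.
  intros Hg Ha Hb Hab (h0 & Hh0 & Hd).
  destruct (torus_metric_bounds g Hg) as (lam & Lam & K & Hm).
  pose proof (mb_lam Hm) as Hl. pose proof (mb_K Hm) as HK.
  set (V := / lam). assert (HV : 0 < V) by now apply Rinv_0_lt_compat.
  set (M := 2 * (K * V * V)). assert (HM : 0 < M) by (unfold M; repeat apply Rmult_lt_0_compat; lra).
  set (z := (fst (u 0) + fst (v 0), snd (u 0) + snd (v 0))).
  assert (Hu1 : gq g (a 0) (u 0) (u 0) = 1) by apply Ha.
  assert (Hv1 : gq g (a 0) (v 0) (v 0) = 1) by (rewrite Hab; apply Hb).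
  pose proof (nrm_unit g lam Lam K _ _ Hm Hu1) as Nu. pose proof (nrm_unit g lam Lam K _ _ Hm Hv1) as Nv.
  fold V in Nu, Nv.
  assert (Nz : nrm z <= 2 * V) by (pose proof (nrm_add (u 0) (v 0)); unfold z; lra).
  (* If the squared length of [u + v] falls short of 4 by [del], the chord beats [2 * h] for small
     [h], against the hypothesis. *)
  assert (H4 : 4 <= gq g (a 0) z z).
  { apply Rnot_lt_le. intros Hlt. set (del := 4 - gq g (a 0) z z).
    assert (Hdel : 0 < del) by (unfold del; lra).
    assert (Hdel4 : del <= 4) by (unfold del; pose proof (gq_nonneg g Hg (a 0) z); lra).
    set (W := 2 * V + 2 * M). assert (HW : 0 < W) by (unfold W; lra).
    (* The three summands bound the cubic errors: variation of the metric along the chord, the cross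
       term of [z] with the Taylor remainder, and the square of the remainder. The choice of [h]
       below makes their total at most half of [del * h ^ 2]. *)
    set (C := 2 * K * W ^ 3 + 8 * (K * V * M) + 4 * (K * M ^ 2)).
    assert (HC : 0 < C).
    { unfold C. assert (0 < K * W ^ 3) by (apply Rmult_lt_0_compat; [lra | now apply pow_lt]).
      assert (0 < K * M ^ 2) by (apply Rmult_lt_0_compat; [lra | now apply pow_lt]).
      assert (0 < K * V * M) by (repeat apply Rmult_lt_0_compat; lra). lra. }
    set (h := Rmin (Rmin 1 h0) (del / (2 * C))).
    assert (Hh : 0 < h) by (unfold h; repeat apply Rmin_pos; try lra; apply Rdiv_lt_0_compat; lra).
    assert (Hh01 : h <= Rmin 1 h0) by apply Rmin_l.
    assert (Hh1 : h <= 1) by (pose proof (Rmin_l 1 h0); lra).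
    assert (Hhh0 : h <= h0) by (pose proof (Rmin_r 1 h0); lra).
    assert (Hh2 : C * h <= del / 2).
    { apply Rle_trans with (C * (del / (2 * C))); [apply Rmult_le_compat_l; [lra | apply Rmin_r]|].
      right. field. lra. }
    specialize (Hd h (conj Hh Hhh0)).
    destruct (unit_geodesic_taylor_vec g lam Lam K a u (- h) Hm Ha) as [e1 [He1 Ea]].
    destruct (unit_geodesic_taylor_vec g lam Lam K b v h Hm Hb) as [e2 [He2 Eb]].
    fold V in He1, He2. fold M in He1, He2. replace ((- h) ^ 2) with (h ^ 2) in He1 by ring.
    set (e := (fst e2 - fst e1, snd e2 - snd e1)).
    assert (He : nrm e <= 2 * M * h ^ 2).
    { pose proof (nrm_add e2 (- fst e1, - snd e1)) as Q. rewrite nrm_opp in Q. cbn [fst snd] in Q.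
      change (nrm e <= nrm e2 + nrm e1) in Q. lra. }
    assert (Hw : (fst (b h) - fst (a (- h)), snd (b h) - snd (a (- h))) = (h * fst z + fst e, h * snd z + snd e)).
    { rewrite Ea, Eb, Hab. unfold z, e; cbn [fst snd]. f_equal; ring. }
    set (w := (fst (b h) - fst (a (- h)), snd (b h) - snd (a (- h)))) in *.
    assert (Hhh : h ^ 2 <= h) by nra.
    assert (Nw : nrm w <= W * h).
    { rewrite Hw. eapply Rle_trans; [apply (nrm_add (h * fst z, h * snd z) e)|].
      rewrite nrm_scal, Rabs_pos_eq by lra. unfold W. nra. }
    assert (Np : dl1 (a (- h)) (a 0) <= W * h).
    { change (nrm (fst (a (-h)) - fst (a 0), snd (a (-h)) - snd (a 0)) <= W * h).
      replace (fst (a (- h)) - fst (a 0), snd (a (- h)) - snd (a 0))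
        with ((- h) * fst (u 0) + fst e1, (- h) * snd (u 0) + snd e1)
        by (rewrite Ea; cbn [fst snd]; f_equal; ring).
      eapply Rle_trans; [apply (nrm_add (- h * fst (u 0), - h * snd (u 0)) e1)|].
      rewrite nrm_scal, Rabs_Ropp, Rabs_pos_eq by lra. unfold W. nra. }
    assert (HS : dist g (a (- h)) (b h) <= h * sqrt (4 - del / 2)).
    { apply dist_le_segment; [assumption | apply Rmult_le_pos; [lra | apply sqrt_pos]|].
      intros t Ht. fold w. rewrite Rpow_mult_distr, pow2_sqrt by lra.
      set (x := (fst (a (- h)) + t * (fst (b h) - fst (a (- h))), snd (a (- h)) + t * (snd (b h) - snd (a (- h))))).
      assert (Nx : dl1 x (a 0) <= 2 * W * h).
      { eapply Rle_trans; [apply (dl1_triang x (a (- h)))|].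
        assert (dl1 x (a (- h)) <= W * h).
        { unfold dl1, x; cbn [fst snd].
          replace (fst (a (- h)) + t * (fst (b h) - fst (a (- h))) - fst (a (- h))) with (t * fst w) by (unfold w; cbn [fst snd]; ring).
          replace (snd (a (- h)) + t * (snd (b h) - snd (a (- h))) - snd (a (- h))) with (t * snd w) by (unfold w; cbn [fst snd]; ring).
          change (nrm (t * fst w, t * snd w) <= W * h). rewrite nrm_scal, Rabs_pos_eq by lra.
          pose proof (nrm_pos w). nra. }
        lra. }
      pose proof (mb_gqlip Hm x (a 0) w) as HL.
      pose proof (Rle_abs (gq g x w w - gq g (a 0) w w)) as HA.
      assert (HL2 : K * dl1 x (a 0) * nrm w ^ 2 <= 2 * K * W ^ 3 * h * h ^ 2).
      { assert (nrm w ^ 2 <= (W * h) ^ 2) by (apply pow_incr; split; [apply nrm_pos | assumption]).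
        pose proof (dl1_pos x (a 0)).
        apply Rle_trans with (K * (2 * W * h) * (W * h) ^ 2); [|right; ring].
        apply Rmult_le_compat; [apply Rmult_le_pos; lra | apply pow2_ge_0 | apply Rmult_le_compat_l; lra | assumption]. }
      assert (Eq : gq g (a 0) w w = h ^ 2 * gq g (a 0) z z + 2 * h * gq g (a 0) z e + gq g (a 0) e e).
      { rewrite Hw. unfold gq; simpl. ring. }
      pose proof (mb_gq Hm (a 0) z e) as G1. pose proof (mb_gq Hm (a 0) e e) as G2.
      pose proof (Rle_abs (gq g (a 0) z e)). pose proof (Rle_abs (gq g (a 0) e e)).
      pose proof (nrm_pos e). pose proof (nrm_pos z).
      assert (G1' : K * nrm z * nrm e <= K * (2 * V) * (2 * M * h ^ 2)).
      { apply Rmult_le_compat; [apply Rmult_le_pos; lra | lra | apply Rmult_le_compat_l; lra | assumption]. }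
      assert (G2' : K * nrm e * nrm e <= K * (2 * M * h ^ 2) * (2 * M * h ^ 2)).
      { apply Rmult_le_compat; [apply Rmult_le_pos; lra | lra | apply Rmult_le_compat_l; lra | assumption]. }
      assert (G1'' : 2 * h * gq g (a 0) z e <= 8 * (K * V * M) * h * h ^ 2).
      { apply Rle_trans with (2 * h * (K * (2 * V) * (2 * M * h ^ 2))); [|right; ring].
        apply Rmult_le_compat_l; lra. }
      assert (G2'' : gq g (a 0) e e <= 4 * (K * M ^ 2) * h * h ^ 2).
      { apply Rle_trans with (4 * (K * M ^ 2) * h ^ 2 * h ^ 2); [lra|].
        apply Rmult_le_compat_r; [apply pow2_ge_0|]. apply Rmult_le_compat_l; [|assumption].
        apply Rmult_le_pos; [lra|]. apply Rmult_le_pos; [lra | apply pow2_ge_0]. }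
      assert (C * h * h ^ 2 <= del / 2 * h ^ 2) by (apply Rmult_le_compat_r; [apply pow2_ge_0 | assumption]).
      replace (gq g (a 0) z z) with (4 - del) in Eq by (unfold del; ring).
      unfold C in *. lra. }
    assert (sqrt (4 - del / 2) < 2).
    { apply Rlt_le_trans with (sqrt (2 ^ 2)); [apply sqrt_lt_1_alt; lra | rewrite sqrt_pow2; lra]. }
    nra. }
  (* Parallelogram law: the squared lengths of [u + v] and [u - v] add up to 4. *)
  assert (Hz : gq g (a 0) (fst (u 0) - fst (v 0), snd (u 0) - snd (v 0)) (fst (u 0) - fst (v 0), snd (u 0) - snd (v 0)) <= 0).
  { replace (gq g (a 0) (fst (u 0) - fst (v 0), snd (u 0) - snd (v 0)) (fst (u 0) - fst (v 0), snd (u 0) - snd (v 0)))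
      with (2 * gq g (a 0) (u 0) (u 0) + 2 * gq g (a 0) (v 0) (v 0) - gq g (a 0) z z)
      by (unfold z, gq; simpl; ring). lra. }
  pose proof (mb_low Hm (a 0) (fst (u 0) - fst (v 0), snd (u 0) - snd (v 0))) as HL.
  change (nrm (fst (u 0) - fst (v 0), snd (u 0) - snd (v 0))) with (dl1 (u 0) (v 0)) in HL.
  apply dl1_eq0. apply Rnot_lt_le. intros Hpos.
  assert (0 < (lam * dl1 (u 0) (v 0)) ^ 2) by (apply pow_lt, Rmult_lt_0_compat; lra). lra.
Qed.

Definition range (c : R -> R * R) (p : R * R) : Prop := exists t, c t = p.

Definition same_range (a b : R -> R * R) : Prop := forall p, range a p <-> range b p.

Lemma minimal_meet_twice_oriented g a u b v s1 s2 t1 t2 : is_torus_metric g ->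
  min_geodesic g a u -> min_geodesic g b v -> a s1 = b t1 -> a s2 = b t2 -> s1 < s2 -> t1 < t2 ->
  same_range a b.
Proof.
  intros Hg Ha Hb E1 E2 Hs Ht.
  assert (Hlen : s2 - s1 = t2 - t1).
  { pose proof (proj2 Ha s1 s2) as Da. pose proof (proj2 Hb t1 t2) as Db.
    rewrite E1, E2, Db in Da. rewrite !Rabs_left in Da by lra. lra. }
  pose proof (min_geodesic_shift g a u s2 Ha) as Ha'. pose proof (min_geodesic_shift g b v t2 Hb) as Hb'.
  assert (Ev : u (0 + s2) = v (0 + t2)).
  { apply (no_corner g (fun t => a (t + s2)) (fun t => u (t + s2)) (fun t => b (t + t2)) (fun t => v (t + t2)));
      [assumption | apply Ha' | apply Hb' | now rewrite !Rplus_0_l |].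
    (* Minimality of [b] puts [b (h + t2)] at distance [t2 - t1 + h] from the first meeting point;
       removing the stretch of [a] of length [s2 - s1 - h] leaves at least [2 * h]. The bound on [h]
       keeps the point of [a] behind the first meeting. *)
    exists (s2 - s1). split; [lra|]. intros h Hh.
    pose proof (dist_triangle g (a s1) (a (- h + s2)) (b (h + t2)) Hg) as HT.
    rewrite (proj2 Ha) in HT. rewrite E1, (proj2 Hb) in HT.
    rewrite (Rabs_left1 (s1 - (- h + s2))), (Rabs_left1 (t1 - (h + t2))) in HT by lra. lra. }
  assert (E : forall t, a (t + s2) = b (t + t2)).
  { intros t. apply (unit_geodesic_unique g (fun t => a (t + s2)) (fun t => u (t + s2))
      (fun t => b (t + t2)) (fun t => v (t + t2)) Hg (proj1 Ha') (proj1 Hb')); [now rewrite !Rplus_0_l | exact Ev]. }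
  intros p. split; intros [t <-].
  - exists (t - s2 + t2). rewrite <- E. f_equal. ring.
  - exists (t - t2 + s2). rewrite E. f_equal. ring.
Qed.

(** Meetings in opposite order are reduced to the oriented case by reversing [b]. Equal times on [b]
    are impossible, since distinct times on [a] are distinct points. *)
Lemma minimal_meet_twice g a u b v s1 s2 t1 t2 : is_torus_metric g ->
  min_geodesic g a u -> min_geodesic g b v -> a s1 = b t1 -> a s2 = b t2 -> s1 <> s2 -> same_range a b.
Proof.
  intros Hg Ha Hb E1 E2 Hne.
  assert (HW : forall s1 s2 t1 t2, a s1 = b t1 -> a s2 = b t2 -> s1 < s2 -> same_range a b).
  { clear s1 s2 t1 t2 E1 E2 Hne. intros s1 s2 t1 t2 E1 E2 Hs.
    destruct (Rtotal_order t1 t2) as [Ht|[Ht|Ht]].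
    - now apply (minimal_meet_twice_oriented g a u b v s1 s2 t1 t2).
    - exfalso. subst t2. pose proof (proj2 Ha s1 s2) as D. rewrite E1, E2, (proj2 Hb), Rminus_diag, Rabs_R0 in D.
      rewrite Rabs_left in D; lra.
    - pose proof (min_geodesic_rev g b v Hb) as Hr.
      pose proof (minimal_meet_twice_oriented g a u _ _ s1 s2 (- t1) (- t2) Hg Ha Hr) as HS.
      cbv beta in HS. rewrite !Ropp_involutive in HS. specialize (HS E1 E2 Hs ltac:(lra)).
      intros p. rewrite (HS p). split; intros [t <-]; exists (- t); [reflexivity | f_equal; ring]. }
  destruct (Rtotal_order s1 s2) as [H|[H|H]]; [|contradiction|].
  - now apply (HW s1 s2 t1 t2).
  - now apply (HW s2 s1 t2 t1).
Qed.

(** * Polygonal connectedness *)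

Definition lin (p q : R * R) (t : R) : R * R :=
  (fst p + t * (fst q - fst p), snd p + t * (snd q - snd p)).

Definition seg_avoids (A : R * R -> Prop) (p q : R * R) : Prop := forall t, 0 <= t <= 1 -> ~ A (lin p q t).

(** Polygonal paths let statements about complementary regions be proved by induction over segments.
    The premise of [conn_refl] ensures that connected points always lie off [A]. *)
Inductive conn (A : R * R -> Prop) : R * R -> R * R -> Prop :=
| conn_refl p : ~ A p -> conn A p p
| conn_step p q r : seg_avoids A p q -> conn A q r -> conn A p r.

Lemma lin_0 p q : lin p q 0 = p.
Proof. apply pair_line_0. Qed.

Lemma lin_1 p q : lin p q 1 = q.
Proof. apply pair_line_1. Qed.

Lemma lin_rev p q t : lin q p t = lin p q (1 - t).
Proof. unfold lin; f_equal; ring. Qed.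

Lemma seg_avoids_sym A p q : seg_avoids A p q -> seg_avoids A q p.
Proof. intros H t Ht. rewrite lin_rev. apply H. lra. Qed.

Lemma conn_seg A p q : seg_avoids A p q -> conn A p q.
Proof.
  intros H. apply (conn_step A p q q H). apply conn_refl.
  rewrite <- (lin_1 p q). apply H. lra.
Qed.

Lemma conn_trans A p q r : conn A p q -> conn A q r -> conn A p r.
Proof.
  induction 1 as [|p p1 q Hs Hc IH]; intros H1; [assumption|].
  apply (conn_step A p p1 r Hs). now apply IH.
Qed.
Arguments conn_trans {A p q r}.

Lemma conn_sym A p q : conn A p q -> conn A q p.
Proof.
  induction 1 as [p Hp|p p' q Hs Hc IH]; [now apply conn_refl|].
  apply (conn_trans IH). now apply conn_seg, seg_avoids_sym.
Qed.
Arguments conn_sym {A p q}.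

Lemma conn_mono (A B : R * R -> Prop) p q : (forall x, A x -> B x) -> conn B p q -> conn A p q.
Proof.
  intros HAB. induction 1 as [p Hp|p p' q Hs Hc IH].
  - apply conn_refl. intros H. now apply Hp, HAB.
  - apply (conn_step A p p' q); [|assumption]. intros t Ht H. now apply (Hs t Ht), HAB.
Qed.

Lemma dl1_lin_le p q x r t : 0 <= t <= 1 -> dl1 p x <= r -> dl1 q x <= r -> dl1 (lin p q t) x <= r.
Proof.
  intros Ht Hp Hq. unfold dl1, lin in *; cbn [fst snd].
  replace (fst p + t * (fst q - fst p) - fst x) with ((1 - t) * (fst p - fst x) + t * (fst q - fst x)) by ring.
  replace (snd p + t * (snd q - snd p) - snd x) with ((1 - t) * (snd p - snd x) + t * (snd q - snd x)) by ring.
  pose proof (Rabs_triang ((1 - t) * (fst p - fst x)) (t * (fst q - fst x))) as E1.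
  pose proof (Rabs_triang ((1 - t) * (snd p - snd x)) (t * (snd q - snd x))) as E2.
  rewrite !Rabs_mult, (Rabs_pos_eq t), (Rabs_pos_eq (1 - t)) in E1, E2 by lra. nra.
Qed.

Definition closed_set (A : R * R -> Prop) : Prop :=
  forall p, ~ A p -> exists d, 0 < d /\ forall q, dl1 q p <= d -> ~ A q.

(** * Uniformly embedded curves *)

(** The part of minimality that the planar arguments use: a bi-Lipschitz proper embedding with
    controlled turning. The vector [u] enters as velocity only through [good_taylor], and the
    constants are shared by all curves of an arrangement. *)
Record good_curve (kap V M : R) (c u : R -> R * R) : Prop := {
  good_kap : 0 < kap;
  good_V : 0 < V;
  good_M : 0 < M;
  good_low : forall s t, kap * Rabs (s - t) <= dl1 (c s) (c t);
  good_up : forall s t, dl1 (c s) (c t) <= V * Rabs (s - t);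
  good_speed : forall t, kap <= nrm (u t) <= V;
  good_lip : forall s t, dl1 (u s) (u t) <= M * Rabs (s - t);
  good_taylor : forall t h,
    dl1 (c (t + h)) (fst (c t) + h * fst (u t), snd (c t) + h * snd (u t)) <= M * h ^ 2
}.

Arguments good_kap {kap V M c u}.
Arguments good_V {kap V M c u}.
Arguments good_M {kap V M c u}.
Arguments good_low {kap V M c u}.
Arguments good_up {kap V M c u}.
Arguments good_speed {kap V M c u}.
Arguments good_lip {kap V M c u}.
Arguments good_taylor {kap V M c u}.

Lemma good_closed kap V M c u : good_curve kap V M c u -> closed_set (range c).
Proof.
  intros Hc p Hp. pose proof (good_kap Hc) as Hk. pose proof (good_V Hc) as HV.
  (* Beyond time [N] the lower bound [good_low] keeps the curve at distance more than 1 from [p], so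
     only a compact time interval has to be examined. *)
  set (N := (1 + dl1 (c 0) p) / kap).
  assert (HN : 0 <= N) by (apply Rdiv_le_0_compat; [pose proof (dl1_pos (c 0) p); lra | assumption]).
  destruct (continuity_ab_min (fun t => dl1 (c t) p) (- N) N) as [m [Hm Hmr]]; [lra| |].
  { intros t _. apply continuity_pt_filterlim.
    assert (HL : forall s, Rabs (dl1 (c s) p - dl1 (c t) p) <= V * Rabs (s - t)).
    { intros s. pose proof (dl1_triang (c s) (c t) p). pose proof (dl1_triang (c t) (c s) p).
      rewrite (dl1_sym (c t) (c s)) in *. pose proof (good_up Hc s t).
      apply Rabs_le. lra. }
    intros P [e He]. assert (Hd : 0 < e / V) by (apply Rdiv_lt_0_compat; [apply cond_pos | assumption]).
    exists (mkposreal _ Hd). intros s Hs. apply He.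
    change (Rabs (dl1 (c s) p - dl1 (c t) p) < e). change (Rabs (s - t) < e / V) in Hs.
    eapply Rle_lt_trans; [apply HL|]. apply Rlt_le_trans with (V * (e / V)).
    - now apply Rmult_lt_compat_l.
    - right. field. lra. }
  assert (Hpos : 0 < dl1 (c m) p).
  { apply Rnot_le_lt. intros Hle. apply Hp. exists m. now apply dl1_eq0. }
  exists (Rmin 1 (dl1 (c m) p) / 2). pose proof (Rmin_pos 1 _ Rlt_0_1 Hpos) as Hd.
  pose proof (Rmin_l 1 (dl1 (c m) p)). pose proof (Rmin_r 1 (dl1 (c m) p)).
  split; [lra|]. intros q Hq [t <-].
  destruct (Rle_dec (Rabs t) N) as [Ht|Ht].
  - assert (- N <= t <= N) by (apply Rabs_le_between; assumption).
    specialize (Hm t H1). cbv beta in Hm. lra.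
  - pose proof (good_low Hc t 0) as HL. rewrite Rminus_0_r in HL.
    assert (kap * N < kap * Rabs t) by (apply Rmult_lt_compat_l; lra).
    assert (EN : kap * N = 1 + dl1 (c 0) p) by (unfold N; field; lra).
    pose proof (dl1_triang (c t) p (c 0)). rewrite (dl1_sym p (c 0)) in *. lra.
Qed.
Arguments good_closed {kap V M c u}.

(* Coordinates along [u] and along its left normal, scaled by the squared Euclidean norm of [u]. *)

Definition fX (c0 u0 p : R * R) : R := fst u0 * (fst p - fst c0) + snd u0 * (snd p - snd c0).
Definition fH (c0 u0 p : R * R) : R := fst u0 * (snd p - snd c0) - snd u0 * (fst p - fst c0).
Definition esq (u0 : R * R) : R := fst u0 ^ 2 + snd u0 ^ 2.
Definition frame (c0 u0 : R * R) (x h : R) : R * R :=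
  (fst c0 + (x * fst u0 - h * snd u0) / esq u0, snd c0 + (x * snd u0 + h * fst u0) / esq u0).

Lemma esq_ge kap u0 : 0 < kap -> kap <= nrm u0 -> kap ^ 2 <= 2 * esq u0.
Proof.
  intros Hk H. unfold esq, nrm in *. rewrite <- (pow2_abs (fst u0)), <- (pow2_abs (snd u0)).
  pose proof (pow2_ge_0 (Rabs (fst u0) - Rabs (snd u0))).
  pose proof (Rabs_pos (fst u0)). pose proof (Rabs_pos (snd u0)). nra.
Qed.

Lemma nrm_sq_le_esq u0 : nrm u0 ^ 2 <= 2 * esq u0.
Proof.
  unfold esq, nrm in *. rewrite <- (pow2_abs (fst u0)), <- (pow2_abs (snd u0)).
  pose proof (pow2_ge_0 (Rabs (fst u0) - Rabs (snd u0))). nra.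
Qed.

Lemma dot_le V (a b : R * R) : nrm a <= V -> Rabs (fst a * fst b + snd a * snd b) <= V * nrm b.
Proof.
  unfold nrm. intros Ha. eapply Rle_trans; [apply Rabs_triang|]. rewrite !Rabs_mult.
  pose proof (Rabs_pos (fst a)). pose proof (Rabs_pos (snd a)).
  pose proof (Rabs_pos (fst b)). pose proof (Rabs_pos (snd b)). nra.
Qed.

Lemma fX_le V c0 u0 p : nrm u0 <= V -> Rabs (fX c0 u0 p) <= V * dl1 p c0.
Proof. intros H. apply (dot_le V u0 (fst p - fst c0, snd p - snd c0) H). Qed.

Lemma fH_le V c0 u0 p : nrm u0 <= V -> Rabs (fH c0 u0 p) <= V * dl1 p c0.
Proof.
  intros H. unfold fH.
  pose proof (dot_le V (- snd u0, fst u0) (fst p - fst c0, snd p - snd c0)) as E.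
  assert (E2 : nrm (- snd u0, fst u0) <= V) by (unfold nrm in *; cbn [fst snd]; rewrite Rabs_Ropp; lra).
  specialize (E E2). cbn [fst snd] in E.
  replace (- snd u0 * (fst p - fst c0) + fst u0 * (snd p - snd c0)) with
   (fst u0 * (snd p - snd c0) - snd u0 * (fst p - fst c0)) in E by ring. exact E.
Qed.

Lemma frame_coords c0 u0 p : 0 < esq u0 -> p = frame c0 u0 (fX c0 u0 p) (fH c0 u0 p).
Proof.
  intros H. unfold frame, fX, fH. destruct p as [x y]; cbn [fst snd].
  f_equal; unfold esq in *; field; lra.
Qed.

Lemma fX_frame c0 u0 x h : 0 < esq u0 -> fX c0 u0 (frame c0 u0 x h) = x.
Proof. intros H. unfold frame, fX; cbn [fst snd]. unfold esq in *; field; lra. Qed.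

Lemma fH_frame c0 u0 x h : 0 < esq u0 -> fH c0 u0 (frame c0 u0 x h) = h.
Proof. intros H. unfold frame, fH; cbn [fst snd]. unfold esq in *; field; lra. Qed.

Lemma lin_frame c0 u0 x h x' h' t : 0 < esq u0 ->
  lin (frame c0 u0 x h) (frame c0 u0 x' h') t = frame c0 u0 (x + t * (x' - x)) (h + t * (h' - h)).
Proof. intros H. unfold lin, frame; cbn [fst snd]. f_equal; field; lra. Qed.

Lemma frame_dist kap c0 u0 x h m : 0 < kap -> kap <= nrm u0 -> Rabs x <= m -> Rabs h <= m ->
  dl1 (frame c0 u0 x h) c0 <= 4 * m / kap.
Proof.
  intros Hk Hn Hx Hh. pose proof (nrm_sq_le_esq u0) as HE.
  assert (Hn0 : 0 < nrm u0) by lra.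
  assert (He : 0 < esq u0) by (assert (0 < nrm u0 ^ 2) by (now apply pow_lt); lra).
  unfold dl1, frame; cbn [fst snd].
  replace (fst c0 + (x * fst u0 - h * snd u0) / esq u0 - fst c0) with ((x * fst u0 - h * snd u0) / esq u0) by ring.
  replace (snd c0 + (x * snd u0 + h * fst u0) / esq u0 - snd c0) with ((x * snd u0 + h * fst u0) / esq u0) by ring.
  unfold Rdiv. rewrite !Rabs_mult, Rabs_inv, (Rabs_pos_eq (esq u0)) by lra.
  rewrite <- Rmult_plus_distr_r.
  assert (HS : Rabs (x * fst u0 - h * snd u0) + Rabs (x * snd u0 + h * fst u0) <= 2 * m * nrm u0).
  { pose proof (Rabs_triang (x * fst u0) (- (h * snd u0))) as E1. pose proof (Rabs_triang (x * snd u0) (h * fst u0)) as E2.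
    rewrite Rabs_Ropp, !Rabs_mult in E1. rewrite !Rabs_mult in E2. unfold Rminus, nrm in *.
    pose proof (Rabs_pos (fst u0)). pose proof (Rabs_pos (snd u0)).
    pose proof (Rabs_pos x). pose proof (Rabs_pos h). nra. }
  assert (Hm : 0 <= m) by (pose proof (Rabs_pos x); lra).
  apply Rmult_le_reg_r with (esq u0 * kap); [now apply Rmult_lt_0_compat|].
  replace (4 * m * / kap * (esq u0 * kap)) with (4 * m * esq u0) by (field; lra).
  replace ((Rabs (x * fst u0 - h * snd u0) + Rabs (x * snd u0 + h * fst u0)) * / esq u0 * (esq u0 * kap))
    with ((Rabs (x * fst u0 - h * snd u0) + Rabs (x * snd u0 + h * fst u0)) * kap) by (field; lra).
  apply Rle_trans with (2 * m * nrm u0 * kap); [apply Rmult_le_compat_r; lra|].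
  apply Rle_trans with (2 * m * nrm u0 * nrm u0).
  - apply Rmult_le_compat_l; [|lra]. apply Rmult_le_pos; lra.
  - replace (4 * m * esq u0) with (2 * m * (2 * esq u0)) by ring. rewrite Rmult_assoc.
    apply Rmult_le_compat_l; lra.
Qed.

(** * Curves as graphs over their tangent lines *)

(** For [w] this window, [kap ^ 2 / 2] equals [6 V M w]. The abscissa along the tangent has at least
    this slope, while turning and Taylor remainder can take away only [V M w] and [2 V M w]. *)
Definition window (kap V M : R) : R := kap ^ 2 / (12 * (V * M)).

Lemma window_pos kap V M c u : good_curve kap V M c u -> 0 < window kap V M.
Proof.
  intros [Hk HV HM _ _ _ _ _]. apply Rdiv_lt_0_compat; [now apply pow_lt|].
  apply Rmult_lt_0_compat; [lra | now apply Rmult_lt_0_compat].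
Qed.
Arguments window_pos {kap V M c u}.

Lemma good_esq kap V M c u t : good_curve kap V M c u -> 0 < esq (u t).
Proof.
  intros Hc. pose proof (esq_ge kap (u t) (good_kap Hc) (proj1 (good_speed Hc t))).
  assert (0 < kap ^ 2) by (apply pow_lt, (good_kap Hc)). lra.
Qed.
Arguments good_esq {kap V M c u}.

(** Between two times of the window the abscissa changes by their difference times [esq (u t0)], up
    to the turning of the velocity and the Taylor remainder; neither is large enough to cancel
    it. *)
Lemma good_fX_injective kap V M c u t0 s1 s2 : good_curve kap V M c u ->
  Rabs (s1 - t0) <= window kap V M -> Rabs (s2 - t0) <= window kap V M ->
  fX (c t0) (u t0) (c s1) = fX (c t0) (u t0) (c s2) -> s1 = s2.
Proof.
  intros Hc H1 H2 HX. pose proof (window_pos Hc) as Hw.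
  pose proof (good_esq t0 Hc) as Hesq.
  destruct Hc as [Hk HV HM Hlow Hup Hsp Hlip Htay].
  set (w := window kap V M) in *.
  assert (Ew : 12 * (V * M) * w = kap ^ 2) by (unfold w, window; field; split; lra).
  specialize (Htay s2 (s1 - s2)). replace (s2 + (s1 - s2)) with s1 in Htay by ring.
  set (D := s1 - s2) in *.
  set (e := (fst (c s1) - (fst (c s2) + D * fst (u s2)), snd (c s1) - (snd (c s2) + D * snd (u s2)))).
  change (nrm e <= M * D ^ 2) in Htay.
  assert (HD : Rabs D <= 2 * w).
  { unfold D. replace (s1 - s2) with ((s1 - t0) + - (s2 - t0)) by ring.
    eapply Rle_trans; [apply Rabs_triang|]. rewrite Rabs_Ropp. lra. }
  assert (EX : 0 = D * (esq (u t0) + (fst (u t0) * (fst (u s2) - fst (u t0)) + snd (u t0) * (snd (u s2) - snd (u t0))))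
     + (fst (u t0) * fst e + snd (u t0) * snd e)).
  { unfold fX in HX. unfold e, esq; cbn [fst snd]. nra. }
  pose proof (dot_le V (u t0) (fst (u s2) - fst (u t0), snd (u s2) - snd (u t0)) (proj2 (Hsp t0))) as B1.
  cbn [fst snd] in B1. change (nrm (fst (u s2) - fst (u t0), snd (u s2) - snd (u t0))) with (dl1 (u s2) (u t0)) in B1.
  pose proof (dot_le V (u t0) e (proj2 (Hsp t0))) as B2.
  set (P := fst (u t0) * (fst (u s2) - fst (u t0)) + snd (u t0) * (snd (u s2) - snd (u t0))) in *.
  set (Q := fst (u t0) * fst e + snd (u t0) * snd e) in *.
  pose proof (Hlip s2 t0) as HL.
  assert (B1' : Rabs P <= V * M * w).
  { eapply Rle_trans; [exact B1|]. rewrite Rmult_assoc. apply Rmult_le_compat_l; [lra|].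
    eapply Rle_trans; [exact HL|]. apply Rmult_le_compat_l; lra. }
  assert (B2' : Rabs Q <= V * M * (2 * w) * Rabs D).
  { eapply Rle_trans; [exact B2|].
    apply Rle_trans with (V * (M * D ^ 2)); [apply Rmult_le_compat_l; lra|].
    rewrite <- (pow2_abs D). pose proof (Rabs_pos D).
    replace (V * (M * Rabs D ^ 2)) with (V * M * Rabs D * Rabs D) by ring.
    apply Rmult_le_compat_r; [assumption|]. apply Rmult_le_compat_l; [|assumption].
    apply Rmult_le_pos; lra. }
  pose proof (esq_ge kap (u t0) Hk (proj1 (Hsp t0))) as HE.
  assert (HPb : 3 * (V * M * w) <= esq (u t0) + P) by (apply Rabs_le_between in B1'; lra).
  assert (HVMw : 0 < V * M * w) by (apply Rmult_lt_0_compat; [apply Rmult_lt_0_compat|]; assumption).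
  destruct (Req_dec D 0) as [E0|Hne]; [unfold D in E0; lra|]. exfalso.
  apply Rabs_pos_lt in Hne.
  assert (EQ : Rabs D * (esq (u t0) + P) = Rabs Q).
  { rewrite <- (Rabs_pos_eq (esq (u t0) + P)) by lra. rewrite <- Rabs_mult, <- Rabs_Ropp. f_equal. lra. }
  nra.
Qed.

Lemma good_fH_small kap V M c u t0 s : good_curve kap V M c u ->
  Rabs (fH (c t0) (u t0) (c s)) <= V * M * (s - t0) ^ 2.
Proof.
  intros Hc. destruct Hc as [Hk HV HM Hlow Hup Hsp Hlip Htay].
  specialize (Htay t0 (s - t0)). replace (t0 + (s - t0)) with s in Htay by ring.
  set (q := (fst (c t0) + (s - t0) * fst (u t0), snd (c t0) + (s - t0) * snd (u t0))) in *.
  replace (fH (c t0) (u t0) (c s)) with (fH q (u t0) (c s)) by (unfold fH, q; cbn [fst snd]; ring).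
  eapply Rle_trans; [apply (fH_le V), Hsp|]. rewrite Rmult_assoc. apply Rmult_le_compat_l; lra.
Qed.

(* The tube radius up to which the curve is a graph over each of its tangent lines. *)
Definition tube (kap V M : R) : R :=
  Rmin (kap ^ 2 * window kap V M / (4 * V)) (kap ^ 4 / (32 * (M * V ^ 2))).

Lemma tube_pos kap V M c u : good_curve kap V M c u -> 0 < tube kap V M.
Proof.
  intros Hc. pose proof (window_pos Hc). destruct Hc as [Hk HV HM _ _ _ _ _].
  apply Rmin_pos; apply Rdiv_lt_0_compat; try lra.
  - apply Rmult_lt_0_compat; [now apply pow_lt | assumption].
  - now apply pow_lt.
  - assert (0 < V ^ 2) by now apply pow_lt. assert (0 < M * V ^ 2) by now apply Rmult_lt_0_compat. lra.
Qed.
Arguments tube_pos {kap V M c u}.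

(** [good_low] converts closeness in the plane into [4 V r / kap ^ 2] closeness in time. The first
    entry of the minimum in [tube] brings this inside the window; the second keeps the quadratic
    height below half of [V * r]. *)
Lemma good_near kap V M c u t0 r s : good_curve kap V M c u -> 0 < r <= tube kap V M ->
  dl1 (c s) (c t0) <= 4 * V / kap * r ->
  Rabs (s - t0) <= window kap V M /\ Rabs (fH (c t0) (u t0) (c s)) <= V * r / 2.
Proof.
  intros Hc Hr Hd. pose proof (good_fH_small kap V M c u t0 s Hc) as HH.
  destruct Hc as [Hk HV HM Hlow Hup Hsp Hlip Htay].
  pose proof (Hlow s t0) as HL.
  assert (Hs : Rabs (s - t0) <= 4 * V * r / kap ^ 2).
  { apply Rmult_le_reg_l with kap; [assumption|].
    replace (kap * (4 * V * r / kap ^ 2)) with (4 * V / kap * r) by (field; lra). lra. }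
  pose proof (Rmin_l (kap ^ 2 * window kap V M / (4 * V)) (kap ^ 4 / (32 * (M * V ^ 2)))) as T1.
  pose proof (Rmin_r (kap ^ 2 * window kap V M / (4 * V)) (kap ^ 4 / (32 * (M * V ^ 2)))) as T2.
  fold (tube kap V M) in T1, T2.
  assert (Hk2 : 0 < kap ^ 2) by now apply pow_lt.
  split.
  - eapply Rle_trans; [exact Hs|]. apply Rmult_le_reg_l with (kap ^ 2 / (4 * V)); [apply Rdiv_lt_0_compat; lra|].
    replace (kap ^ 2 / (4 * V) * (4 * V * r / kap ^ 2)) with r by (field; lra).
    replace (kap ^ 2 / (4 * V) * window kap V M) with (kap ^ 2 * window kap V M / (4 * V)) by (field; lra). lra.
  - eapply Rle_trans; [exact HH|]. rewrite <- pow2_abs.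
    apply Rle_trans with (V * M * (4 * V * r / kap ^ 2) ^ 2).
    + apply Rmult_le_compat_l; [apply Rmult_le_pos; lra|]. apply pow_incr. split; [apply Rabs_pos | assumption].
    + replace (V * M * (4 * V * r / kap ^ 2) ^ 2) with (V * r / 2 * (32 * (M * V ^ 2) / kap ^ 4 * r)) by (field; lra).
      rewrite <- (Rmult_1_r (V * r / 2)) at 2. apply Rmult_le_compat_l; [apply Rdiv_le_0_compat; [apply Rmult_le_pos|]; lra|].
      assert (HV2 : 0 < V ^ 2) by now apply pow_lt.
      assert (HMV : 0 < M * V ^ 2) by now apply Rmult_lt_0_compat.
      apply Rle_trans with (32 * (M * V ^ 2) / kap ^ 4 * (kap ^ 4 / (32 * (M * V ^ 2)))).
      * apply Rmult_le_compat_l; [apply Rdiv_le_0_compat; [lra | now apply pow_lt] | lra].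
      * right. field. repeat split; lra.
Qed.

(* The point at signed height [h] on the normal line of the curve at [c t]. *)
Definition tb (c u : R -> R * R) (t h : R) : R * R := frame (c t) (u t) 0 h.

Definition un (A B : R * R -> Prop) (p : R * R) : Prop := A p \/ B p.

Lemma tb_dist kap V M c u t r h : good_curve kap V M c u -> Rabs h <= V * r ->
  dl1 (tb c u t h) (c t) <= 4 * V / kap * r.
Proof.
  intros Hc Hh. pose proof (good_kap Hc).
  eapply Rle_trans; [apply (frame_dist kap _ _ 0 h (V * r)); try assumption|].
  - apply (good_speed Hc).
  - rewrite Rabs_R0. pose proof (Rabs_pos h). lra.
  - right. field. lra.
Qed.

(* Over a given abscissa the curve has at most one point, so it cannot meet both vertical segments issued from [p]. *)
Lemma near_conn_tb kap V M c u A t0 r p : good_curve kap V M c u -> 0 < r <= tube kap V M ->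
  (forall q, dl1 q (c t0) <= 4 * V / kap * r -> ~ A q) -> ~ range c p -> dl1 p (c t0) <= r ->
  conn (un A (range c)) p (tb c u t0 (V * r)) \/ conn (un A (range c)) p (tb c u t0 (- (V * r))).
Proof.
  intros Hc Hr HA Hp Hd. pose proof (good_esq t0 Hc) as He.
  pose proof (good_kap Hc) as Hk. pose proof (good_V Hc) as HV.
  pose proof (good_speed Hc t0) as Hsp.
  set (F := frame (c t0) (u t0)).
  set (X := fX (c t0) (u t0) p). set (H := fH (c t0) (u t0) p).
  assert (HVr : 0 < V * r) by (apply Rmult_lt_0_compat; lra).
  assert (HX : Rabs X <= V * r).
  { eapply Rle_trans; [apply (fX_le V), Hsp|]. apply Rmult_le_compat_l; lra. }
  assert (HH : Rabs H <= V * r).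
  { eapply Rle_trans; [apply (fH_le V), Hsp|]. apply Rmult_le_compat_l; lra. }
  assert (Ep : p = F X H) by now apply frame_coords.
  apply Rabs_le_between in HX. apply Rabs_le_between in HH.
  assert (HF : forall x h, - (V * r) <= x <= V * r -> - (V * r) <= h <= V * r -> dl1 (F x h) (c t0) <= 4 * V / kap * r).
  { intros x h Hx Hh. eapply Rle_trans.
    - apply (frame_dist kap _ _ x h (V * r)); try apply Hsp; try assumption; now apply Rabs_le_between.
    - right. field. lra. }
  assert (HFc : forall x h s, - (V * r) <= x <= V * r -> - (V * r) <= h <= V * r -> c s = F x h ->
     Rabs (s - t0) <= window kap V M /\ Rabs h <= V * r / 2 /\ fX (c t0) (u t0) (c s) = x).
  { intros x h s Hx Hh E.
    destruct (good_near kap V M c u t0 r s Hc Hr) as [N1 N2]; [rewrite E; now apply HF|].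
    rewrite E in N2. unfold F in N2. rewrite fH_frame in N2 by assumption.
    split; [assumption|split; [assumption|]]. rewrite E. now apply fX_frame. }
  assert (Hmid : forall a b t, - (V * r) <= a <= V * r -> - (V * r) <= b <= V * r -> 0 <= t <= 1 ->
     - (V * r) <= a + t * (b - a) <= V * r).
  { intros a b t Ha Hb Ht. split; nra. }
  (* At height [V * r] in absolute value the horizontal segments are clear, since curve points in
     this neighbourhood have at most half that height. *)
  assert (Hhor : forall e, e = V * r \/ e = - (V * r) -> seg_avoids (un A (range c)) (F X e) (F 0 e)).
  { intros e He' t Ht [HAq|[s Hs]].
    - unfold F in HAq. rewrite lin_frame in HAq by assumption. apply (HA _ (HF _ _ (Hmid X 0 t ltac:(lra) ltac:(lra) Ht)
        (Hmid e e t ltac:(lra) ltac:(lra) Ht)) HAq).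
    - unfold F in Hs. rewrite lin_frame in Hs by assumption.
      destruct (HFc _ _ _ (Hmid X 0 t ltac:(lra) ltac:(lra) Ht) (Hmid e e t ltac:(lra) ltac:(lra) Ht) Hs) as (_ & Q & _).
      replace (e + t * (e - e)) with e in Q by ring. apply Rabs_le_between in Q. lra. }
  assert (Hver : forall e, e = V * r \/ e = - (V * r) ->
     seg_avoids (un A (range c)) p (F X e) \/ exists t s, 0 <= t <= 1 /\ c s = F X (H + t * (e - H))).
  { intros e He'. destruct (classic (exists t s, 0 <= t <= 1 /\ c s = F X (H + t * (e - H)))) as [|Hn]; [now right|left].
    intros t Ht. rewrite Ep. unfold F. rewrite lin_frame by assumption.
    replace (X + t * (X - X)) with X by ring. intros [HAq|[s Hs]].
    - apply (HA _ (HF X (H + t * (e - H)) ltac:(lra) (Hmid H e t ltac:(lra) ltac:(lra) Ht)) HAq).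
    - apply Hn. exists t, s. auto. }
  destruct (Hver (V * r) ltac:(lra)) as [Hup|(t1 & s1 & Ht1 & E1)].
  { left. apply (conn_step _ _ _ _ Hup). apply conn_seg. apply Hhor. lra. }
  destruct (Hver (- (V * r)) ltac:(lra)) as [Hdn|(t2 & s2 & Ht2 & E2)].
  { right. apply (conn_step _ _ _ _ Hdn). apply conn_seg. apply Hhor. lra. }
  (* If both vertical segments are hit, injectivity of the abscissa makes the two hits one point.
     Its height is both at least and at most that of [p], so it is [p]. *)
  exfalso. apply Hp.
  destruct (HFc X _ _ ltac:(lra) (Hmid H (V * r) t1 ltac:(lra) ltac:(lra) Ht1) E1) as (W1 & _ & X1).
  destruct (HFc X _ _ ltac:(lra) (Hmid H (- (V * r)) t2 ltac:(lra) ltac:(lra) Ht2) E2) as (W2 & _ & X2).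
  assert (E : s1 = s2) by (apply (good_fX_injective kap V M c u t0); congruence).
  subst s2. exists s1. rewrite Ep, E1. f_equal.
  assert (EH : H + t1 * (V * r - H) = H + t2 * (- (V * r) - H)).
  { pose proof (fH_frame (c t0) (u t0) X (H + t1 * (V * r - H)) He) as Q1.
    pose proof (fH_frame (c t0) (u t0) X (H + t2 * (- (V * r) - H)) He) as Q2.
    fold F in Q1, Q2. rewrite <- E1 in Q1. rewrite <- E2 in Q2. congruence. }
  nra.
Qed.

(** Inside the tube the normal line meets the curve only at height 0, and heights of equal sign are
    joined without passing through 0. *)
Lemma tb_conn kap V M c u A t0 r h h' : good_curve kap V M c u -> 0 < r <= tube kap V M ->
  (forall q, dl1 q (c t0) <= 4 * V / kap * r -> ~ A q) ->
  0 < h * h' -> Rabs h <= V * r -> Rabs h' <= V * r ->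
  conn (un A (range c)) (tb c u t0 h) (tb c u t0 h').
Proof.
  intros Hc Hr HA Hhh Hh Hh'. pose proof (good_esq t0 Hc) as He.
  apply conn_seg. intros t Ht. unfold tb. rewrite lin_frame by assumption.
  replace (0 + t * (0 - 0)) with 0 by ring.
  set (k := h + t * (h' - h)).
  assert (Hk : Rabs k <= V * r).
  { apply Rabs_le_between in Hh. apply Rabs_le_between in Hh'. apply Rabs_le_between. unfold k. split; nra. }
  assert (Hk0 : k <> 0).
  { assert (Hhk : 0 < h * k).
    { assert (0 < h ^ 2) by (assert (h <> 0) by (intros ->; lra); nra).
      replace (h * k) with ((1 - t) * h ^ 2 + t * (h * h')) by (unfold k; ring).
      destruct (Rle_dec t (1 / 2)); nra. }
    intros E0. rewrite E0 in Hhk. lra. }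
  pose proof (tb_dist kap V M c u t0 r k Hc Hk) as Hd.
  intros [HAq|[s Hs]]; [now apply (HA _ Hd)|].
  destruct (good_near kap V M c u t0 r s Hc Hr) as [N1 _]; [rewrite Hs; exact Hd|].
  assert (s = t0).
  { apply (good_fX_injective kap V M c u t0); [assumption | assumption | |].
    - rewrite Rminus_diag, Rabs_R0. apply Rlt_le, (window_pos Hc).
    - rewrite Hs at 1. rewrite fX_frame by assumption. unfold fX. ring. }
  subst s. apply Hk0. rewrite <- (fH_frame (c t0) (u t0) 0 k) by assumption. rewrite <- Hs. unfold fH. ring.
Qed.

(** A polygonal connection of a point with itself already certifies that the point is off the curve,
    so [tb_conn] with empty [A] applies. *)
Lemma tb_not_range kap V M c u t0 r h : good_curve kap V M c u -> 0 < r <= tube kap V M ->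
  h <> 0 -> Rabs h <= V * r -> ~ range c (tb c u t0 h).
Proof.
  intros Hc Hr Hh0 Hh.
  assert (Hcn : conn (un (fun _ => False) (range c)) (tb c u t0 h) (tb c u t0 h)).
  { apply (tb_conn kap V M c u _ t0 r); try assumption; [tauto | nra]. }
  intros Hin. inversion Hcn as [p Hp|p q r' Hs Hc']; subst.
  - apply Hp. now right.
  - apply (Hs 0 ltac:(lra)). rewrite lin_0. now right.
Qed.

(** * Complementary regions of an arrangement of curves *)

(** Connectedness of the interval: near the supremum of the times where [P] holds, the local
    hypothesis carries [P] past it unless it is [b]. *)
Lemma interval_propagate (P : R -> Prop) (a b : R) : a <= b -> P a ->
  (forall t, a <= t <= b -> exists d, 0 < d /\
     forall s s', a <= s <= b -> a <= s' <= b -> Rabs (s - t) < d -> Rabs (s' - t) < d -> P s -> P s') ->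
  P b.
Proof.
  intros Hab Ha Hloc.
  set (E := fun x => a <= x <= b /\ P x).
  destruct (completeness E) as [m [Hub Hlub]].
  - exists b. intros x [Hx _]. lra.
  - exists a. split; [lra | assumption].
  - assert (Ham : a <= m) by (apply Hub; split; [lra | assumption]).
    assert (Hmb : m <= b) by (apply Hlub; intros x [Hx _]; lra).
    destruct (Hloc m ltac:(lra)) as [d [Hd Hm]].
    assert (Hex : exists s, E s /\ m - d < s).
    { apply NNPP. intros Hn. assert (m <= m - d); [|lra]. apply Hlub.
      intros x Hx. apply Rnot_lt_le. intros Hlt. apply Hn. now exists x. }
    destruct Hex as [s [[Hs HPs] Hsd]].
    assert (Hsm : s <= m) by now apply Hub.
    set (s' := Rmin b (m + d / 2)).
    assert (Hs' : a <= s' <= b /\ Rabs (s' - m) < d).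
    { unfold s', Rmin. destruct (Rle_dec b (m + d / 2)); split; try lra; apply Rabs_def1; lra. }
    assert (HP : P s').
    { apply (Hm s s'); try tauto. apply Rabs_def1; lra. }
    assert (s' <= m) by (apply Hub; split; tauto).
    replace b with s'; [assumption|]. unfold s', Rmin in *. destruct (Rle_dec b (m + d / 2)); lra.
Qed.

Lemma interval_propagate_sym (P : R -> Prop) (a b : R) : P a ->
  (forall t, Rmin a b <= t <= Rmax a b -> exists d, 0 < d /\
     forall s s', Rabs (s - t) < d -> Rabs (s' - t) < d -> P s -> P s') ->
  P b.
Proof.
  intros Ha Hloc. destruct (Rle_dec a b) as [Hab|Hab].
  - rewrite Rmin_left, Rmax_right in Hloc by lra. apply (interval_propagate P a b); try assumption.
    intros t Ht. destruct (Hloc t Ht) as [d [Hd H]]. exists d. split; [assumption|].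
    intros s s' _ _ H1 H2 H3. exact (H s s' H1 H2 H3).
  - rewrite Rmin_right, Rmax_left in Hloc by lra.
    rewrite <- (Ropp_involutive b). apply (interval_propagate (fun x => P (- x)) (- a) (- b)); [lra | now rewrite Ropp_involutive|].
    intros t Ht. destruct (Hloc (- t) ltac:(lra)) as [d [Hd H]]. exists d. split; [assumption|].
    intros s s' _ _ H1 H2 H3. apply (H (- s) (- s')); [| |assumption].
    + rewrite <- Rabs_Ropp. now replace (- (- s - - t)) with (s - t) by ring.
    + rewrite <- Rabs_Ropp. now replace (- (- s' - - t)) with (s' - t) by ring.
Qed.

(** The references [L] and [N] are independent of [t]; this is what allows the property to be
    transported along an arc that misses [A], and one pair of points to serve the whole arc. *)
Definition two_sided (A : R * R -> Prop) (c : R -> R * R) (L N : R * R) (t : R) : Prop :=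
  exists r, 0 < r /\ forall p, ~ range c p -> dl1 p (c t) <= r ->
    conn (un A (range c)) p L \/ conn (un A (range c)) p N.

Lemma ball_shrink kap V M c u t0 s A d r : good_curve kap V M c u ->
  (forall q, dl1 q (c t0) <= d -> ~ A q) -> V * Rabs (s - t0) <= d / 2 -> 4 * V / kap * r <= d / 2 ->
  forall q, dl1 q (c s) <= 4 * V / kap * r -> ~ A q.
Proof.
  intros Hc HA Hs Hr q Hq. apply HA. pose proof (dl1_triang q (c s) (c t0)).
  pose proof (good_up Hc s t0). lra.
Qed.

Lemma small_radius kap V M c u d : good_curve kap V M c u -> 0 < d ->
  exists r, 0 < r <= tube kap V M /\ 4 * V / kap * r <= d.
Proof.
  intros Hc Hd. pose proof (tube_pos Hc) as Ht.
  pose proof (good_kap Hc). pose proof (good_V Hc).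
  set (C := 4 * V / kap). assert (HC : 0 < C) by (apply Rdiv_lt_0_compat; lra).
  exists (Rmin (tube kap V M) (d / C)). assert (0 < d / C) by now apply Rdiv_lt_0_compat.
  split; [split; [now apply Rmin_pos | apply Rmin_l]|].
  apply Rle_trans with (C * (d / C)); [apply Rmult_le_compat_l; [lra | apply Rmin_r]|].
  right. field. lra.
Qed.

Lemma two_sided_at kap V M c u A t r : good_curve kap V M c u -> 0 < r <= tube kap V M ->
  (forall q, dl1 q (c t) <= 4 * V / kap * r -> ~ A q) ->
  two_sided A c (tb c u t (V * r)) (tb c u t (- (V * r))) t.
Proof.
  intros Hc Hr HA. exists r. split; [lra|]. intros p Hp Hd. now apply (near_conn_tb kap V M).
Qed.

(** A point near [c s'] lies in a tube around [c s] whose radius comes from [d] alone, so it is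
    joined there to a point on the normal at [c s]. Descending that normal reaches the region where
    the hypothesis at [s] applies. *)
Lemma two_sided_local kap V M c u A L N t0 d : good_curve kap V M c u -> 0 < d ->
  (forall q, dl1 q (c t0) <= d -> ~ A q) ->
  exists e, 0 < e /\ forall s s', Rabs (s - t0) < e -> Rabs (s' - t0) < e ->
    two_sided A c L N s -> two_sided A c L N s'.
Proof.
  intros Hc Hd HA. pose proof (good_V Hc) as HV.
  destruct (small_radius kap V M c u (d / 2) Hc ltac:(lra)) as [r [Hr Hr2]].
  exists (Rmin (d / (2 * V)) (r / (4 * V))).
  split; [apply Rmin_pos; apply Rdiv_lt_0_compat; lra|].
  intros s s' Hs Hs' [rho [Hrho HT]].
  pose proof (Rmin_l (d / (2 * V)) (r / (4 * V))) as M1. pose proof (Rmin_r (d / (2 * V)) (r / (4 * V))) as M2.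
  assert (E1 : V * (d / (2 * V)) = d / 2) by (field; lra).
  assert (E2 : V * (r / (4 * V)) = r / 4) by (field; lra).
  assert (B1 : V * Rabs (s - t0) <= d / 2) by (rewrite <- E1; apply Rmult_le_compat_l; lra).
  assert (B2 : V * Rabs (s - t0) <= r / 4) by (rewrite <- E2; apply Rmult_le_compat_l; lra).
  assert (B3 : V * Rabs (s' - t0) <= r / 4) by (rewrite <- E2; apply Rmult_le_compat_l; lra).
  pose proof (ball_shrink kap V M c u t0 s A d r Hc HA B1 Hr2) as HAs.
  exists (r / 2). split; [lra|]. intros p Hp Hpd.
  assert (Hps : dl1 p (c s) <= r).
  { pose proof (dl1_triang p (c s') (c s)). pose proof (dl1_triang (c s') (c t0) (c s)).
    pose proof (good_up Hc s' t0). pose proof (good_up Hc s t0).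
    rewrite (dl1_sym (c t0) (c s)) in *. lra. }
  (* The radius [rho] may be far smaller than the distance from [c s] to [c s']; [r2] is a height on
     the normal that fits both the tube and the ball of radius [rho]. *)
  destruct (small_radius kap V M c u rho Hc Hrho) as [r1 [Hr1 Hr1']].
  set (r2 := Rmin r r1). assert (Hr2p : 0 < r2) by (apply Rmin_pos; lra).
  assert (r2 <= r) by apply Rmin_l. assert (r2 <= r1) by apply Rmin_r.
  assert (HVr : 0 < V * r) by (apply Rmult_lt_0_compat; lra).
  assert (HVr2 : 0 < V * r2) by (apply Rmult_lt_0_compat; lra).
  assert (V * r2 <= V * r) by (apply Rmult_le_compat_l; lra).
  assert (V * r2 <= V * r1) by (apply Rmult_le_compat_l; lra).
  assert (HN : forall h, Rabs h = V * r2 -> conn (un A (range c)) (tb c u s h) L \/ conn (un A (range c)) (tb c u s h) N).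
  { intros h Hh. apply HT.
    - apply (tb_not_range kap V M c u s r1); [assumption | assumption | |lra].
      intros E. rewrite E, Rabs_R0 in Hh. lra.
    - eapply Rle_trans; [apply (tb_dist kap V M c u s r1); [assumption | lra] | exact Hr1']. }
  destruct (near_conn_tb kap V M c u A s r p Hc Hr HAs Hp Hps) as [Hcn|Hcn].
  - assert (Hc2 : conn (un A (range c)) (tb c u s (V * r)) (tb c u s (V * r2))).
    { apply (tb_conn kap V M c u A s r); try assumption; [now apply Rmult_lt_0_compat | |]; rewrite Rabs_pos_eq; lra. }
    pose proof (conn_trans Hcn Hc2) as Hc3.
    destruct (HN (V * r2)) as [Hx|Hx]; [rewrite Rabs_pos_eq; lra| |];
      [left|right]; exact (conn_trans Hc3 Hx).
  - assert (Hc2 : conn (un A (range c)) (tb c u s (- (V * r))) (tb c u s (- (V * r2)))).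
    { apply (tb_conn kap V M c u A s r); try assumption; [nra | |]; rewrite Rabs_Ropp, Rabs_pos_eq; lra. }
    pose proof (conn_trans Hcn Hc2) as Hc3.
    destruct (HN (- (V * r2))) as [Hx|Hx]; [rewrite Rabs_Ropp, Rabs_pos_eq; lra| |];
      [left|right]; exact (conn_trans Hc3 Hx).
Qed.

Lemma two_sided_slide kap V M c u A L N a b : good_curve kap V M c u -> closed_set A ->
  (forall t, Rmin a b <= t <= Rmax a b -> ~ A (c t)) -> two_sided A c L N a -> two_sided A c L N b.
Proof.
  intros Hc HcA HA Ha. apply (interval_propagate_sym (two_sided A c L N) a b Ha).
  intros t Ht. destruct (HcA (c t) (HA t Ht)) as [d [Hd Hball]].
  now apply (two_sided_local kap V M c u A L N t d).
Qed.

(** * First hits of a polygon with a curve *)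

(** The first hit is a supremum of clear parameters and lies on the curve because its range is
    closed. Points of the segment just before it are still reachable from [p] and arbitrarily close
    to the hit. *)
Lemma seg_first_hit c A p q : closed_set (range c) -> ~ range c p -> seg_avoids A p q ->
  seg_avoids (un A (range c)) p q \/
  exists t, ~ A (c t) /\ forall e, 0 < e -> exists x, dl1 x (c t) <= e /\ seg_avoids (un A (range c)) p x.
Proof.
  intros Hcl Hp HA.
  destruct (classic (seg_avoids (range c) p q)) as [Hs|Hs].
  { left. intros t Ht [H|H]; [now apply (HA t Ht) | now apply (Hs t Ht)]. }
  right.
  assert (Hex : exists t, 0 <= t <= 1 /\ range c (lin p q t)).
  { apply NNPP. intros Hn. apply Hs. intros t Ht H. apply Hn. now exists t. }
  destruct Hex as [t1 [Ht1 Hr1]].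
  set (E := fun x => 0 <= x <= 1 /\ forall s, 0 <= s <= x -> ~ range c (lin p q s)).
  assert (HE0 : E 0).
  { split; [lra|]. intros s Hs0. replace s with 0 by lra. now rewrite lin_0. }
  destruct (completeness E) as [m [Hub Hlub]].
  - exists 1. intros x [Hx _]. lra.
  - now exists 0.
  - assert (Hm0 : 0 <= m) by now apply Hub.
    assert (Hm1 : m <= 1) by (apply Hlub; intros x [Hx _]; lra).
    assert (Hbelow : forall s, 0 <= s < m -> ~ range c (lin p q s)).
    { intros s Hs0 Hr. assert (m <= s); [|lra]. apply Hlub. intros x [Hx HxE].
      apply Rnot_lt_le. intros Hlt. apply (HxE s); [lra | assumption]. }
    assert (Hlip : forall s s', dl1 (lin p q s) (lin p q s') = Rabs (s - s') * dl1 p q).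
    { intros s s'. unfold dl1, lin; cbn [fst snd].
      replace (fst p + s * (fst q - fst p) - (fst p + s' * (fst q - fst p))) with (- ((s - s') * (fst p - fst q))) by ring.
      replace (snd p + s * (snd q - snd p) - (snd p + s' * (snd q - snd p))) with (- ((s - s') * (snd p - snd q))) by ring.
      rewrite !Rabs_Ropp, !Rabs_mult. ring. }
    pose proof (dl1_pos p q) as Hpq.
    assert (Hm : range c (lin p q m)).
    { apply NNPP. intros Hn. destruct (Hcl _ Hn) as [d [Hd Hball]].
      set (m' := m + d / (dl1 p q + 1)).
      assert (Hdd : 0 < d / (dl1 p q + 1)) by (apply Rdiv_lt_0_compat; lra).
      assert (Hav : forall s, 0 <= s <= m' -> ~ range c (lin p q s)).
      { intros s Hs0. destruct (Rlt_dec s m) as [Hlt|Hge]; [apply Hbelow; lra|].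
        apply Hball. rewrite Hlip, Rabs_pos_eq by lra.
        apply Rle_trans with (d / (dl1 p q + 1) * (dl1 p q + 1)); [|right; field; lra].
        apply Rmult_le_compat; unfold m' in Hs0; lra. }
      assert (Hm'1 : m' < 1).
      { apply Rnot_le_lt. intros Hle. apply (Hav t1); [lra | assumption]. }
      assert (m' <= m); [|unfold m' in *; lra]. apply Hub. split; [unfold m' in *; lra | assumption]. }
    assert (Hmpos : 0 < m).
    { destruct (Rle_lt_or_eq_dec 0 m Hm0) as [|E0]; [assumption|].
      exfalso. apply Hp. rewrite <- E0, lin_0 in Hm. exact Hm. }
    destruct Hm as [t Et]. exists t. split; [rewrite Et; apply HA; lra|].
    intros e He. set (x := Rmax 0 (m - e / (dl1 p q + 1))).
    assert (Hee : 0 < e / (dl1 p q + 1)) by (apply Rdiv_lt_0_compat; lra).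
    assert (Hx : 0 <= x < m /\ m - x <= e / (dl1 p q + 1)).
    { unfold x, Rmax. destruct (Rle_dec 0 (m - e / (dl1 p q + 1))); lra. }
    exists (lin p q x). split.
    + rewrite Et, Hlip, Rabs_minus_sym, Rabs_pos_eq by lra.
      apply Rle_trans with (e / (dl1 p q + 1) * (dl1 p q + 1)); [|right; field; lra].
      apply Rmult_le_compat; lra.
    + intros s Hs0.
      replace (lin p (lin p q x) s) with (lin p q (s * x)) by (unfold lin; cbn [fst snd]; f_equal; ring).
      assert (0 <= s * x < m) by (split; nra).
      intros [H1|H1]; [apply (HA (s * x)); [lra | assumption] | now apply (Hbelow (s * x))].
Qed.

Lemma conn_first_hit c A p q : closed_set (range c) -> ~ range c p -> conn A p q ->
  conn (un A (range c)) p q \/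
  exists t, ~ A (c t) /\ forall e, 0 < e -> exists x, dl1 x (c t) <= e /\ conn (un A (range c)) p x.
Proof.
  intros Hcl Hp Hc. induction Hc as [p HA|p p1 q Hs Hc IH].
  - left. apply conn_refl. intros [H|H]; contradiction.
  - destruct (seg_first_hit c A p p1 Hcl Hp Hs) as [Hs1|(t & Ht & He)].
    + assert (Hp1 : ~ range c p1).
      { intros H. apply (Hs1 1); [lra|]. rewrite lin_1. now right. }
      destruct (IH Hp1) as [H|(t & Ht & He)].
      * left. now apply (conn_step _ p p1 q).
      * right. exists t. split; [assumption|]. intros e Hpos. destruct (He e Hpos) as [x [Hx Hcx]].
        exists x. split; [assumption|]. now apply (conn_step _ p p1 x).
    + right. exists t. split; [assumption|]. intros e Hpos. destruct (He e Hpos) as [x [Hx Hsx]].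
      exists x. split; [assumption | now apply conn_seg].
Qed.

(** * Counting arcs and regions *)

(** Labels the components of the complement of [ts]: off [ts] the value is constant on each
    component and differs between components. *)
Definition count_below (ts : list R) (t : R) : nat := length (filter (fun x => if Rlt_dec x t then true else false) ts).

Lemma count_below_le ts t : (count_below ts t <= length ts)%nat.
Proof. apply filter_length_le. Qed.

Lemma count_below_mono ts a b : a <= b -> (count_below ts a <= count_below ts b)%nat.
Proof.
  intros Hab. unfold count_below. induction ts as [|x ts IH]; simpl; [lia|].
  destruct (Rlt_dec x a), (Rlt_dec x b); simpl; try lia. lra.
Qed.

Lemma count_below_strict ts a b x : In x ts -> a <= x < b -> (count_below ts a < count_below ts b)%nat.
Proof.
  intros Hin Hx. unfold count_below. induction ts as [|y ts IH]; [destruct Hin|].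
  destruct Hin as [->|Hin]; simpl.
  - pose proof (count_below_mono ts a b ltac:(lra)) as Hm. unfold count_below in Hm.
    destruct (Rlt_dec x a), (Rlt_dec x b); simpl; try lra. lia.
  - specialize (IH Hin). destruct (Rlt_dec y a), (Rlt_dec y b); simpl; try lia. lra.
Qed.

(** The labels take values from 0 to [length ts]; one representative is chosen for each value that
    occurs off [ts]. *)
Lemma interval_classes (ts : list R) : exists ms : list R, (length ms <= S (length ts))%nat /\
  (forall m, In m ms -> ~ In m ts) /\
  forall t, ~ In t ts -> exists m, In m ms /\ forall s, Rmin m t <= s <= Rmax m t -> ~ In s ts.
Proof.
  assert (H : forall k, exists ms : list R, (length ms <= k)%nat /\
    (forall m, In m ms -> ~ In m ts) /\
    forall t, ~ In t ts -> (count_below ts t < k)%nat -> exists m, In m ms /\ count_below ts m = count_below ts t).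
  { induction k as [|k [ms [Hl [Hn Hm]]]].
    - exists []. split; [simpl; lia|]. split; [intros m []|]. intros; lia.
    - destruct (classic (exists t, ~ In t ts /\ count_below ts t = k)) as [[t0 [Ht0 Hk]]|Hno].
      + exists (t0 :: ms). split; [simpl; lia|]. split.
        * intros m [<-|Hin]; [assumption | now apply Hn].
        * intros t Ht Hlt. destruct (Nat.eq_dec (count_below ts t) k) as [E|E].
          -- exists t0. split; [now left | congruence].
          -- destruct (Hm t Ht ltac:(lia)) as [m [Hin Em]]. exists m. split; [now right | assumption].
      + exists ms. split; [lia|]. split; [assumption|]. intros t Ht Hlt.
        apply Hm; [assumption|]. assert (count_below ts t <> k) by (intros E; apply Hno; now exists t). lia. }
  destruct (H (S (length ts))) as [ms [Hl [Hn Hm]]]. exists ms. split; [assumption|]. split; [assumption|].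
  intros t Ht. destruct (Hm t Ht) as [m [Hin E]]; [pose proof (count_below_le ts t); lia|].
  exists m. split; [assumption|]. intros s Hs Hst.
  assert (Hmt : ~ In m ts) by now apply Hn.
  destruct (Rle_dec m t) as [Hle|Hle].
  - rewrite Rmin_left, Rmax_right in Hs by lra.
    assert (s <> t) by (intros ->; contradiction).
    pose proof (count_below_strict ts m t s Hst ltac:(lra)). lia.
  - rewrite Rmin_right, Rmax_left in Hs by lra.
    assert (s <> m) by (intros ->; contradiction).
    pose proof (count_below_strict ts t m s Hst ltac:(lra)). lia.
Qed.

Definition union_ranges (cs : list (R -> R * R)) (p : R * R) : Prop := exists c, In c cs /\ range c p.

(** Disjoint curves qualify. Uniqueness is stated for the time on [a], which is what limits the
    number of arcs into which [a] is cut. *)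
Definition meet_once (a b : R -> R * R) : Prop :=
  forall s1 s2 t1 t2, a s1 = b t1 -> a s2 = b t2 -> s1 = s2.

Lemma closed_union_ranges cs : (forall c, In c cs -> closed_set (range c)) -> closed_set (union_ranges cs).
Proof.
  induction cs as [|c cs IH]; intros H p Hp.
  - exists 1. split; [lra|]. intros q _ [c [[] _]].
  - destruct (IH ltac:(intros; apply H; now right) p) as [d1 [Hd1 H1]].
    { intros [b [Hb Hr]]. apply Hp. exists b. split; [now right | assumption]. }
    destruct (H c ltac:(now left) p) as [d2 [Hd2 H2]].
    { intros Hr. apply Hp. exists c. split; [now left | assumption]. }
    exists (Rmin d1 d2). split; [now apply Rmin_pos|]. intros q Hq [b [[<-|Hb] Hr]].
    + apply (H2 q); [pose proof (Rmin_r d1 d2); lra | assumption].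
    + apply (H1 q); [pose proof (Rmin_l d1 d2); lra | now exists b].
Qed.

Lemma meeting_times c cs : (forall b, In b cs -> meet_once c b) ->
  exists ts : list R, (length ts <= length cs)%nat /\ forall t, union_ranges cs (c t) <-> In t ts.
Proof.
  induction cs as [|b cs IH]; intros H.
  - exists []. split; [simpl; lia|]. intros t. split; [intros [b [[] _]] | intros []].
  - destruct IH as [ts [Hl Hts]]; [intros; apply H; now right|].
    assert (Hu : forall t, union_ranges (b :: cs) (c t) <-> range b (c t) \/ In t ts).
    { intros t. rewrite <- Hts. split.
      - intros [b' [[<-|Hb] Hr]]; [now left | right; now exists b'].
      - intros [Hr|[b' [Hb Hr]]]; [exists b; split; [now left | assumption] | exists b'; split; [now right | assumption]]. }
    destruct (classic (exists t, range b (c t))) as [[t0 [s0 E0]]|Hno].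
    + exists (t0 :: ts). split; [simpl; lia|]. intros t. rewrite Hu. simpl. split; intros [Hr|Hr]; try now right.
      * left. destruct Hr as [s E]. symmetry in E, E0. now apply (H b ltac:(now left) t0 t s0 s).
      * left. subst t. now exists s0.
    + exists ts. split; [simpl; lia|]. intros t. rewrite Hu. split; [|now right].
      intros [Hr|Hr]; [|assumption]. exfalso. apply Hno. now exists t.
Qed.

Lemma conn_end A p q : conn A p q -> ~ A q.
Proof.
  intros H. apply conn_sym in H. destruct H as [p' H|p' q' r Hs _]; [assumption|].
  rewrite <- (lin_0 p' q'). apply Hs. lra.
Qed.
Arguments conn_end {A p q}.

(* A new curve meeting [k] others at most once each is cut into at most [k + 1] arcs; a new region lies
   along one side of one of them. *)
Lemma regions_bound kap V M (cs : list (R -> R * R)) :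
  (forall c, In c cs -> exists u, good_curve kap V M c u) ->
  (forall a b, In a cs -> In b cs -> same_range a b \/ meet_once a b) ->
  exists reps : list (R * R), (length reps <= 1 + length cs * (length cs + 1))%nat /\
    forall p, ~ union_ranges cs p -> exists q, In q reps /\ conn (union_ranges cs) p q.
Proof.
  induction cs as [|c cs IH]; intros Hgood Hmeet.
  - exists [(0, 0)]. split; [simpl; lia|]. intros p _. exists (0, 0). split; [now left|].
    apply conn_seg. intros t _ [c [[] _]].
  - destruct IH as [reps [Hlen Hreps]].
    { intros; apply Hgood; now right. } { intros; apply Hmeet; now right. }
    assert (Heq : forall p, un (union_ranges cs) (range c) p <-> union_ranges (c :: cs) p).
    { intros p. split.
      - intros [[b [Hb Hr]]|Hr]; [exists b; split; [now right | assumption] | exists c; split; [now left | assumption]].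
      - intros [b [[<-|Hb] Hr]]; [now right | left; now exists b]. }
    assert (Hconn : forall p q, conn (un (union_ranges cs) (range c)) p q -> conn (union_ranges (c :: cs)) p q).
    { intros p q. apply conn_mono. intros x. apply Heq. }
    (* A curve with the range of an earlier one adds nothing to the union; every other curve meets
       each earlier one at most once. *)
    destruct (classic (exists b, In b cs /\ same_range c b)) as [[b [Hb Hsame]]|Hnew].
    + exists reps. split; [simpl; nia|]. intros p Hp.
      destruct (Hreps p) as [q [Hq Hcq]].
      { intros [b' [Hb' Hr]]. apply Hp. exists b'. split; [now right | assumption]. }
      exists q. split; [assumption|]. revert Hcq. apply conn_mono. intros x [b' [[<-|Hb'] Hr]].
      * exists b. split; [assumption | now apply Hsame].
      * now exists b'.
    + destruct (Hgood c ltac:(now left)) as [u Hu].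
      assert (Hcl : closed_set (union_ranges cs)).
      { apply closed_union_ranges. intros b Hb. destruct (Hgood b ltac:(now right)) as [v Hv].
        apply (good_closed Hv). }
      destruct (meeting_times c cs) as [ts [Hts Hin]].
      { intros b Hb. destruct (Hmeet c b ltac:(now left) ltac:(now right)) as [Hs|]; [|assumption].
        exfalso. apply Hnew. now exists b. }
      destruct (interval_classes ts) as [ms [Hms [Hmn Hcls]]].
      (* Two new representatives per arc, one on each side. With at most [k + 1] arcs the count
         grows from [1 + k (k + 1)] by [2 (k + 1)], to [1 + (k + 1) (k + 2)]. *)
      assert (Hnt : exists nts, (length nts <= 2 * length ms)%nat /\ forall m, In m ms -> ~ union_ranges cs (c m) ->
         exists L N, In L nts /\ In N nts /\ two_sided (union_ranges cs) c L N m).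
      { clear Hms Hmn Hcls. induction ms as [|m ms [nts [Hl Hn]]].
        - exists []. split; [simpl; lia|]. intros m [].
        - destruct (classic (union_ranges cs (c m))) as [Hm|Hm].
          + exists nts. split; [simpl; lia|]. intros m' [<-|Hm'] Hx; [contradiction | now apply Hn].
          + destruct (Hcl _ Hm) as [d [Hd Hball]].
            destruct (small_radius kap V M c u d Hu Hd) as [r [Hr Hr2]].
            exists (tb c u m (V * r) :: tb c u m (- (V * r)) :: nts). split; [simpl; lia|].
            intros m' [<-|Hm'] Hx.
            * exists (tb c u m (V * r)), (tb c u m (- (V * r))). split; [now left|]. split; [right; now left|].
              apply (two_sided_at kap V M c u _ m r Hu Hr). intros q Hq. apply Hball. lra.
            * destruct (Hn m' Hm' Hx) as (L & N & HL & HN & HT). exists L, N.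
              split; [now right; right|]. split; [now right; right | assumption]. }
      destruct Hnt as [nts [Hntl Hnt]].
      exists (reps ++ nts). split; [rewrite length_app; simpl; nia|].
      intros p Hp.
      assert (Hpc : ~ range c p) by (intros H; apply Hp, Heq; now right).
      assert (Hpu : ~ union_ranges cs p) by (intros H; apply Hp, Heq; now left).
      destruct (Hreps p Hpu) as [q [Hq Hcq]].
      (* Either the path to an old representative misses the new curve, or its first hit lies on
         some arc, and sliding along that arc reaches one of the two representatives attached to
         it. *)
      destruct (conn_first_hit c _ p q (good_closed Hu) Hpc Hcq) as [Hok|(t & Ht & He)].
      * exists q. split; [apply in_or_app; now left | now apply Hconn].
      * assert (Htt : ~ In t ts) by (intros Htt; now apply Ht, Hin).
        destruct (Hcls t Htt) as [m [Hm Hs]].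
        assert (Hs' : forall s, Rmin m t <= s <= Rmax m t -> ~ union_ranges cs (c s))
          by (intros s Hsr Hus; apply (Hs s Hsr); now apply Hin).
        destruct (Hnt m Hm) as (L & N & HL & HN & HT).
        { apply Hs'. split; [apply Rmin_l | apply Rmax_l]. }
        apply (two_sided_slide kap V M c u _ L N m t Hu Hcl Hs') in HT. destruct HT as [r [Hr HT]].
        destruct (He r Hr) as [x [Hx Hcx]].
        assert (Hxc : ~ range c x) by (intros H; apply (conn_end Hcx); now right).
        destruct (HT x Hxc Hx) as [Hf|Hf]; [exists L | exists N];
          (split; [apply in_or_app; now right | apply Hconn; exact (conn_trans Hcx Hf)]).
Qed.

(** * The two sides of a curve are not connected *)

Definition vec (z p : R * R) : R * R := (fst p - fst z, snd p - snd z).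
Definition dot (u v : R * R) : R := fst u * fst v + snd u * snd v.
Definition crs (u v : R * R) : R := fst u * snd v - snd u * fst v.
Definition en (u : R * R) : R := sqrt (esq u).
(** The oriented angle from [u] to [v], strictly between [- PI] and [PI], by the half-angle tangent.
    It is continuous as long as the denominator is positive, that is, while the vectors are nonzero
    and not opposite. *)
Definition ang (u v : R * R) : R := 2 * atan (crs u v / (en u * en v + dot u v)).

Lemma esq_nonneg u : 0 <= esq u.
Proof. unfold esq. pose proof (pow2_ge_0 (fst u)). pose proof (pow2_ge_0 (snd u)). lra. Qed.

Lemma en_sq u : en u * en u = esq u.
Proof. apply sqrt_sqrt, esq_nonneg. Qed.

Lemma en_pos u : 0 <= en u.
Proof. apply sqrt_pos. Qed.

Lemma lagrange u v : (en u * en v) ^ 2 = dot u v ^ 2 + crs u v ^ 2.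
Proof.
  replace ((en u * en v) ^ 2) with ((en u * en u) * (en v * en v)) by ring.
  rewrite !en_sq. unfold esq, dot, crs. ring.
Qed.

Lemma en_dot_nonneg u v : 0 <= en u * en v + dot u v.
Proof.
  pose proof (lagrange u v) as E. pose proof (pow2_ge_0 (crs u v)).
  assert (HN : 0 <= en u * en v) by (apply Rmult_le_pos; apply en_pos).
  apply Rnot_lt_le. intros Hlt. nra.
Qed.

Lemma ang_cos_sin u v : 0 < en u * en v + dot u v ->
  0 < en u * en v /\ cos (ang u v) = dot u v / (en u * en v) /\ sin (ang u v) = crs u v / (en u * en v).
Proof.
  intros HD. pose proof (lagrange u v) as E. unfold ang.
  assert (HN0 : 0 <= en u * en v) by (apply Rmult_le_pos; apply en_pos).
  set (N := en u * en v) in *. set (d := dot u v) in *. set (k := crs u v) in *.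
  assert (HN : 0 < N).
  { destruct (Rle_lt_or_eq_dec 0 N HN0) as [|E0]; [assumption|]. rewrite <- E0 in *. nra. }
  set (x := k / (N + d)).
  assert (Hx : 1 + x ^ 2 = 2 * N / (N + d)).
  { unfold x. replace (1 + (k / (N + d)) ^ 2) with (((N + d) ^ 2 + k ^ 2) / (N + d) ^ 2) by (field; lra).
    replace ((N + d) ^ 2 + k ^ 2) with (2 * N * (N + d)) by nra. field. lra. }
  assert (Hs : 0 < 1 + x ^ 2) by (pose proof (pow2_ge_0 x); lra).
  assert (Hq : sqrt (1 + x ^ 2) * sqrt (1 + x ^ 2) = 1 + x ^ 2) by (apply sqrt_sqrt; lra).
  assert (Hq0 : 0 < sqrt (1 + x ^ 2)) by now apply sqrt_lt_R0.
  split; [assumption|]. rewrite cos_2a_cos, sin_2a, cos_atan, sin_atan.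
  replace (1 + x²) with (1 + x ^ 2) by (unfold Rsqr; ring).
  split.
  - replace (2 * (1 / sqrt (1 + x ^ 2)) * (1 / sqrt (1 + x ^ 2)) - 1)
      with (2 / (sqrt (1 + x ^ 2) * sqrt (1 + x ^ 2)) - 1) by (field; lra).
    rewrite Hq, Hx. field. lra.
  - replace (2 * (x / sqrt (1 + x ^ 2)) * (1 / sqrt (1 + x ^ 2)))
      with (2 * x / (sqrt (1 + x ^ 2) * sqrt (1 + x ^ 2))) by (field; lra).
    rewrite Hq, Hx. unfold x. field. lra.
Qed.

Lemma en_zero u : en u = 0 -> u = (0, 0).
Proof.
  intros H. pose proof (en_sq u) as E. rewrite H in E. unfold esq in E.
  pose proof (pow2_ge_0 (fst u)). pose proof (pow2_ge_0 (snd u)).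
  assert (Hz : forall r, r ^ 2 = 0 -> r = 0) by (intros r Hr; apply Rsqr_0_uniq; unfold Rsqr; lra).
  destruct u as [a b]; simpl in *. f_equal; apply Hz; simpl; lra.
Qed.

(** A zero sum is the case of opposite vectors in Cauchy-Schwarz; then [z] divides the segment in
    the ratio of the two lengths, against the hypothesis. *)
Lemma en_dot_pos p q z : (forall t, 0 <= t <= 1 -> lin p q t <> z) ->
  0 < en (vec z p) * en (vec z q) + dot (vec z p) (vec z q).
Proof.
  intros H. pose proof (en_dot_nonneg (vec z p) (vec z q)) as Hn.
  destruct (Rle_lt_or_eq_dec _ _ Hn) as [|E]; [assumption|]. exfalso.
  set (u := vec z p) in *. set (v := vec z q) in *.
  pose proof (en_pos u) as Pu. pose proof (en_pos v) as Pv.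
  assert (Hu : en u <> 0).
  { intros E0. apply en_zero in E0. apply (H 0); [lra|]. rewrite lin_0.
    unfold u, vec in E0. destruct p, z; simpl in *. injection E0; intros; f_equal; lra. }
  assert (Hw : esq (en v * fst u + en u * fst v, en v * snd u + en u * snd v) = 0).
  { replace (esq (en v * fst u + en u * fst v, en v * snd u + en u * snd v))
      with (en v * en v * esq u + en u * en u * esq v + 2 * (en u * en v) * dot u v)
      by (unfold esq, dot; cbn [fst snd]; ring).
    rewrite <- !en_sq. replace (dot u v) with (- (en u * en v)) by lra. ring. }
  assert (Hz : (en v * fst u + en u * fst v, en v * snd u + en u * snd v) = (0, 0)).
  { apply en_zero. revert Hw. generalize (en v * fst u + en u * fst v, en v * snd u + en u * snd v).
    intros w Hw. unfold en. rewrite Hw. apply sqrt_0. }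
  injection Hz as Z1 Z2.
  apply (H (en u / (en u + en v))).
  - split; [apply Rdiv_le_0_compat; lra|]. apply Rmult_le_reg_r with (en u + en v); [lra|].
    unfold Rdiv. rewrite Rmult_assoc, Rinv_l; lra.
  - unfold lin. rewrite (surjective_pairing z).
    change (fst u) with (fst p - fst z) in Z1. change (fst v) with (fst q - fst z) in Z1.
    change (snd u) with (snd p - snd z) in Z2. change (snd v) with (snd q - snd z) in Z2.
    f_equal.
    + replace (fst p + en u / (en u + en v) * (fst q - fst p))
        with (fst z + (en v * (fst p - fst z) + en u * (fst q - fst z)) / (en u + en v)) by (field; lra).
      rewrite Z1. field. lra.
    + replace (snd p + en u / (en u + en v) * (snd q - snd p))
        with (snd z + (en v * (snd p - snd z) + en u * (snd q - snd z)) / (en u + en v)) by (field; lra).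
      rewrite Z2. field. lra.
Qed.

(** Seen from distance [n], a segment of length [D] gives a cross product of at most [n * D] over a
    denominator of at least [n ^ 2 / 4]. *)
Lemma ang_far p q e : 0 < e -> exists T, forall z, T < dl1 z p -> Rabs (ang (vec z p) (vec z q)) < e.
Proof.
  intros He.
  assert (Hc : continuous atan 0).
  { apply continuity_pt_filterlim. apply derivable_continuous_pt, derivable_pt_atan. }
  assert (HP : locally (atan 0) (fun y => Rabs y < e / 2)).
  { rewrite atan_0. exists (mkposreal (e / 2) ltac:(lra)). intros y Hy.
    change (Rabs (y - 0) < e / 2) in Hy. now rewrite Rminus_0_r in Hy. }
  destruct (Hc _ HP) as [d Hd]. pose proof (cond_pos d) as Hdp.
  set (D := dl1 q p). pose proof (dl1_pos q p) as HD. fold D in HD.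
  exists (Rmax (4 * D + 1) (4 * D / d + 1)). intros z Hz.
  pose proof (Rmax_l (4 * D + 1) (4 * D / d + 1)). pose proof (Rmax_r (4 * D + 1) (4 * D / d + 1)).
  set (n := dl1 z p) in *.
  assert (Hn1 : 4 * D + 1 < n) by lra. assert (Hn2 : 4 * D / d < n) by lra.
  set (u := vec z p). set (w := vec p q).
  assert (Eu : nrm u = n) by (unfold n; rewrite dl1_sym; reflexivity).
  assert (Ew : nrm w = D) by reflexivity.
  assert (Ev : vec z q = (fst u + fst w, snd u + snd w)) by (unfold u, w, vec; cbn [fst snd]; f_equal; ring).
  assert (Edot : dot u (vec z q) = esq u + (fst u * fst w + snd u * snd w)) by (rewrite Ev; unfold dot, esq; cbn [fst snd]; ring).
  assert (Ecrs : crs u (vec z q) = fst u * snd w + snd u * - fst w) by (rewrite Ev; unfold crs; cbn [fst snd]; ring).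
  pose proof (dot_le n u w ltac:(lra)) as B1. rewrite Ew in B1.
  pose proof (dot_le n u (snd w, - fst w) ltac:(lra)) as B2. cbn [fst snd] in B2.
  assert (Ew2 : nrm (snd w, - fst w) = D) by (rewrite <- Ew; unfold nrm; cbn [fst snd]; rewrite Rabs_Ropp; ring).
  rewrite Ew2 in B2. rewrite <- Ecrs in B2.
  pose proof (nrm_sq_le_esq u) as B3. rewrite Eu in B3.
  assert (Hdot : n ^ 2 / 4 <= dot u (vec z q)).
  { rewrite Edot. apply Rabs_le_between in B1. nra. }
  assert (HN : 0 <= en u * en (vec z q)) by (apply Rmult_le_pos; apply en_pos).
  set (den := en u * en (vec z q) + dot u (vec z q)) in *.
  assert (Hden : n ^ 2 / 4 <= den) by (unfold den; lra).
  assert (Hn2p : 0 < n ^ 2) by (apply pow_lt; lra).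
  assert (Hx : Rabs (crs u (vec z q) / den) < d).
  { unfold Rdiv. rewrite Rabs_mult, Rabs_inv, (Rabs_pos_eq den) by lra.
    apply Rmult_lt_reg_r with den; [lra|]. rewrite Rmult_assoc, Rinv_l, Rmult_1_r by lra.
    apply Rle_lt_trans with (n * D); [assumption|].
    apply Rlt_le_trans with (d * (n ^ 2 / 4)); [|apply Rmult_le_compat_l; lra].
    assert (4 * D < d * n).
    { replace (4 * D) with (d * (4 * D / d)) by (field; lra). now apply Rmult_lt_compat_l. }
    nra. }
  assert (Hb : Rabs (atan (crs u (vec z q) / den)) < e / 2).
  { apply Hd. change (Rabs (crs u (vec z q) / den - 0) < d). now rewrite Rminus_0_r. }
  change (Rabs (2 * atan (crs u (vec z q) / den)) < e). rewrite Rabs_mult, (Rabs_pos_eq 2) by lra. lra.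
Qed.

Lemma good_continuous kap V M c u : good_curve kap V M c u ->
  forall t, continuous (fun s => fst (c s)) t /\ continuous (fun s => snd (c s)) t.
Proof.
  intros Hc t. pose proof (good_V Hc) as HV.
  assert (HL : forall s, Rabs (fst (c s) - fst (c t)) <= V * Rabs (s - t) /\ Rabs (snd (c s) - snd (c t)) <= V * Rabs (s - t)).
  { intros s. pose proof (good_up Hc s t) as Hu. unfold dl1 in Hu.
    pose proof (Rabs_pos (fst (c s) - fst (c t))). pose proof (Rabs_pos (snd (c s) - snd (c t))). lra. }
  split; intros P [e He]; (assert (Hd : 0 < e / V) by (apply Rdiv_lt_0_compat; [apply cond_pos | assumption]));
    exists (mkposreal _ Hd); intros s Hs; apply He; change (Rabs (s - t) < e / V) in Hs;
    assert (HVe : V * Rabs (s - t) < e) by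
      (apply Rlt_le_trans with (V * (e / V)); [now apply Rmult_lt_compat_l | right; field; lra]).
  - change (Rabs (fst (c s) - fst (c t)) < e). destruct (HL s). lra.
  - change (Rabs (snd (c s) - snd (c t)) < e). destruct (HL s). lra.
Qed.
Arguments good_continuous {kap V M c u}.

Lemma continuous_ang (c : R -> R * R) p q t : continuous (fun s => fst (c s)) t -> continuous (fun s => snd (c s)) t ->
  0 < en (vec (c t) p) * en (vec (c t) q) + dot (vec (c t) p) (vec (c t) q) ->
  continuous (fun s => ang (vec (c s) p) (vec (c s) q)) t.
Proof.
  intros C1 C2 Hpos.
  assert (K1 : forall r : R, continuous (fun s => r - fst (c s)) t)
    by (intros r; apply (continuous_minus (fun _ => r) (fun s => fst (c s))); [apply continuous_const | exact C1]).
  assert (K2 : forall r : R, continuous (fun s => r - snd (c s)) t)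
    by (intros r; apply (continuous_minus (fun _ => r) (fun s => snd (c s))); [apply continuous_const | exact C2]).
  assert (Kd : continuous (fun s => dot (vec (c s) p) (vec (c s) q)) t).
  { unfold dot, vec; cbn [fst snd].
    exact (continuous_Rplus _ _ _ (continuous_Rmult _ _ _ (K1 (fst p)) (K1 (fst q))) (continuous_Rmult _ _ _ (K2 (snd p)) (K2 (snd q)))). }
  assert (Kc : continuous (fun s => crs (vec (c s) p) (vec (c s) q)) t).
  { unfold crs, vec; cbn [fst snd].
    exact (continuous_minus _ _ _ (continuous_Rmult _ _ _ (K1 (fst p)) (K2 (snd q))) (continuous_Rmult _ _ _ (K2 (snd p)) (K1 (fst q)))). }
  assert (Ke : forall r, continuous (fun s => en (vec (c s) r)) t).
  { intros r. unfold en. apply (continuous_comp (fun s => esq (vec (c s) r)) sqrt); [|apply continuous_sqrt].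
    apply (continuous_ext (fun s => (fst r - fst (c s)) * (fst r - fst (c s)) + (snd r - snd (c s)) * (snd r - snd (c s)))).
    { intros s. change ((fst r - fst (c s)) * (fst r - fst (c s)) + (snd r - snd (c s)) * (snd r - snd (c s))
        = (fst r - fst (c s)) ^ 2 + (snd r - snd (c s)) ^ 2)%R. ring. }
    exact (continuous_Rplus _ _ _ (continuous_Rmult _ _ _ (K1 (fst r)) (K1 (fst r))) (continuous_Rmult _ _ _ (K2 (snd r)) (K2 (snd r)))). }
  unfold ang, Rdiv. apply continuous_Rmult; [apply continuous_const|].
  apply (continuous_comp (fun s => crs (vec (c s) p) (vec (c s) q) * / (en (vec (c s) p) * en (vec (c s) q) + dot (vec (c s) p) (vec (c s) q))) atan).
  - apply continuous_Rmult; [exact Kc|].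
    apply (continuous_comp (fun s => en (vec (c s) p) * en (vec (c s) q) + dot (vec (c s) p) (vec (c s) q)) Rinv).
    + exact (continuous_Rplus _ _ _ (continuous_Rmult _ _ _ (Ke p) (Ke q)) Kd).
    + apply continuous_Rinv. lra.
  - apply continuity_pt_filterlim. apply derivable_continuous_pt, derivable_pt_atan.
Qed.

Lemma good_far kap V M c u p T : good_curve kap V M c u -> exists B, forall t, B < Rabs t -> T < dl1 (c t) p.
Proof.
  intros Hc. pose proof (good_kap Hc) as Hk.
  exists ((T + dl1 (c 0) p) / kap). intros t Ht.
  pose proof (good_low Hc t 0) as HL. rewrite Rminus_0_r in HL.
  assert (kap * ((T + dl1 (c 0) p) / kap) < kap * Rabs t) by now apply Rmult_lt_compat_l.
  replace (kap * ((T + dl1 (c 0) p) / kap)) with (T + dl1 (c 0) p) in * by (field; lra).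
  pose proof (dl1_triang (c t) p (c 0)). rewrite (dl1_sym p (c 0)) in *. lra.
Qed.

(* The total angle under which a polygon avoiding the curve is seen from a point of the curve. *)
Lemma conn_angle kap V M c u p q : good_curve kap V M c u -> conn (range c) p q ->
  exists f : R -> R, (forall t, continuous f t) /\
    (forall t, 0 < en (vec (c t) p) * en (vec (c t) q) /\
       cos (f t) = dot (vec (c t) p) (vec (c t) q) / (en (vec (c t) p) * en (vec (c t) q)) /\
       sin (f t) = crs (vec (c t) p) (vec (c t) q) / (en (vec (c t) p) * en (vec (c t) q))) /\
    (forall e, 0 < e -> exists T, forall t, T < Rabs t -> Rabs (f t) < e).
Proof.
  intros Hc Hpq. induction Hpq as [p Hp|p p1 q Hs Hcn (f & Hf1 & Hf2 & Hf3)].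
  - exists (fun _ => 0). split; [intros; apply continuous_const|]. split.
    + intros t.
      assert (Hen : en (vec (c t) p) <> 0).
      { intros E. apply en_zero in E. apply Hp. exists t. unfold vec in E. destruct (c t), p; simpl in E.
        injection E; intros; f_equal; lra. }
      pose proof (en_pos (vec (c t) p)). assert (0 < en (vec (c t) p) * en (vec (c t) p)) by nra.
      split; [assumption|]. rewrite en_sq, cos_0, sin_0. rewrite en_sq in *.
      unfold dot, crs, esq in *. split; field; lra.
    + intros e He. exists 0. intros t _. now rewrite Rabs_R0.
  - assert (Hpos : forall t, 0 < en (vec (c t) p) * en (vec (c t) p1) + dot (vec (c t) p) (vec (c t) p1)).
    { intros t. apply en_dot_pos. intros x Hx E. apply (Hs x Hx). now exists t. }
    exists (fun t => ang (vec (c t) p) (vec (c t) p1) + f t). split; [|split].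
    + intros t. apply continuous_Rplus; [|apply Hf1].
      destruct (good_continuous Hc t). now apply continuous_ang.
    + intros t. destruct (ang_cos_sin _ _ (Hpos t)) as (N1 & C1 & S1). destruct (Hf2 t) as (N2 & C2 & S2).
      (* With dot and cross product as real and imaginary part of a conjugate product of complex
         numbers, the addition theorems multiply two such products, and the intermediate vector
         contributes only the factor [esq b], which cancels. *)
      rewrite cos_plus, sin_plus, C1, S1, C2, S2.
      pose proof (en_sq (vec (c t) p1)) as E1.
      pose proof (en_pos (vec (c t) p)). pose proof (en_pos (vec (c t) p1)). pose proof (en_pos (vec (c t) q)).
      set (a := vec (c t) p) in *. set (b := vec (c t) p1) in *. set (d := vec (c t) q) in *.
      assert (0 < en a) by nra. assert (0 < en b) by nra. assert (0 < en d) by nra.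
      split; [now apply Rmult_lt_0_compat|].
      split.
      * apply Rmult_eq_reg_r with (en a * en d * (en b * en b)); [|apply Rgt_not_eq; repeat apply Rmult_lt_0_compat; assumption].
        field_simplify; [|lra|lra]. replace (en b ^ 2) with (esq b) by (rewrite <- E1; ring).
        unfold dot, crs, esq. ring.
      * apply Rmult_eq_reg_r with (en a * en d * (en b * en b)); [|apply Rgt_not_eq; repeat apply Rmult_lt_0_compat; assumption].
        field_simplify; [|lra|lra]. replace (en b ^ 2) with (esq b) by (rewrite <- E1; ring).
        unfold dot, crs, esq. ring.
    + intros e He. destruct (Hf3 (e / 2) ltac:(lra)) as [T1 H1].
      destruct (ang_far p p1 (e / 2) ltac:(lra)) as [T2 H2].
      destruct (good_far kap V M c u p T2 Hc) as [B HB].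
      exists (Rmax T1 B). intros t Ht. pose proof (Rmax_l T1 B). pose proof (Rmax_r T1 B).
      specialize (H1 t ltac:(lra)). specialize (H2 (c t) (HB t ltac:(lra))).
      eapply Rle_lt_trans; [apply Rabs_triang|]. lra.
Qed.

Lemma cos_eq_1_small x : Rabs x < PI -> cos x = 1 -> x = 0.
Proof.
  intros Hx Hc.
  assert (H : forall y, 0 <= y < PI -> cos y = 1 -> y = 0).
  { intros y Hy Hcy. destruct (Rle_lt_or_eq_dec 0 y (proj1 Hy)) as [H0|]; [|now symmetry].
    exfalso. pose proof (cos_decreasing_1 0 y ltac:(lra) ltac:(lra) ltac:(lra) ltac:(lra) H0). rewrite cos_0 in *. lra. }
  destruct (Rle_dec 0 x) as [H0|H0].
  - rewrite Rabs_pos_eq in Hx by assumption. apply H; [lra | assumption].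
  - rewrite Rabs_left in Hx by lra. rewrite <- cos_neg in Hc.
    pose proof (H (- x) ltac:(lra) Hc). lra.
Qed.

(** Where its cosine is 1 the function takes values in the multiples of [2 * PI]; continuity keeps
    it at the only such value of modulus below [PI]. *)
Lemma angle_vanish (h : R -> R) (a b : R) :
  (forall t, Rmin a b <= t <= Rmax a b -> continuous h t /\ exists d, 0 < d /\ forall s, Rabs (s - t) < d -> cos (h s) = 1) ->
  Rabs (h a) < PI -> h b = 0.
Proof.
  intros H Ha.
  assert (Hb : Rabs (h b) < PI).
  { apply (interval_propagate_sym (fun t => Rabs (h t) < PI) a b Ha).
    intros t Ht. destruct (H t Ht) as [Hc [d [Hd Hcos]]].
    assert (HP : locally (h t) (fun y => Rabs (y - h t) < 1)).
    { exists (mkposreal 1 Rlt_0_1). intros y Hy. exact Hy. }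
    destruct (Hc _ HP) as [d2 Hd2]. exists (Rmin d d2).
    split; [apply Rmin_pos; [assumption | apply cond_pos]|].
    intros s s' Hs Hs' Hp. pose proof (Rmin_l d d2). pose proof (Rmin_r d d2).
    assert (E : h s = 0) by (apply cos_eq_1_small; [assumption | apply Hcos; lra]).
    assert (B1 : Rabs (h s - h t) < 1) by (apply Hd2; change (Rabs (s - t) < d2); lra).
    assert (B2 : Rabs (h s' - h t) < 1) by (apply Hd2; change (Rabs (s' - t) < d2); lra).
    rewrite E in B1. pose proof PI2_3_2. unfold PI2 in *.
    apply Rabs_def2 in B1. apply Rabs_def2 in B2. apply Rabs_def1; lra. }
  apply cos_eq_1_small; [assumption|].
  destruct (H b) as [_ [d [Hd Hcos]]]; [split; [apply Rmin_r | apply Rmax_r]|].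
  apply Hcos. rewrite Rminus_diag, Rabs_R0. assumption.
Qed.

(** A negative dot product makes the half-angle tangent larger than 1, because the denominator falls
    below the cross product. *)
Lemma ang_gt_half_turn u v : dot u v < 0 -> 0 < crs u v -> 0 < en u * en v + dot u v -> PI / 2 < ang u v.
Proof.
  intros Hd Hc Hp. pose proof (lagrange u v) as E. unfold ang.
  set (N := en u * en v) in *. set (d := dot u v) in *. set (k := crs u v) in *.
  assert (HN : N + d < k) by nra.
  assert (Hx : 1 < k / (N + d)).
  { apply Rmult_lt_reg_r with (N + d); [assumption|]. unfold Rdiv. rewrite Rmult_assoc, Rinv_l; lra. }
  apply atan_increasing in Hx. rewrite atan_1 in Hx. lra.
Qed.

Lemma ang_antisym u v : ang v u = - ang u v.
Proof.
  unfold ang. replace (crs v u / (en v * en u + dot v u)) with (- (crs u v / (en u * en v + dot u v))).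
  - rewrite atan_opp. ring.
  - replace (en v * en u + dot v u) with (en u * en v + dot u v) by (unfold dot; ring).
    unfold crs, Rdiv. ring.
Qed.

(* A polygon from one side to the other, closed up across the curve, has winding number 0 around every point
   of the curve except the crossing (look from infinity), but the winding number jumps at the crossing. *)
Lemma sides_not_conn kap V M c u t0 r : good_curve kap V M c u -> 0 < r <= tube kap V M ->
  ~ conn (range c) (tb c u t0 (V * r)) (tb c u t0 (- (V * r))).
Proof.
  intros Hc Hr Hcn. pose proof (good_esq t0 Hc) as HE.
  pose proof (good_V Hc) as HV. pose proof (good_M Hc) as HM.
  destruct (conn_angle kap V M c u _ _ Hc Hcn) as (f & Hf1 & Hf2 & Hf3).
  set (h := V * r) in *. assert (Hh : 0 < h) by (apply Rmult_lt_0_compat; lra).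
  set (p := tb c u t0 h) in *. set (q := tb c u t0 (- h)) in *.
  assert (Hpos : forall t, t <> t0 -> 0 < en (vec (c t) q) * en (vec (c t) p) + dot (vec (c t) q) (vec (c t) p)).
  { intros t Ht. apply en_dot_pos. intros x Hx E. apply Ht.
    unfold p, q, tb in E. rewrite lin_frame in E by assumption.
    replace (0 + x * (0 - 0)) with 0 in E by ring. set (k := - h + x * (h - - h)) in *.
    assert (Hk : Rabs k <= V * r) by (apply Rabs_le_between; unfold k; fold h; split; nra).
    pose proof (tb_dist kap V M c u t0 r k Hc Hk) as Hd. unfold tb in Hd. rewrite E in Hd.
    destruct (good_near kap V M c u t0 r t Hc Hr Hd) as [N1 _].
    apply (good_fX_injective kap V M c u t0); [assumption | assumption | |].
    - rewrite Rminus_diag, Rabs_R0. apply Rlt_le, (window_pos Hc).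
    - rewrite <- E. rewrite fX_frame by assumption. unfold fX. ring. }
  (* The angle of the normal segment that closes up the polygon; [f + e] is the total angle of a
     closed polygon, hence a multiple of a full turn. *)
  set (e := fun t => ang (vec (c t) q) (vec (c t) p)).
  assert (Hcos : forall t, t <> t0 -> cos (f t + e t) = 1).
  { intros t Ht. destruct (Hf2 t) as (N1 & C1 & S1). destruct (ang_cos_sin _ _ (Hpos t Ht)) as (N2 & C2 & S2).
    unfold e. rewrite cos_plus, C1, S1, C2, S2.
    pose proof (lagrange (vec (c t) p) (vec (c t) q)) as EL.
    rewrite (Rmult_comm (en (vec (c t) q))).
    set (a := vec (c t) p) in *. set (b := vec (c t) q) in *.
    replace (dot b a) with (dot a b) by (unfold dot; ring).
    replace (crs b a) with (- crs a b) by (unfold crs; ring).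
    replace (dot a b / (en a * en b) * (dot a b / (en a * en b)) - crs a b / (en a * en b) * (- crs a b / (en a * en b)))
      with ((dot a b ^ 2 + crs a b ^ 2) / (en a * en b) ^ 2).
    2:{ set (N := en a * en b) in *. field. lra. }
    rewrite <- EL. set (N := en a * en b) in *. field. lra. }
  (* Both [f] and [e] are small at either end of the curve, so their sum is 0 there and stays 0 up
     to the crossing time from each side. *)
  assert (Hzero : forall t, t <> t0 -> f t = - e t).
  { intros t Ht.
    destruct (Hf3 1 Rlt_0_1) as [T1 H1]. destruct (ang_far q p 1 Rlt_0_1) as [T2 H2].
    destruct (good_far kap V M c u q T2 Hc) as [B HB].
    set (T := Rabs T1 + Rabs B + Rabs t + Rabs t0 + 1).
    pose proof (Rle_abs T1). pose proof (Rle_abs B). pose proof (Rabs_pos T1). pose proof (Rabs_pos B).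
    pose proof (Rabs_pos t). pose proof (Rabs_pos t0).
    assert (HT : forall s, Rabs s = T -> Rabs (f s + e s) < PI).
    { intros s Hs. eapply Rle_lt_trans; [apply Rabs_triang|].
      specialize (H1 s ltac:(unfold T in Hs; lra)). specialize (H2 (c s) (HB s ltac:(unfold T in Hs; lra))).
      change (Rabs (e s) < 1) in H2. pose proof PI2_3_2. unfold PI2 in *. lra. }
    assert (HI : forall s, (t0 < s /\ t0 < t) \/ (s < t0 /\ t < t0) -> Rabs s = T -> f t + e t = 0).
    { intros s Hside Hs. apply (angle_vanish (fun x => f x + e x) s t); [|now apply HT].
      intros x Hx. assert (Hxt : x <> t0).
      { destruct Hside as [[A1 A2]|[A1 A2]]; unfold Rmin, Rmax in Hx; destruct (Rle_dec s t); lra. }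
      split.
      - apply continuous_Rplus; [apply Hf1|]. destruct (good_continuous Hc x).
        apply continuous_ang; [assumption | assumption | now apply Hpos].
      - exists (Rabs (x - t0)). split; [apply Rabs_pos_lt; lra|].
        intros y Hy. apply Hcos. intros ->. rewrite Rabs_minus_sym in Hy. lra. }
    pose proof (Rle_abs t). pose proof (Rle_abs t0). pose proof (Rle_abs (- t)) as At. pose proof (Rle_abs (- t0)) as At0.
    rewrite Rabs_Ropp in At, At0.
    assert (HTpos : 0 < T) by (unfold T; lra).
    destruct (Rtotal_order t t0) as [Hlt|[->|Hgt]]; [| contradiction |].
    - assert (f t + e t = 0); [|lra]. apply (HI (- T)); [right; unfold T; lra|].
      rewrite Rabs_Ropp. apply Rabs_pos_eq. lra.
    - assert (f t + e t = 0); [|lra]. apply (HI T); [left; unfold T; lra|]. apply Rabs_pos_eq. lra. }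
  assert (HP : locally (f t0) (fun y => Rabs (y - f t0) < 1)).
  { exists (mkposreal 1 Rlt_0_1). intros y Hy. exact Hy. }
  destruct (Hf1 t0 _ HP) as [d Hd]. pose proof (cond_pos d) as Hdp.
  set (E := esq (u t0)) in *.
  (* The three bounds on the time [s] serve in turn: [f] varies by less than 1, the abscissa at
     [t0 + s] and [t0 - s] keeps the sign given by the tangent, and the curve stays within half the
     height [h], so that the closing segment is seen under an obtuse angle. Then [f] would have to
     jump by more than [PI]. *)
  set (s := Rmin (d / 2) (Rmin (E / (2 * (V * M))) (r / (2 * V)))).
  assert (HVM : 0 < V * M) by now apply Rmult_lt_0_compat.
  assert (Q1 : 0 < E / (2 * (V * M))) by (apply Rdiv_lt_0_compat; lra).
  assert (Q2 : 0 < r / (2 * V)) by (apply Rdiv_lt_0_compat; lra).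
  assert (Hs : 0 < s) by (unfold s; repeat apply Rmin_pos; lra).
  pose proof (Rmin_l (d / 2) (Rmin (E / (2 * (V * M))) (r / (2 * V)))) as L1.
  pose proof (Rmin_r (d / 2) (Rmin (E / (2 * (V * M))) (r / (2 * V)))) as L2. fold s in L1, L2.
  pose proof (Rmin_l (E / (2 * (V * M))) (r / (2 * V))). pose proof (Rmin_r (E / (2 * (V * M))) (r / (2 * V))).
  assert (L3 : V * M * s <= E / 2).
  { apply Rle_trans with (V * M * (E / (2 * (V * M)))); [apply Rmult_le_compat_l; lra | right; field; lra]. }
  assert (L4 : V * s <= r / 2).
  { apply Rle_trans with (V * (r / (2 * V))); [apply Rmult_le_compat_l; lra | right; field; lra]. }
  assert (Hnear : forall x, Rabs x = s ->
     let X := fX (c t0) (u t0) (c (t0 + x)) in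
     Rabs (X - x * E) <= E / 2 * s /\
     dot (vec (c (t0 + x)) q) (vec (c (t0 + x)) p) < 0 /\
     crs (vec (c (t0 + x)) q) (vec (c (t0 + x)) p) = - 2 * h * X / E).
  { intros x Hx X. pose proof (good_speed Hc t0) as Hsp.
    assert (Hdist : V * dl1 (c (t0 + x)) (c t0) <= h / 2).
    { pose proof (good_up Hc (t0 + x) t0) as Hup.
      replace (t0 + x - t0) with x in Hup by ring. rewrite Hx in Hup.
      unfold h. replace (V * r / 2) with (V * (r / 2)) by field. apply Rmult_le_compat_l; lra. }
    pose proof (fX_le V (c t0) (u t0) (c (t0 + x)) (proj2 Hsp)) as BX.
    pose proof (fH_le V (c t0) (u t0) (c (t0 + x)) (proj2 Hsp)) as BH.
    fold X in BX. set (H' := fH (c t0) (u t0) (c (t0 + x))) in *.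
    assert (Ec : c (t0 + x) = frame (c t0) (u t0) X H') by (apply frame_coords; exact HE).
    split; [|split].
    - pose proof (good_taylor Hc t0 x) as HT.
      set (y := (fst (c t0) + x * fst (u t0), snd (c t0) + x * snd (u t0))) in *.
      replace (X - x * E) with (fX y (u t0) (c (t0 + x))) by (unfold X, fX, y, E, esq; cbn [fst snd]; ring).
      eapply Rle_trans; [apply (fX_le V), Hsp|].
      apply Rle_trans with (V * (M * x ^ 2)); [apply Rmult_le_compat_l; lra|].
      rewrite <- (pow2_abs x), Hx. replace (V * (M * s ^ 2)) with (V * M * s * s) by ring.
      apply Rmult_le_compat_r; lra.
    - replace (dot (vec (c (t0 + x)) q) (vec (c (t0 + x)) p)) with ((X ^ 2 + H' ^ 2 - h ^ 2) / E).
      2:{ rewrite Ec. unfold p, q, tb, frame, dot, vec, E, esq in *; cbn [fst snd]. field. lra. }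
      assert (X ^ 2 <= (h / 2) ^ 2) by (rewrite <- (pow2_abs X); apply pow_incr; split; [apply Rabs_pos | lra]).
      assert (H' ^ 2 <= (h / 2) ^ 2) by (rewrite <- (pow2_abs H'); apply pow_incr; split; [apply Rabs_pos | lra]).
      assert (X ^ 2 + H' ^ 2 - h ^ 2 < 0) by nra.
      unfold Rdiv. assert (0 < / E) by now apply Rinv_0_lt_compat. nra.
    - rewrite Ec at 1 2. unfold p, q, tb, frame, crs, vec, E, esq in *; cbn [fst snd]. field. lra. }
  destruct (Hnear s ltac:(apply Rabs_pos_eq; lra)) as (X1 & D1 & C1).
  destruct (Hnear (- s) ltac:(rewrite Rabs_Ropp; apply Rabs_pos_eq; lra)) as (X2 & D2 & C2).
  set (Xp := fX (c t0) (u t0) (c (t0 + s))) in *. set (Xm := fX (c t0) (u t0) (c (t0 + - s))) in *.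
  apply Rabs_le_between in X1. apply Rabs_le_between in X2.
  assert (HsE : 0 < s * E) by now apply Rmult_lt_0_compat.
  assert (P1 : 0 < Xp) by lra. assert (P2 : Xm < 0) by lra.
  assert (HiE : 0 < / E) by now apply Rinv_0_lt_compat.
  assert (Bm : PI / 2 < e (t0 + - s)).
  { apply ang_gt_half_turn; [assumption | | apply Hpos; lra]. rewrite C2.
    unfold Rdiv. apply Rmult_lt_0_compat; [nra | assumption]. }
  assert (Bp : e (t0 + s) < - (PI / 2)).
  { unfold e. rewrite ang_antisym. apply Ropp_lt_contravar. apply ang_gt_half_turn.
    - unfold dot in *. lra.
    - replace (crs (vec (c (t0 + s)) p) (vec (c (t0 + s)) q)) with (2 * h * Xp * / E).
      2:{ replace (crs (vec (c (t0 + s)) p) (vec (c (t0 + s)) q)) with (- crs (vec (c (t0 + s)) q) (vec (c (t0 + s)) p))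
            by (unfold crs; ring). rewrite C1. field. lra. }
      apply Rmult_lt_0_compat; [nra | assumption].
    - rewrite (Rmult_comm (en (vec (c (t0 + s)) p))). specialize (Hpos (t0 + s) ltac:(lra)). unfold dot in *. lra. }
  assert (F1 : Rabs (f (t0 + s) - f t0) < 1) by (apply Hd; change (Rabs (t0 + s - t0) < d); replace (t0 + s - t0) with s by ring; rewrite Rabs_pos_eq; lra).
  assert (F2 : Rabs (f (t0 + - s) - f t0) < 1) by (apply Hd; change (Rabs (t0 + - s - t0) < d); replace (t0 + - s - t0) with (- s) by ring; rewrite Rabs_Ropp, Rabs_pos_eq; lra).
  rewrite (Hzero (t0 + s)) in F1 by lra. rewrite (Hzero (t0 + - s)) in F2 by lra.
  apply Rabs_def2 in F1. apply Rabs_def2 in F2. pose proof PI2_3_2. unfold PI2 in *. lra.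
Qed.

(** * Counting traces *)

Section Sauer_Shelah.
Context {D X : Type} (S : D -> X -> Prop).

Definition eqtrace (P : list X) (a b : D) : Prop := forall x, In x P -> (S a x <-> S b x).

Definition shatters (F : list D) (Q : list X) : Prop :=
  forall w : list bool, length w = length Q ->
    exists a, In a F /\ Forall2 (fun x b => S a x <-> b = true) Q w.

(** [U] keeps one member for each trace on [P], and [I] one for each trace on [P] that extends to
    [p] in both ways. A trace on [P] occurs at most twice in [F], so the lengths add up. *)
Lemma trace_split (p : X) (P : list X) (F : list D) :
  ForallOrdPairs (fun a b => ~ eqtrace (p :: P) a b) F ->
  exists U I, length F = (length U + length I)%nat /\
    ForallOrdPairs (fun a b => ~ eqtrace P a b) U /\ ForallOrdPairs (fun a b => ~ eqtrace P a b) I /\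
    (forall a, In a U -> In a F) /\
    (forall a, In a F -> exists b, In b U /\ eqtrace P a b) /\
    (forall i, In i I -> forall b : bool, exists a, In a F /\ eqtrace P a i /\ (S a p <-> b = true)).
Proof.
  assert (Hsym : forall a b, eqtrace P a b -> eqtrace P b a) by (intros a b H x Hx; symmetry; now apply H).
  assert (Htr : forall a b d, eqtrace P a b -> eqtrace P b d -> eqtrace P a d)
    by (intros a b d H1 H2 x Hx; rewrite (H1 x Hx); now apply H2).
  induction 1 as [|a F Ha HF (U & I & Hlen & HU & HI & HUF & Hrep & HIF)].
  - exists [], []. repeat split; try constructor; intros a [].
  - rewrite Forall_forall in Ha.
    destruct (classic (exists b, In b U /\ eqtrace P a b)) as [(b & Hb & Hab)|Hno].
    + exists U, (b :: I). split; [simpl; lia|]. split; [assumption|].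
      assert (Hdiff : forall y, In y F -> eqtrace P a y -> (S a p <-> ~ S y p)).
      { intros y Hy Hay. pose proof (Ha y Hy) as Hn. split; intros H.
        - intros H1. apply Hn. intros x [<-|Hx]; [tauto | now apply Hay].
        - apply NNPP. intros H1. apply Hn. intros x [<-|Hx]; [tauto | now apply Hay]. }
      split; [|split; [|split]].
      * constructor; [|assumption]. rewrite Forall_forall. intros i Hi Hbi.
        destruct (classic (S a p)) as [Hs|Hs].
        -- destruct (HIF i Hi true) as (y & Hy & Hyi & Hyp).
           assert (Hay : eqtrace P a y) by (apply (Htr a b y Hab); apply (Htr b i y Hbi); now apply Hsym).
           specialize (Hdiff y Hy Hay). tauto.
        -- destruct (HIF i Hi false) as (y & Hy & Hyi & Hyp).
           assert (Hay : eqtrace P a y) by (apply (Htr a b y Hab); apply (Htr b i y Hbi); now apply Hsym).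
           specialize (Hdiff y Hy Hay). destruct Hyp as [Hyp _]. assert (~ S y p) by (intros H; now apply Hyp in H). tauto.
      * intros y Hy. right. now apply HUF.
      * intros y [<-|Hy]; [now exists b | now apply Hrep].
      * intros i [<-|Hi] v.
        -- pose proof (HUF b Hb) as HbF. specialize (Hdiff b HbF Hab).
           destruct (classic (S a p <-> v = true)) as [Hv|Hv].
           ++ exists a. split; [now left|]. split; assumption.
           ++ exists b. split; [now right|]. split; [intros x _; tauto|]. destruct (classic (S b p)), (classic (S a p)), v; intuition congruence.
        -- destruct (HIF i Hi v) as (y & Hy & H1 & H2). exists y. split; [now right | now split].
    + exists (a :: U), I. split; [simpl; lia|]. split; [|split; [assumption|split; [|split]]].
      * constructor; [|assumption]. rewrite Forall_forall. intros b Hb Hab. apply Hno. now exists b.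
      * intros y [<-|Hy]; [now left | right; now apply HUF].
      * intros y [<-|Hy].
        -- exists a. split; [now left | intros x _; tauto].
        -- destruct (Hrep y Hy) as (b & Hb & Hyb). exists b. split; [now right | assumption].
      * intros i Hi v. destruct (HIF i Hi v) as (y & Hy & H1 & H2). exists y. split; [now right | now split].
Qed.

(** If [U] is large its shattered set serves; otherwise [I] is large and its shattered set is
    enlarged by [p]. The crude bound satisfies the recursion since [(m + 1) ^ (d + 1) + (m + 1) ^ d
    <= (m + 2) ^ (d + 1)]. *)
Lemma sauer_shelah (P : list X) : forall (d : nat) (F : list D),
  ForallOrdPairs (fun a b => ~ eqtrace P a b) F -> ((length P + 1) ^ d < length F)%nat ->
  exists Q, length Q = (d + 1)%nat /\ incl Q P /\ shatters F Q.
Proof.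
  induction P as [|p P IH]; intros d F HF Hlen.
  - exfalso. simpl in Hlen. rewrite Nat.pow_1_l in Hlen.
    destruct F as [|a [|b F]]; simpl in Hlen; try lia.
    inversion HF as [|x l Hx Hl]; subst. rewrite Forall_forall in Hx.
    apply (Hx b); [now left|]. intros x [].
  - destruct (trace_split p P F HF) as (U & I & Hl & HU & HI & HUF & _ & HIF).
    destruct (Nat.lt_ge_cases ((length P + 1) ^ d) (length U)) as [HlU|HlU].
    + destruct (IH d U HU HlU) as (Q & HQ & Hincl & Hsh). exists Q. split; [assumption|].
      split; [intros x Hx; right; now apply Hincl|].
      intros w Hw. destruct (Hsh w Hw) as (a & Ha & HaQ). exists a. split; [now apply HUF | assumption].
    + assert (HIne : (length F - length U)%nat = length I) by lia.
      simpl length in Hlen.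
      (* For exponent 0 the list [U] has at most one member, so [I] is nonempty and [p] alone is
         shattered. *)
      destruct d as [|d].
      * rewrite Nat.pow_0_r in Hlen, HlU. destruct I as [|i I]; [rewrite Nat.add_0_r in Hl; lia|].
        exists [p]. split; [reflexivity|]. split; [intros x [<-|[]]; now left|].
        intros [|b [|b' w]] Hw; simpl in Hw; try lia.
        destruct (HIF i ltac:(now left) b) as (a & Ha & _ & Hab). exists a. split; [assumption|].
        constructor; [assumption | constructor].
      * assert (HlI : ((length P + 1) ^ d < length I)%nat).
        { assert (Hmono : ((length P + 1) ^ d <= (Datatypes.S (length P) + 1) ^ d)%nat) by (apply Nat.pow_le_mono_l; lia).
          rewrite Nat.pow_succ_r' in Hlen, HlU.
          set (a := ((length P + 1) ^ d)%nat) in *. set (b := ((Datatypes.S (length P) + 1) ^ d)%nat) in *.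
          pose proof (Nat.mul_le_mono_l a b (Datatypes.S (length P) + 1) Hmono) as Hm2.
          assert (E : ((Datatypes.S (length P) + 1) * a = (length P + 1) * a + a)%nat) by ring.
          set (y := ((length P + 1) * a)%nat) in *. set (z := ((Datatypes.S (length P) + 1) * b)%nat) in *.
          rewrite E in Hm2. lia. }
        destruct (IH d I HI HlI) as (Q & HQ & Hincl & Hsh). exists (p :: Q).
        split; [simpl; lia|]. split; [intros x [<-|Hx]; [now left | right; now apply Hincl]|].
        intros [|b w] Hw; simpl in Hw; [lia|].
        destruct (Hsh w ltac:(lia)) as (i & Hi & HiQ). destruct (HIF i Hi b) as (a & Ha & Hai & Hab).
        exists a. split; [assumption|]. constructor; [assumption|].
        assert (Hgen : forall Q w, incl Q P -> Forall2 (fun x b => S i x <-> b = true) Q w -> Forall2 (fun x b => S a x <-> b = true) Q w).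
        { intros Q' w' Hi'. induction 1 as [|x b' Q' w' Hx _ IH2]; constructor.
          - rewrite (Hai x); [assumption | apply Hi'; now left].
          - apply IH2. intros y Hy. apply Hi'. now right. }
        now apply Hgen.
Qed.
End Sauer_Shelah.

Lemma pigeonhole_rel {A B : Type} (rel : A -> B -> Prop) (l : list A) (rs : list B) : NoDup l ->
  (forall a, In a l -> exists b, In b rs /\ rel a b) -> (length rs < length l)%nat ->
  exists a a' b, In a l /\ In a' l /\ a <> a' /\ rel a b /\ rel a' b.
Proof.
  intros Hnd Hex Hlen.
  assert (Hb0 : inhabited B).
  { destruct l as [|a l]; [simpl in Hlen; lia|]. destruct (Hex a ltac:(now left)) as [b _]. exact (inhabits b). }
  set (f := fun a => epsilon Hb0 (fun b => In b rs /\ rel a b)).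
  assert (Hf : forall a, In a l -> In (f a) rs /\ rel a (f a)).
  { intros a Ha. apply (epsilon_spec Hb0 (fun b => In b rs /\ rel a b)). now apply Hex. }
  apply NNPP. intros Hn.
  assert (HM : NoDup (map f l)).
  { apply NoDup_map_NoDup_ForallPairs; [|assumption].
    intros a a' Ha Ha' E. apply NNPP. intros Hne. apply Hn. exists a, a', (f a).
    repeat split; try assumption; [apply Hf | rewrite E; apply Hf]; assumption. }
  assert (Hincl : incl (map f l) rs).
  { intros b Hb. apply in_map_iff in Hb. destruct Hb as (a & <- & Ha). now apply Hf. }
  pose proof (NoDup_incl_length HM Hincl) as HL. rewrite length_map in HL. lia.
Qed.

Definition curve := ((R -> R * R) * (R -> R * R))%type.

(** The side is the connected class of one reference point, on the positive normal at time 0. *)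
Definition left_of (V r : R) (d : curve) (p : R * R) : Prop :=
  conn (range (fst d)) p (tb (fst d) (snd d) 0 (V * r)).

(* Five curves have at most 31 complementary regions, hence cannot realise all 32 sign vectors. *)
Lemma trace_bound kap V M r (F : list curve) (P : list (R * R)) :
  (forall d, In d F -> good_curve kap V M (fst d) (snd d)) ->
  (forall a b, In a F -> In b F -> same_range (fst a) (fst b) \/ meet_once (fst a) (fst b)) ->
  (forall d p, In d F -> In p P -> ~ range (fst d) p) ->
  ForallOrdPairs (fun a b => ~ eqtrace (left_of V r) P a b) F ->
  (length F <= (length P + 1) ^ 31)%nat.
Proof.
  intros Hgood Hmeet Hoff Hdist.
  destruct (Nat.le_gt_cases (length F) ((length P + 1) ^ 31)) as [|Hlt]; [assumption|]. exfalso.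
  destruct (sauer_shelah (left_of V r) P 31 F Hdist Hlt) as (Q & HQ & HQP & Hsh).
  change (31 + 1)%nat with 32%nat in HQ.
  (* Shattering is applied to the set of indices whose binary digit number [j] is 1. The curves for
     the digits 0 to 4 together determine an index below 32. *)
  assert (Hex : forall j, exists d, In d F /\ forall i, (i < 32)%nat -> (left_of V r d (nth i Q (0, 0)) <-> Nat.testbit i j = true)).
  { intros j. destruct (Hsh (map (fun i => Nat.testbit i j) (seq 0 32))) as (d & Hd & HF2).
    { now rewrite length_map, length_seq. }
    exists d. split; [assumption|]. intros i Hi.
    assert (Hnth : forall Q w, Forall2 (fun x b => left_of V r d x <-> b = true) Q w ->
       forall i, (i < length Q)%nat -> (left_of V r d (nth i Q (0, 0)) <-> nth i w false = true)).
    { clear. induction 1 as [|x b Q w Hx _ IH]; intros i Hi; [simpl in Hi; lia|].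
      destruct i as [|i]; simpl; [assumption | apply IH; simpl in Hi; lia]. }
    specialize (Hnth _ _ HF2 i ltac:(lia)). rewrite Hnth.
    rewrite (nth_indep _ false (Nat.testbit 0 j)) by (rewrite length_map, length_seq; lia).
    rewrite (map_nth (fun i => Nat.testbit i j)), seq_nth by lia. reflexivity. }
  destruct (Hex 0%nat) as (d0 & I0 & T0). destruct (Hex 1%nat) as (d1 & I1 & T1). destruct (Hex 2%nat) as (d2 & I2 & T2).
  destruct (Hex 3%nat) as (d3 & I3 & T3). destruct (Hex 4%nat) as (d4 & I4 & T4).
  set (cs := map fst [d0; d1; d2; d3; d4]).
  assert (Hcs : forall c, In c cs -> exists d, In d F /\ c = fst d).
  { intros c Hc. apply in_map_iff in Hc. destruct Hc as (d & <- & Hd). exists d. split; [|reflexivity].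
    simpl in Hd. intuition congruence. }
  destruct (regions_bound kap V M cs) as (reps & Hreps & Hcov).
  { intros c Hc. destruct (Hcs c Hc) as (d & Hd & ->). exists (snd d). now apply Hgood. }
  { intros a b Ha Hb. destruct (Hcs a Ha) as (da & Hda & ->). destruct (Hcs b Hb) as (db & Hdb & ->). now apply Hmeet. }
  change (length cs) with 5%nat in Hreps. simpl in Hreps.
  destruct (pigeonhole_rel (fun i q => conn (union_ranges cs) (nth i Q (0, 0)) q) (seq 0 32) reps)
    as (i & i' & q & Hi & Hi' & Hne & Hci & Hci').
  - apply seq_NoDup.
  - intros i Hi. apply in_seq in Hi. apply Hcov. intros (c & Hc & Hr).
    destruct (Hcs c Hc) as (d & Hd & ->). apply (Hoff d (nth i Q (0, 0)) Hd); [|assumption].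
    apply HQP. apply nth_In. lia.
  - rewrite length_seq. lia.
  - apply in_seq in Hi, Hi'.
    (* Two of the 32 points share a region of the five curves, hence lie on the same side of each;
       all their binary digits agree, although the indices differ. *)
    pose proof (conn_trans Hci (conn_sym Hci')) as Hcc.
    assert (Hbit : forall j d, In (fst d) cs ->
       (forall i, (i < 32)%nat -> (left_of V r d (nth i Q (0, 0)) <-> Nat.testbit i j = true)) ->
       Nat.testbit i j = Nat.testbit i' j).
    { intros j d Hd HT.
      assert (Hcd : conn (range (fst d)) (nth i Q (0, 0)) (nth i' Q (0, 0))).
      { revert Hcc. apply conn_mono. intros x Hx. now exists (fst d). }
      assert (HE : left_of V r d (nth i Q (0, 0)) <-> left_of V r d (nth i' Q (0, 0))).
      { unfold left_of. split; intros H.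
        - exact (conn_trans (conn_sym Hcd) H).
        - exact (conn_trans Hcd H). }
      pose proof (HT i ltac:(lia)) as E1. pose proof (HT i' ltac:(lia)) as E2.
      destruct (Nat.testbit i j), (Nat.testbit i' j); intuition congruence. }
    assert (B0 := Hbit 0%nat d0 ltac:(simpl; tauto) T0). assert (B1 := Hbit 1%nat d1 ltac:(simpl; tauto) T1).
    assert (B2 := Hbit 2%nat d2 ltac:(simpl; tauto) T2). assert (B3 := Hbit 3%nat d3 ltac:(simpl; tauto) T3).
    assert (B4 := Hbit 4%nat d4 ltac:(simpl; tauto) T4).
    apply Hne. apply Nat.bits_inj. intros j.
    do 5 (destruct j as [|j]; [assumption|]).
    assert (Hhigh : forall n, (n < 32)%nat -> Nat.testbit n (Datatypes.S (Datatypes.S (Datatypes.S (Datatypes.S (Datatypes.S j))))) = false).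
    { intros n Hn. destruct n as [|n]; [apply Nat.bits_0|]. apply Nat.bits_above_log2.
      apply Nat.le_lt_trans with 4%nat; [|lia]. apply Nat.lt_succ_r.
      apply Nat.log2_lt_pow2; simpl; lia. }
    now rewrite !Hhigh by lia.
Qed.

(** * Geodesics with equal traces are close *)

(** On a minimal geodesic [dist] is the parameter difference, so comparing [dist] with the l1
    distance gives both Lipschitz bounds. The remaining fields express unit speed and bounded
    acceleration. *)
Lemma min_geodesic_good g lam Lam K c u : is_torus_metric g -> metric_bounds g lam Lam K -> min_geodesic g c u ->
  good_curve (/ Lam) (/ lam) (2 * (K * / lam * / lam)) c u.
Proof.
  intros Hg Hb [Hu Hm]. pose proof (mb_lam Hb) as Hl. pose proof (mb_Lam Hb) as HL.
  pose proof (mb_K Hb) as HK.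
  assert (Hil : 0 < / lam) by now apply Rinv_0_lt_compat.
  assert (HiL : 0 < / Lam) by now apply Rinv_0_lt_compat.
  split; try assumption.
  - repeat apply Rmult_lt_0_compat; lra.
  - intros s t. rewrite <- Hm. apply Rmult_le_reg_l with Lam; [assumption|].
    rewrite <- Rmult_assoc, Rinv_r, Rmult_1_l by lra. now apply (dist_le g lam Lam K).
  - intros s t. rewrite <- Hm. apply Rmult_le_reg_l with lam; [assumption|].
    rewrite <- Rmult_assoc, Rinv_r, Rmult_1_l by lra. now apply (dist_ge g lam Lam K).
  - intros t. split; [|now apply (nrm_unit g lam Lam K (c t)); [|apply Hu]].
    pose proof (mb_up Hb (c t) (u t)) as Hup. rewrite (proj2 Hu t) in Hup.
    pose proof (nrm_pos (u t)). assert (0 <= Lam * nrm (u t)) by (apply Rmult_le_pos; lra).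
    assert (1 <= Lam * nrm (u t)) by nra.
    apply Rmult_le_reg_l with Lam; [assumption|]. rewrite Rinv_r; lra.
  - intros s t. now apply (geodesic_velocity_lipschitz g lam Lam K c u).
  - intros t h. now apply (geodesic_taylor g lam Lam K c u).
Qed.

Lemma min_geodesics_meet g a u b v : is_torus_metric g -> min_geodesic g a u -> min_geodesic g b v ->
  same_range a b \/ meet_once a b.
Proof.
  intros Hg Ha Hb. destruct (classic (meet_once a b)) as [|Hn]; [now right|left].
  apply NNPP. intros Hs. apply Hn. intros s1 s2 t1 t2 E1 E2. apply NNPP. intros Hne. apply Hs.
  now apply (minimal_meet_twice g a u b v s1 s2 t1 t2).
Qed.

(** Induction over the curves, keeping around the current point a ball that earlier curves miss. The
    next curve is left along its normal by at most half the radius of that ball. *)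
Lemma avoid_curves kap V M (F : list curve) x e : (forall d, In d F -> good_curve kap V M (fst d) (snd d)) -> 0 < e ->
  exists p, dl1 p x <= e /\ forall d, In d F -> ~ range (fst d) p.
Proof.
  intros HF He.
  assert (H : exists p b, 0 < b /\ dl1 p x <= e / 2 /\ forall q, dl1 q p <= b -> forall d, In d F -> ~ range (fst d) q).
  { assert (He2 : 0 < e / 2) by lra. revert He2. generalize (e / 2). clear e He.
    induction F as [|d F IH]; intros e He.
    - exists x, 1. split; [lra|]. split; [rewrite dl1_refl; lra|]. intros q _ d [].
    - destruct (IH ltac:(intros; apply HF; now right) (e / 2) ltac:(lra)) as (p & b & Hb & Hpx & Hp).
      pose proof (HF d ltac:(now left)) as Hd.
      assert (Hp' : exists p', dl1 p' p <= Rmin (b / 2) (e / 2) /\ ~ range (fst d) p').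
      { assert (Hm : 0 < Rmin (b / 2) (e / 2)) by (apply Rmin_pos; lra).
        destruct (classic (range (fst d) p)) as [[t <-]|Hr].
        - destruct (small_radius kap V M _ _ _ Hd Hm) as [r [Hr Hr2]].
          assert (HV : 0 < V * r) by (apply Rmult_lt_0_compat; [apply (good_V Hd) | lra]).
          exists (tb (fst d) (snd d) t (V * r)). split.
          + eapply Rle_trans; [|exact Hr2]. apply (tb_dist kap V M); [assumption|]. rewrite Rabs_pos_eq; lra.
          + apply (tb_not_range kap V M _ _ t r); [assumption | assumption | lra|]. rewrite Rabs_pos_eq; lra.
        - exists p. split; [rewrite dl1_refl; lra | assumption]. }
      destruct Hp' as (p' & Hp'1 & Hp'2). destruct (good_closed Hd p' Hp'2) as (b' & Hb' & Hball).
      pose proof (Rmin_l (b / 2) (e / 2)). pose proof (Rmin_r (b / 2) (e / 2)).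
      exists p', (Rmin b' (b / 2)). split; [apply Rmin_pos; lra|].
      split; [pose proof (dl1_triang p' p x); lra|].
      pose proof (Rmin_l b' (b / 2)). pose proof (Rmin_r b' (b / 2)).
      intros q Hq d' [<-|Hd'].
      + apply Hball. lra.
      + apply (Hp q); [|assumption]. pose proof (dl1_triang q p' p). lra. }
  destruct H as (p & b & Hb & Hpx & Hp). exists p. split; [lra|].
  apply Hp. rewrite dl1_refl. lra.
Qed.

Lemma avoid_curves_net kap V M (F : list curve) (G : list (R * R)) e :
  (forall d, In d F -> good_curve kap V M (fst d) (snd d)) -> 0 < e ->
  exists P, length P = length G /\ (forall d p, In d F -> In p P -> ~ range (fst d) p) /\
    forall x, In x G -> exists p, In p P /\ dl1 p x <= e.
Proof.
  intros HF He. induction G as [|x G (P & Hl & Hav & Hnet)].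
  - exists []. split; [reflexivity|]. split; [intros d p _ []|intros x []].
  - destruct (avoid_curves kap V M F x e HF He) as (p & Hpx & Hp). exists (p :: P).
    split; [simpl; lia|]. split.
    + intros d q Hd [<-|Hq]; [now apply Hp | now apply Hav].
    + intros y [<-|Hy]; [exists p; split; [now left | assumption]|].
      destruct (Hnet y Hy) as (q & Hq & Hqy). exists q. split; [now right | assumption].
Qed.

Lemma good_kap_le_V kap V M c u : good_curve kap V M c u -> kap <= V.
Proof. intros Hc. pose proof (good_speed Hc 0). lra. Qed.
Arguments good_kap_le_V {kap V M c u}.

(** A curve point in the ball would have height at least [3 / 4 * V * r] in absolute value, while
    [good_near] at radius [5 / 4 * r] allows at most [5 / 8 * V * r]. *)
Lemma tb_ball kap V M c u t r h q : good_curve kap V M c u -> 0 < r -> 5 / 4 * r <= tube kap V M ->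
  Rabs h = V * r -> dl1 q (tb c u t h) <= r / 4 -> ~ range c q.
Proof.
  intros Hc Hr Ht Hh Hq [s Hs]. pose proof (good_esq t Hc) as HE.
  pose proof (good_V Hc) as HV. pose proof (good_kap Hc) as Hk.
  pose proof (good_kap_le_V Hc) as HkV. pose proof (good_speed Hc t) as Hsp.
  assert (HVk : 1 <= V / kap).
  { apply Rmult_le_reg_r with kap; [assumption|]. unfold Rdiv. rewrite Rmult_assoc, Rinv_l; lra. }
  pose proof (tb_dist kap V M c u t r h Hc ltac:(lra)) as Hd.
  assert (Hnear : dl1 (c s) (c t) <= 4 * V / kap * (5 / 4 * r)).
  { rewrite Hs. pose proof (dl1_triang q (tb c u t h) (c t)).
    replace (4 * V / kap * (5 / 4 * r)) with (4 * V / kap * r + V / kap * r) by (field; lra). nra. }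
  destruct (good_near kap V M c u t (5 / 4 * r) s Hc ltac:(lra) Hnear) as [_ HH].
  assert (Hdiff : Rabs (fH (c t) (u t) (c s) - h) <= V * (r / 4)).
  { rewrite <- (fH_frame (c t) (u t) 0 h) at 1 by assumption. fold (tb c u t h).
    replace (fH (c t) (u t) (c s) - fH (c t) (u t) (tb c u t h)) with (fH (tb c u t h) (u t) (c s))
      by (unfold fH; ring).
    eapply Rle_trans; [apply (fH_le V), Hsp|]. apply Rmult_le_compat_l; [lra|]. now rewrite Hs. }
  assert (HVr : 0 < V * r) by now apply Rmult_lt_0_compat.
  apply Rabs_le_between in HH. apply Rabs_le_between in Hdiff.
  unfold Rabs in Hh. destruct (Rcase_abs h); lra.
Qed.

Lemma tb_ball_conn kap V M c u t r h q : good_curve kap V M c u -> 0 < r -> 5 / 4 * r <= tube kap V M ->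
  Rabs h = V * r -> dl1 q (tb c u t h) <= r / 4 -> conn (range c) q (tb c u t h).
Proof.
  intros Hc Hr Ht Hh Hq. apply conn_seg. intros x Hx.
  apply (tb_ball kap V M c u t r h); try assumption.
  apply dl1_lin_le; [assumption | assumption|]. rewrite dl1_refl. lra.
Qed.

(** Relates the sides at time [t] to the references at time 0: with empty [A], two-sidedness slides
    along the whole curve, and descending the normal at [c t] brings the point into its range of
    validity. *)
Lemma tb_conn_start kap V M c u r0 t r h : good_curve kap V M c u -> 0 < r0 <= tube kap V M ->
  0 < r <= tube kap V M -> Rabs h = V * r ->
  conn (range c) (tb c u t h) (tb c u 0 (V * r0)) \/ conn (range c) (tb c u t h) (tb c u 0 (- (V * r0))).
Proof.
  intros Hc Hr0 Hr Hh. set (A := fun _ : R * R => False).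
  assert (Hcl : closed_set A) by (intros p _; exists 1; split; [lra | intros q _ []]).
  assert (HT : two_sided A c (tb c u 0 (V * r0)) (tb c u 0 (- (V * r0))) t).
  { apply (two_sided_slide kap V M c u A _ _ 0 t Hc Hcl); [intros s _ []|].
    apply (two_sided_at kap V M); [assumption | assumption | intros q _ []]. }
  destruct HT as (rho & Hrho & HT).
  destruct (small_radius kap V M c u rho Hc Hrho) as (r1 & Hr1 & Hr1').
  pose proof (good_V Hc) as HV.
  set (r2 := Rmin r r1). assert (Hr2 : 0 < r2) by (apply Rmin_pos; lra).
  assert (r2 <= r) by apply Rmin_l. assert (r2 <= r1) by apply Rmin_r.
  assert (HVr : 0 < V * r) by (apply Rmult_lt_0_compat; lra).
  assert (HVr2 : 0 < V * r2) by (apply Rmult_lt_0_compat; lra).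
  assert (V * r2 <= V * r) by (apply Rmult_le_compat_l; lra).
  assert (V * r2 <= V * r1) by (apply Rmult_le_compat_l; lra).
  assert (Hex : exists h2, Rabs h2 = V * r2 /\ 0 < h * h2).
  { destruct (Rle_dec 0 h) as [Hp|Hp].
    - exists (V * r2). rewrite Rabs_pos_eq in Hh by assumption. split; [apply Rabs_pos_eq; lra|].
      rewrite Hh. now apply Rmult_lt_0_compat.
    - exists (- (V * r2)). rewrite Rabs_left in Hh by lra. rewrite Rabs_Ropp. split; [apply Rabs_pos_eq; lra|].
      replace (h * - (V * r2)) with (- h * (V * r2)) by ring. rewrite Hh. now apply Rmult_lt_0_compat. }
  destruct Hex as (h2 & Hh2 & Hhh).
  assert (Hm : forall p q, conn (un A (range c)) p q -> conn (range c) p q)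
    by (intros p q; apply conn_mono; intros x Hx; now right).
  assert (Hc1 : conn (range c) (tb c u t h) (tb c u t h2)).
  { apply Hm. apply (tb_conn kap V M c u A t r); try assumption; try lra. intros q _ []. }
  assert (Hn : ~ range c (tb c u t h2)).
  { apply (tb_not_range kap V M c u t r1); [assumption | assumption | | lra]. intros E. rewrite E, Rabs_R0 in Hh2. lra. }
  assert (Hd : dl1 (tb c u t h2) (c t) <= rho).
  { eapply Rle_trans; [apply (tb_dist kap V M c u t r1); [assumption | lra] | exact Hr1']. }
  destruct (HT _ Hn Hd) as [Hx|Hx]; apply Hm in Hx; [left|right]; exact (conn_trans Hc1 Hx).
Qed.

(* If [b] stayed away from [a t], two net points on either side of [a] near [a t] would lie on the same side of [b]. *)
Lemma equal_trace_close kap V M a b r0 r e (P : list (R * R)) t :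
  good_curve kap V M (fst a) (snd a) -> good_curve kap V M (fst b) (snd b) ->
  0 < r0 <= tube kap V M -> 0 < r -> 5 / 4 * r <= tube kap V M -> 4 * V / kap * r + r / 4 <= e ->
  (forall x, dl1 x (fst a t) <= e -> exists p, In p P /\ dl1 p x <= r / 4) ->
  eqtrace (left_of V r0) P a b -> exists s, dl1 (fst a t) (fst b s) <= e.
Proof.
  intros Ha Hb Hr0 Hr Hrt Hre Hnet Heq. apply NNPP. intros Hn.
  assert (Hball : forall q, dl1 q (fst a t) <= e -> ~ range (fst b) q).
  { intros q Hq [s <-]. apply Hn. exists s. now rewrite dl1_sym. }
  pose proof (good_V Ha) as HV. assert (HVr : 0 < V * r) by now apply Rmult_lt_0_compat.
  set (top := tb (fst a) (snd a) t (V * r)). set (bot := tb (fst a) (snd a) t (- (V * r))).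
  assert (Htop : Rabs (V * r) = V * r) by (apply Rabs_pos_eq; lra).
  assert (Hbot : Rabs (- (V * r)) = V * r) by now rewrite Rabs_Ropp.
  pose proof (tb_dist kap V M _ _ t r (V * r) Ha ltac:(lra)) as Dt. fold top in Dt.
  pose proof (tb_dist kap V M _ _ t r (- (V * r)) Ha ltac:(lra)) as Db. fold bot in Db.
  destruct (Hnet top ltac:(lra)) as (p & Hp & Hpd). destruct (Hnet bot ltac:(lra)) as (q & Hq & Hqd).
  pose proof (tb_ball_conn kap V M _ _ t r (V * r) p Ha Hr Hrt Htop Hpd) as Cp. fold top in Cp.
  pose proof (tb_ball_conn kap V M _ _ t r (- (V * r)) q Ha Hr Hrt Hbot Hqd) as Cq. fold bot in Cq.
  assert (Hpq : conn (range (fst b)) p q).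
  { apply conn_seg. intros x Hx. apply Hball. apply dl1_lin_le; [assumption| |].
    - pose proof (dl1_triang p top (fst a t)). lra.
    - pose proof (dl1_triang q bot (fst a t)). lra. }
  assert (Eb : left_of V r0 b p <-> left_of V r0 b q).
  { unfold left_of. split; intros H; [exact (conn_trans (conn_sym Hpq) H) | exact (conn_trans Hpq H)]. }
  (* Equal traces carry the agreement of [p] and [q] from [b] over to [a]. Each of [top] and [bot]
     reaches one of the two references; in every combination they become connected to each other. *)
  assert (Ea : left_of V r0 a p <-> left_of V r0 a q) by (rewrite (Heq p Hp), (Heq q Hq); exact Eb).
  apply (sides_not_conn kap V M (fst a) (snd a) t r Ha ltac:(lra)). fold top bot.
  pose proof (tb_conn_start kap V M _ _ r0 t r (V * r) Ha Hr0 ltac:(lra) Htop) as St. fold top in St.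
  pose proof (tb_conn_start kap V M _ _ r0 t r (- (V * r)) Ha Hr0 ltac:(lra) Hbot) as Sb. fold bot in Sb.
  destruct St as [St|St].
  - assert (Lp : left_of V r0 a p) by exact (conn_trans Cp St).
    apply Ea in Lp. exact (conn_trans St (conn_sym (conn_trans (conn_sym Cq) Lp))).
  - destruct Sb as [Sb|Sb].
    + assert (Lq : left_of V r0 a q) by exact (conn_trans Cq Sb).
      apply Ea in Lq. pose proof (conn_trans (conn_sym Cp) Lq) as Ht.
      exact (conn_trans Ht (conn_sym Sb)).
    + exact (conn_trans St (conn_sym Sb)).
Qed.

(** The part [1 + 2 V Lam] is the loss in replacing the nearest parameter on the second curve by [t]
    up to sign; the last summand pays for the short times at which [b t] and [b (- t)] cannot yet be
    told apart. *)
Definition drift (Lam kap V : R) : R := 1 + 2 * (V * Lam) + 2 * V * (2 + 2 * (V * Lam)) / kap.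

Lemma drift_ge Lam kap V : 0 < Lam -> 0 < kap -> 0 < V -> 1 + 2 * (V * Lam) <= drift Lam kap V.
Proof.
  intros HL Hk HV. unfold drift. assert (0 < V * Lam) by now apply Rmult_lt_0_compat.
  assert (0 < 2 * V * (2 + 2 * (V * Lam)) / kap) by (apply Rdiv_lt_0_compat; [apply Rmult_lt_0_compat|]; lra). lra.
Qed.

(* Minimality makes the arc length parameters of nearby points agree up to sign; the initial directions and
   continuity fix the sign. *)
Lemma close_parametrization g lam Lam K kap V M a ua b ub e T : is_torus_metric g -> metric_bounds g lam Lam K ->
  minimal g a -> minimal g b -> good_curve kap V M a ua -> good_curve kap V M b ub -> 0 < e ->
  dl1 (a 0) (b 0) <= e -> dl1 (ua 0) (ub 0) <= e -> e <= kap / 2 -> drift Lam kap V * e < kap ^ 2 / (8 * M) ->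
  (forall t, 0 <= t <= T -> exists s, dl1 (a t) (b s) <= e) ->
  forall t, 0 <= t <= T -> dl1 (a t) (b t) <= drift Lam kap V * e.
Proof.
  intros Hg Hb Ma Mb Ga Gb He H0 Hu0 Hek HeM Hclose.
  pose proof (mb_Lam Hb) as HL. pose proof (good_kap Ga) as Hk.
  pose proof (good_V Ga) as HV. pose proof (good_M Ga) as HM.
  set (C1 := 1 + 2 * (V * Lam)). set (C2 := drift Lam kap V) in *.
  assert (HC12 : C1 <= C2) by now apply drift_ge.
  assert (HVL : 0 < V * Lam) by now apply Rmult_lt_0_compat.
  (* Distances from the starting points are absolute values of parameters, so [t] and [Rabs s]
     differ by at most [2 * Lam * e]; only the sign of [s] remains open. *)
  assert (Hpm : forall t, 0 <= t <= T -> dl1 (a t) (b t) <= C1 * e \/ dl1 (a t) (b (- t)) <= C1 * e).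
  { intros t Ht. destruct (Hclose t Ht) as [s Hs].
    pose proof (dist_triangle g (a 0) (b 0) (a t) Hg) as T1. pose proof (dist_triangle g (b 0) (b s) (a t) Hg) as T2.
    pose proof (dist_triangle g (b 0) (a 0) (b s) Hg) as T3. pose proof (dist_triangle g (a 0) (a t) (b s) Hg) as T4.
    pose proof (dist_le g lam Lam K (a 0) (b 0) Hg Hb) as D1. pose proof (dist_le g lam Lam K (b 0) (a 0) Hg Hb) as D2.
    pose proof (dist_le g lam Lam K (a t) (b s) Hg Hb) as D3. pose proof (dist_le g lam Lam K (b s) (a t) Hg Hb) as D4.
    rewrite (dl1_sym (b 0)) in D2. rewrite (dl1_sym (b s)) in D4.
    rewrite Ma in T1, T4. rewrite Mb in T2, T3.
    assert (E0 : Lam * dl1 (a 0) (b 0) <= Lam * e) by (apply Rmult_le_compat_l; lra).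
    assert (E1 : Lam * dl1 (a t) (b s) <= Lam * e) by (apply Rmult_le_compat_l; lra).
    assert (At : Rabs (0 - t) = t) by (rewrite Rabs_left1; lra).
    assert (As : Rabs (0 - s) = Rabs s) by (rewrite <- Rabs_Ropp; f_equal; ring).
    rewrite At in *. rewrite As in *.
    assert (HB : forall x, Rabs (s - x) <= 2 * Lam * e -> dl1 (a t) (b x) <= C1 * e).
    { intros x Hx. eapply Rle_trans; [apply (dl1_triang _ (b s))|].
      pose proof (good_up Gb s x). assert (V * Rabs (s - x) <= V * (2 * Lam * e)) by (apply Rmult_le_compat_l; lra).
      unfold C1. lra. }
    destruct (Rle_dec 0 s) as [Hs0|Hs0].
    - left. apply HB. rewrite Rabs_pos_eq in * by assumption. apply Rabs_le. lra.
    - right. apply HB. rewrite (Rabs_left s) in * by lra. apply Rabs_le. lra. }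
  (* Up to this time the two Taylor remainders add up to at most [kap / 2 * t]. A match with
     [b (- t)] then forces [kap * t <= (1 + C1) * e], so that [b t] is close as well. *)
  set (ts := kap / (4 * M)). assert (Hts : 0 < ts) by (apply Rdiv_lt_0_compat; lra).
  assert (HtsM : 4 * M * ts = kap) by (unfold ts; field; lra).
  assert (Hsmall : forall t, 0 <= t <= T -> t <= ts -> dl1 (a t) (b t) <= C2 * e).
  { intros t Ht Htts. destruct (Hpm t Ht) as [Hp|Hp]; [nra|].
    pose proof (good_taylor Ga 0 t) as Ta. pose proof (good_taylor Gb 0 t) as Tb.
    rewrite Rplus_0_l in Ta, Tb.
    set (qa := (fst (a 0) + t * fst (ua 0), snd (a 0) + t * snd (ua 0))) in *.
    set (qb := (fst (b 0) + t * fst (ub 0), snd (b 0) + t * snd (ub 0))) in *.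
    assert (Hq : dl1 qa qb <= e + t * e).
    { assert (Hq1 : dl1 qa qb <= dl1 (a 0) (b 0) + t * dl1 (ua 0) (ub 0)).
      { unfold dl1, qa, qb; cbn [fst snd].
        replace (fst (a 0) + t * fst (ua 0) - (fst (b 0) + t * fst (ub 0))) with ((fst (a 0) - fst (b 0)) + t * (fst (ua 0) - fst (ub 0))) by ring.
        replace (snd (a 0) + t * snd (ua 0) - (snd (b 0) + t * snd (ub 0))) with ((snd (a 0) - snd (b 0)) + t * (snd (ua 0) - snd (ub 0))) by ring.
        pose proof (Rabs_triang (fst (a 0) - fst (b 0)) (t * (fst (ua 0) - fst (ub 0)))) as R1.
        pose proof (Rabs_triang (snd (a 0) - snd (b 0)) (t * (snd (ua 0) - snd (ub 0)))) as R2.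
        rewrite Rabs_mult, (Rabs_pos_eq t) in R1, R2 by lra. lra. }
      assert (t * dl1 (ua 0) (ub 0) <= t * e) by (apply Rmult_le_compat_l; lra). lra. }
    assert (Hab : dl1 (a t) (b t) <= e + t * e + 2 * (M * t ^ 2)).
    { pose proof (dl1_triang (a t) qa (b t)). pose proof (dl1_triang qa qb (b t)). rewrite (dl1_sym qb (b t)) in *. lra. }
    pose proof (good_low Gb t (- t)) as Low.
    rewrite (Rabs_pos_eq (t - - t)) in Low by lra.
    pose proof (dl1_triang (b t) (a t) (b (- t))) as Tr. rewrite (dl1_sym (b t) (a t)) in Tr.
    assert (HMt : 2 * (M * t ^ 2) <= kap / 2 * t).
    { replace (2 * (M * t ^ 2)) with (2 * M * t * t) by ring. apply Rmult_le_compat_r; [lra|]. nra. }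
    assert (Hte : t * e <= kap / 2 * t) by nra.
    assert (Hkt : kap * t <= (1 + C1) * e) by lra.
    pose proof (good_up Gb (- t) t) as Up. rewrite Rabs_left1 in Up by lra.
    pose proof (dl1_triang (a t) (b (- t)) (b t)) as Tr2.
    assert (Ht2 : t <= (1 + C1) * e / kap).
    { apply Rmult_le_reg_l with kap; [assumption|]. replace (kap * ((1 + C1) * e / kap)) with ((1 + C1) * e) by (field; lra). assumption. }
    assert (V * (2 * t) <= V * (2 * ((1 + C1) * e / kap))) by (apply Rmult_le_compat_l; lra).
    unfold C2, drift. fold C1. replace (2 + 2 * (V * Lam)) with (1 + C1) by (unfold C1; ring).
    replace ((C1 + 2 * V * (1 + C1) / kap) * e) with (C1 * e + V * (2 * ((1 + C1) * e / kap))) by (field; lra). lra. }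
  intros t Ht. destruct (Rle_dec t ts) as [Hle|Hgt]; [now apply Hsmall|].
  assert (HeM2 : C2 * e < kap * ts / 2) by (unfold ts; replace (kap * (kap / (4 * M)) / 2) with (kap ^ 2 / (8 * M)) by (field; lra); assumption).
  apply (interval_propagate (fun t => dl1 (a t) (b t) <= C2 * e) ts t); [lra | apply Hsmall; lra|].
  (* From [ts] on, [b s] and [b (- s')] are at least [2 * kap * ts] apart, more than the errors and
     the motion within this radius allow; hence the sign cannot switch. *)
  intros x Hx. exists (kap * ts / (2 * V)). assert (Hd : 0 < kap * ts / (2 * V)) by (apply Rdiv_lt_0_compat; [apply Rmult_lt_0_compat|]; lra).
  split; [assumption|]. intros s s' Hs Hs' Hxs Hxs' Hps.
  destruct (Hpm s' ltac:(lra)) as [Hp|Hp]; [nra|]. exfalso.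
  pose proof (good_low Gb s (- s')) as Low. rewrite (Rabs_pos_eq (s - - s')) in Low by lra.
  pose proof (dl1_triang (b s) (a s) (b (- s'))) as Tr1. rewrite (dl1_sym (b s) (a s)) in Tr1.
  pose proof (dl1_triang (a s) (a s') (b (- s'))) as Tr2.
  pose proof (good_up Ga s s') as Up.
  assert (Hss : Rabs (s - s') < 2 * (kap * ts / (2 * V))).
  { apply Rabs_def2 in Hxs. apply Rabs_def2 in Hxs'. apply Rabs_def1; lra. }
  assert (V * Rabs (s - s') < V * (2 * (kap * ts / (2 * V)))) by now apply Rmult_lt_compat_l.
  replace (V * (2 * (kap * ts / (2 * V)))) with (kap * ts) in * by (field; lra).
  assert (kap * (2 * ts) <= kap * (s - - s')) by (apply Rmult_le_compat_l; lra).
  assert (C1 * e <= C2 * e) by (apply Rmult_le_compat_r; lra). lra.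
Qed.

(** A velocity is a difference quotient up to [M * h]. The increment [h] stays free, to be balanced
    against the position error. *)
Lemma close_velocity kap V M a ua b ub t h e : good_curve kap V M a ua -> good_curve kap V M b ub -> 0 < h ->
  dl1 (a t) (b t) <= e -> dl1 (a (t + h)) (b (t + h)) <= e -> dl1 (ua t) (ub t) <= 2 * e / h + 2 * M * h.
Proof.
  intros Ga Gb Hh H1 H2.
  pose proof (good_taylor Ga t h) as Ta. pose proof (good_taylor Gb t h) as Tb.
  assert (H : h * dl1 (ua t) (ub t) <= 2 * e + 2 * M * h ^ 2).
  { unfold dl1 in *; cbn [fst snd] in *.
    assert (Q : forall x x' y y' u v, h * Rabs (u - v) <= Rabs (x' - (x + h * u)) + Rabs (y' - (y + h * v)) + Rabs (x - y) + Rabs (x' - y')).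
    { intros x x' y y' u v. rewrite <- (Rabs_pos_eq h) at 1 by lra. rewrite <- Rabs_mult.
      replace (h * (u - v)) with (- (x' - (x + h * u)) + ((y' - (y + h * v)) + (- (x - y) + (x' - y')))) by ring.
      eapply Rle_trans; [apply Rabs_triang|]. rewrite Rabs_Ropp.
      pose proof (Rabs_triang (y' - (y + h * v)) (- (x - y) + (x' - y'))). pose proof (Rabs_triang (- (x - y)) (x' - y')) as R.
      rewrite Rabs_Ropp in R. lra. }
    pose proof (Q (fst (a t)) (fst (a (t + h))) (fst (b t)) (fst (b (t + h))) (fst (ua t)) (fst (ub t))).
    pose proof (Q (snd (a t)) (snd (a (t + h))) (snd (b t)) (snd (b (t + h))) (snd (ua t)) (snd (ub t))).
    lra. }
  apply Rmult_le_reg_l with h; [assumption|].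
  replace (h * (2 * e / h + 2 * M * h)) with (2 * e + 2 * M * h ^ 2) by (field; lra). assumption.
Qed.

(** * The Sasaki distance of nearby unit vectors *)

Lemma continuous_quad_chr g k (x a b : R -> R * R) (t : R) : is_torus_metric g ->
  continuous (fun s => fst (x s)) t -> continuous (fun s => snd (x s)) t ->
  continuous (fun s => fst (a s)) t -> continuous (fun s => snd (a s)) t ->
  continuous (fun s => fst (b s)) t -> continuous (fun s => snd (b s)) t ->
  continuous (fun s => quad_chr g k (x s) (a s) (b s)) t.
Proof.
  intros Hg Hx1 Hx2 Ha1 Ha2 Hb1 Hb2. unfold quad_chr.
  assert (Hc : forall i j, continuous (fun s => chr g k i j (fst (x s)) (snd (x s))) t).
  { intros i j. apply continuous_comp_2d; [|assumption|assumption].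
    apply continuity_of_BL. now apply BL_chr. }
  assert (Ht : forall i j (u v : R -> R), continuous u t -> continuous v t ->
    continuous (fun s => chr g k i j (fst (x s)) (snd (x s)) * u s * v s) t).
  { intros i j u v Hu Hv.
    exact (continuous_Rmult _ _ _ (continuous_Rmult _ _ _ (Hc i j) Hu) Hv). }
  exact (continuous_Rplus _ _ _ (continuous_Rplus _ _ _ (continuous_Rplus _ _ _
    (Ht 0 0 _ _ Ha1 Hb1) (Ht 0 1 _ _ Ha1 Hb2)) (Ht 1 0 _ _ Ha2 Hb1)) (Ht 1 1 _ _ Ha2 Hb2))%nat.
Qed.

Lemma continuous_sasaki_density g gam gam' V V' : is_torus_metric g -> C1curve gam gam' -> C1curve V V' ->
  forall t, continuous (fun t =>
    let D := (cov g 0 (gam t) (gam' t) (V t) (V' t), cov g 1 (gam t) (gam' t) (V t) (V' t)) in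
    sqrt (gq g (gam t) (gam' t) (gam' t) + gq g (gam t) D D)) t.
Proof.
  intros Hg H1 H2 t. destruct (H1 t) as (A1 & A2 & A3 & A4). destruct (H2 t) as (B1 & B2 & B3 & B4).
  apply continuous_of_is_derive in A1, A2, B1, B2.
  set (D := fun t => (cov g 0 (gam t) (gam' t) (V t) (V' t), cov g 1 (gam t) (gam' t) (V t) (V' t))).
  apply (continuous_comp (fun t => gq g (gam t) (gam' t) (gam' t) + gq g (gam t) (D t) (D t)) sqrt); [|apply continuous_sqrt].
  assert (D0 : continuous (fun s => fst (D s)) t).
  { exact (continuous_Rplus _ _ _ B3 (continuous_quad_chr g 0 gam gam' V t Hg A1 A2 A3 A4 B1 B2)). }
  assert (D1 : continuous (fun s => snd (D s)) t).
  { exact (continuous_Rplus _ _ _ B4 (continuous_quad_chr g 1 gam gam' V t Hg A1 A2 A3 A4 B1 B2)). }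
  apply continuous_Rplus; now apply continuous_gq.
Qed.

(** If horizontal and vertical parts of the motion have l1 size at most [L], the Sasaki speed is at
    most [2 * Lam * L], the 2 being generous for the square root of 2. *)
Lemma distS_le_path g w1 w2 k1 k2 gam gam' V V' L : is_torus_metric g -> C1curve gam gam' -> C1curve V V' ->
  (forall t, 0 <= t <= 1 -> unitvec g (gam t, V t)) -> (gam 0, V 0) = w1 -> (gam 1, V 1) = shift k1 k2 w2 ->
  0 <= L -> (forall t, 0 <= t <= 1 -> nrm (gam' t) <= L) ->
  (forall t, 0 <= t <= 1 -> nrm (cov g 0 (gam t) (gam' t) (V t) (V' t), cov g 1 (gam t) (gam' t) (V t) (V' t)) <= L) ->
  forall lam Lam K, metric_bounds g lam Lam K -> distS g w1 w2 <= Lam * (2 * L).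
Proof.
  intros Hg H1 H2 Hu E0 E1 HL Hn1 Hn2 lam Lam K Hb. pose proof (mb_Lam Hb) as HLam.
  assert (Hpos : 0 <= Lam * (2 * L)) by (apply Rmult_le_pos; lra).
  assert (Hlen : sasaki_len g gam gam' V V' <= Lam * (2 * L)).
  { unfold sasaki_len. apply Rle_trans with (RInt (fun _ => Lam * (2 * L)) 0 1).
    - apply RInt_le; [lra | | apply ex_RInt_const |].
      + apply ex_RInt_continuous_all. now apply continuous_sasaki_density.
      + intros t Ht. specialize (Hn1 t ltac:(lra)). specialize (Hn2 t ltac:(lra)).
        set (D := (cov g 0 (gam t) (gam' t) (V t) (V' t), cov g 1 (gam t) (gam' t) (V t) (V' t))) in *.
        cbv zeta. rewrite <- (sqrt_pow2 (Lam * (2 * L))) by assumption. apply sqrt_le_1_alt.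
        assert (Q : forall a, nrm a <= L -> gq g (gam t) a a <= (Lam * L) ^ 2).
        { intros a Ha. eapply Rle_trans; [apply (mb_up Hb)|]. apply pow_incr. pose proof (nrm_pos a).
          split; [apply Rmult_le_pos; lra | apply Rmult_le_compat_l; lra]. }
        pose proof (Q _ Hn1). pose proof (Q _ Hn2). pose proof (pow2_ge_0 (Lam * L)).
        replace ((Lam * (2 * L)) ^ 2) with (4 * (Lam * L) ^ 2) by ring. lra.
    - rewrite RInt_const. unfold scal; simpl; unfold mult; simpl. lra. }
  unfold distS.
  match goal with |- real (Glb_Rbar ?E) <= _ => pose proof (proj1 (Glb_Rbar_correct E)) as HG; set (G := Glb_Rbar E) in * end.
  specialize (HG (sasaki_len g gam gam' V V')).
  (* [real] sends an infinite bound to 0, and the right-hand side is nonnegative. *)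
  destruct G as [r| |]; simpl in *; try assumption.
  eapply Rle_trans; [|exact Hlen]. apply HG. exists k1, k2, gam, gam', V, V'. auto 10.
Qed.

Lemma is_derive_inv_sqrt (q : R -> R) t q' : is_derive q t q' -> 0 < q t ->
  is_derive (fun s => / sqrt (q s)) t (q' * (- / (2 * q t * sqrt (q t)))).
Proof.
  intros Hq Hpos. pose proof (sqrt_lt_R0 _ Hpos) as Hs. pose proof (sqrt_sqrt (q t) ltac:(lra)) as Hss.
  apply (is_derive_comp (fun z => / sqrt z) q t (- / (2 * q t * sqrt (q t))) q'); [|assumption].
  auto_derive; [split; [assumption|split; [lra | trivial]]|].
  set (r := sqrt (q t)) in *. rewrite <- Hss. field. lra.
Qed.

(** Base point and vector are interpolated linearly, and the vector is rescaled to unit length on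
    the way. Its squared length [q] stays near 1, so the rescaling factor and its derivative are
    controlled and the Sasaki speed is of order [xi]. *)
Lemma distS_close g lam Lam K : is_torus_metric g -> metric_bounds g lam Lam K ->
  exists C xi0, 0 < C /\ 0 < xi0 /\ forall x y v w k1 k2 xi, gq g x v v = 1 -> gq g y w w = 1 ->
    0 <= xi <= xi0 -> dl1 x (tr k1 k2 y) <= xi -> dl1 v w <= xi -> distS g (x, v) (y, w) <= C * xi.
Proof.
  intros Hg Hb. pose proof (mb_lam Hb) as Hl. pose proof (mb_K Hb) as HK. pose proof (mb_Lam Hb) as HLam.
  set (B := / lam + 1). assert (HB : 1 < B) by (unfold B; pose proof (Rinv_0_lt_compat _ Hl); lra).
  set (C1 := 2 * K * B ^ 2). assert (HB2 : 1 < B ^ 2) by nra.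
  assert (HC1 : 0 < C1) by (unfold C1; apply Rmult_lt_0_compat; lra).
  set (C3 := 2 * K * B ^ 2 + 4 * K * B).
  assert (HKB : 0 < K * B) by (apply Rmult_lt_0_compat; lra).
  assert (HC3 : 0 < C3) by (unfold C3; unfold C1 in HC1; lra).
  set (C4 := 4 + B * (4 * C3)).
  assert (HBC3 : 0 < B * (4 * C3)) by (apply Rmult_lt_0_compat; lra).
  set (C5 := C4 + 8 * (K * B)).
  assert (HC5 : 4 < C5) by (unfold C5, C4; lra).
  (* [C1 * xi] bounds the deviation of [q] from 1, so the second witness keeps [q] at least 1/4. Per
     unit of [xi], [C3] bounds the derivative of [q], [C4] that of the unit field, and [C5] its
     covariant derivative. *)
  exists (Lam * (2 * C5)), (Rmin 1 (3 / 4 / C1)).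
  split; [apply Rmult_lt_0_compat; lra|].
  split; [apply Rmin_pos; [lra | apply Rdiv_lt_0_compat; lra]|].
  intros x y0 v w k1 k2 xi Hv Hw Hxi Hxy Hvw. set (y := tr k1 k2 y0) in *.
  assert (Hy : gq g y w w = 1) by (unfold y; now rewrite gq_tr).
  pose proof (Rmin_l 1 (3 / 4 / C1)). pose proof (Rmin_r 1 (3 / 4 / C1)).
  assert (Hxi1 : xi <= 1) by lra.
  assert (Hxi2 : C1 * xi <= 3 / 4).
  { apply Rle_trans with (C1 * (3 / 4 / C1)); [apply Rmult_le_compat_l; lra | right; field; lra]. }
  pose proof (nrm_unit g lam Lam K x v Hb Hv) as Nv.
  (* [C1curve] concerns all real times. The sine passes from 0 to 1 on the unit interval and never
     leaves the interval from -1 to 1, so the interpolated vector does not degenerate anywhere on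
     the line. *)
  set (s := fun t => sin (PI / 2 * t)). set (s' := fun t => PI / 2 * cos (PI / 2 * t)).
  assert (Ds : forall t, is_derive s t (s' t)).
  { intros t. unfold s, s'. auto_derive; [trivial | ring]. }
  assert (Cs' : forall t, continuous s' t).
  { intros t. apply (ex_derive_continuous s' t). unfold s'. auto_derive; trivial. }
  assert (Bs : forall t, Rabs (s t) <= 1) by (intros t; apply Rabs_le; apply SIN_bound).
  assert (Bs' : forall t, Rabs (s' t) <= 2).
  { intros t. unfold s'. rewrite Rabs_mult. rewrite (Rabs_pos_eq (PI / 2)) by (pose proof PI_RGT_0; lra).
    pose proof PI_4. assert (Rabs (cos (PI / 2 * t)) <= 1) by (apply Rabs_le; apply COS_bound).
    pose proof (Rabs_pos (cos (PI / 2 * t))). pose proof PI_RGT_0. nra. }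
  set (dx := (fst y - fst x, snd y - snd x)). set (dv := (fst w - fst v, snd w - snd v)).
  assert (Ndx : nrm dx <= xi) by (rewrite dl1_sym in Hxy; exact Hxy).
  assert (Ndv : nrm dv <= xi) by (rewrite dl1_sym in Hvw; exact Hvw).
  set (gam := fun t => (fst x + s t * fst dx, snd x + s t * snd dx)).
  set (gam' := fun t => (s' t * fst dx, s' t * snd dx)).
  set (W := fun t => (fst v + s t * fst dv, snd v + s t * snd dv)).
  set (W' := fun t => (s' t * fst dv, s' t * snd dv)).
  assert (Hline : forall p r : R, forall t, is_derive (fun t => p + s t * r) t (s' t * r)).
  { intros p r t. evar_last.
    - apply (is_derive_plus (fun _ => p) (fun t => s t * r) t 0 (s' t * r)); [apply (is_derive_const p)|].
      evar_last; [apply (is_derive_Rmult s (fun _ => r) t (s' t) 0); [apply Ds | apply (is_derive_const r)] | cbv beta; ring].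
    - unfold plus; simpl. ring. }
  assert (Hcl : forall r : R, forall t, continuous (fun t => s' t * r) t)
    by (intros r t; apply continuous_Rmult; [apply Cs' | apply continuous_const]).
  assert (Hgam : C1curve gam gam').
  { intros t. unfold gam, gam'; cbn [fst snd]. split; [apply Hline|split; [apply Hline|split; apply Hcl]]. }
  assert (HW : C1curve W W').
  { intros t. unfold W, W'; cbn [fst snd]. split; [apply Hline|split; [apply Hline|split; apply Hcl]]. }
  assert (Ngam' : forall t, nrm (gam' t) <= 2 * xi).
  { intros t. unfold gam'. rewrite nrm_scal. apply Rmult_le_compat; auto using Rabs_pos, nrm_pos. }
  assert (NW' : forall t, nrm (W' t) <= 2 * xi).
  { intros t. unfold W'. rewrite nrm_scal. apply Rmult_le_compat; auto using Rabs_pos, nrm_pos. }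
  assert (Ne : forall d t, nrm d <= xi -> nrm (s t * fst d, s t * snd d) <= xi).
  { intros d t Hd. rewrite nrm_scal. pose proof (Bs t). pose proof (Rabs_pos (s t)). pose proof (nrm_pos d). nra. }
  assert (NW : forall t, nrm (W t) <= B).
  { intros t. eapply Rle_trans; [apply (nrm_add v (s t * fst dv, s t * snd dv))|].
    pose proof (Ne dv t Ndv). unfold B. lra. }
  assert (Dgam : forall t, dl1 (gam t) x <= xi).
  { intros t. unfold dl1, gam; cbn [fst snd].
    replace (fst x + s t * fst dx - fst x) with (s t * fst dx) by ring.
    replace (snd x + s t * snd dx - snd x) with (s t * snd dx) by ring. exact (Ne dx t Ndx). }
  set (q := fun t => gq g (gam t) (W t) (W t)).
  assert (Hq : forall t, / 4 <= q t).
  { intros t. pose proof (mb_gqlip Hb (gam t) x (W t)) as L1.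
    set (e := (s t * fst dv, s t * snd dv)).
    assert (Ne' : nrm e <= xi) by now apply Ne.
    assert (Eq : gq g x (W t) (W t) = 1 + 2 * gq g x v e + gq g x e e).
    { rewrite <- Hv. unfold W, e, gq; simpl. ring. }
    pose proof (mb_gq Hb x v e) as G1. pose proof (mb_gq Hb x e e) as G2.
    pose proof (nrm_pos e). pose proof (nrm_pos v). pose proof (nrm_pos (W t)). specialize (Dgam t). pose proof (dl1_pos (gam t) x).
    specialize (NW t).
    assert (L1' : K * dl1 (gam t) x * nrm (W t) ^ 2 <= K * xi * B ^ 2).
    { apply Rmult_le_compat; [apply Rmult_le_pos; lra | apply pow2_ge_0 | apply Rmult_le_compat_l; lra | apply pow_incr; lra]. }
    assert (G1' : K * nrm v * nrm e <= K * (B - 1) * xi).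
    { apply Rmult_le_compat; [apply Rmult_le_pos; lra | lra | apply Rmult_le_compat_l; [lra | unfold B; lra] | assumption]. }
    assert (G2' : K * nrm e * nrm e <= K * 1 * xi).
    { apply Rmult_le_compat; [apply Rmult_le_pos; lra | lra | apply Rmult_le_compat_l; lra | assumption]. }
    apply Rabs_le_between in L1. apply Rabs_le_between in G1. apply Rabs_le_between in G2.
    assert (Hsum : K * xi * B ^ 2 + 2 * (K * (B - 1) * xi) + K * 1 * xi <= C1 * xi).
    { unfold C1. assert (0 <= K * xi) by (apply Rmult_le_pos; lra).
      replace (K * xi * B ^ 2 + 2 * (K * (B - 1) * xi) + K * 1 * xi) with (K * xi * (B ^ 2 + 2 * B - 1)) by ring.
      replace (2 * K * B ^ 2 * xi) with (K * xi * (2 * B ^ 2)) by ring.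
      apply Rmult_le_compat_l; [assumption|]. pose proof (pow2_ge_0 (B - 1)). lra. }
    unfold q. lra. }
  assert (Hq0 : forall t, 0 < q t) by (intros t; specialize (Hq t); lra).
  assert (Hsq : forall t, / 2 <= sqrt (q t)).
  { intros t. rewrite <- (sqrt_pow2 (/ 2)) by lra. apply sqrt_le_1_alt. specialize (Hq t). lra. }
  set (q' := fun t => (let P i j := pd 0 (gc g i j) (fst (gam t)) (snd (gam t)) * fst (gam' t)
                + pd 1 (gc g i j) (fst (gam t)) (snd (gam t)) * snd (gam' t) in
     P 0%nat 0%nat * fst (W t) * fst (W t) + 2 * (P 0%nat 1%nat * fst (W t) * snd (W t))
       + P 1%nat 1%nat * snd (W t) * snd (W t) + 2 * gq g (gam t) (W' t) (W t))).
  assert (Dq : forall t, is_derive q t (q' t)).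
  { intros t. apply (is_derive_gq g gam gam' W W' t Hg); apply Hgam || apply HW. }
  assert (Cgam : forall t, continuous (fun t => fst (gam t)) t /\ continuous (fun t => snd (gam t)) t).
  { intros t. destruct (Hgam t) as (A1 & A2 & _). apply continuous_of_is_derive in A1, A2. now split. }
  assert (CW : forall t, continuous (fun t => fst (W t)) t /\ continuous (fun t => snd (W t)) t).
  { intros t. destruct (HW t) as (A1 & A2 & _). apply continuous_of_is_derive in A1, A2. now split. }
  assert (Cq' : forall t, continuous q' t).
  { intros t. destruct (Cgam t) as [G1 G2]. destruct (CW t) as [W1 W2].
    destruct (Hgam t) as (_ & _ & G3 & G4). destruct (HW t) as (_ & _ & W3 & W4).
    assert (CP : forall i j, continuous (fun t => pd 0 (gc g i j) (fst (gam t)) (snd (gam t)) * fst (gam' t)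
                + pd 1 (gc g i j) (fst (gam t)) (snd (gam t)) * snd (gam' t)) t).
    { intros i j.
      assert (Cp : forall k, continuous (fun t => pd k (gc g i j) (fst (gam t)) (snd (gam t))) t).
      { intros k. apply continuous_comp_2d; [|assumption|assumption]. apply continuity_of_BL. now apply BL_pd_gc. }
      exact (continuous_Rplus _ _ _ (continuous_Rmult _ _ _ (Cp 0%nat) G3) (continuous_Rmult _ _ _ (Cp 1%nat) G4)). }
    exact (continuous_Rplus _ _ _ (continuous_Rplus _ _ _ (continuous_Rplus _ _ _
      (continuous_Rmult _ _ _ (continuous_Rmult _ _ _ (CP 0%nat 0%nat) W1) W1)
      (continuous_Rmult _ _ _ (continuous_const 2 t) (continuous_Rmult _ _ _ (continuous_Rmult _ _ _ (CP 0%nat 1%nat) W1) W2)))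
      (continuous_Rmult _ _ _ (continuous_Rmult _ _ _ (CP 1%nat 1%nat) W2) W2))
      (continuous_Rmult _ _ _ (continuous_const 2 t) (continuous_gq g gam W' W t Hg G1 G2 W3 W4 W1 W2))). }
  assert (Bq' : forall t, Rabs (q' t) <= C3 * xi).
  { intros t. unfold q'. cbv zeta.
    assert (BP : forall i j, Rabs (pd 0 (gc g i j) (fst (gam t)) (snd (gam t)) * fst (gam' t)
                + pd 1 (gc g i j) (fst (gam t)) (snd (gam t)) * snd (gam' t)) <= K * (2 * xi)).
    { intros i j. eapply Rle_trans; [apply Rabs_triang|]. rewrite !Rabs_mult.
      pose proof (mb_pd Hb i j 0 (fst (gam t)) (snd (gam t))) as Q1.
      pose proof (mb_pd Hb i j 1 (fst (gam t)) (snd (gam t))) as Q2.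
      specialize (Ngam' t). unfold nrm in Ngam'. pose proof (Rabs_pos (fst (gam' t))). pose proof (Rabs_pos (snd (gam' t))).
      assert (Rabs (pd 0 (gc g i j) (fst (gam t)) (snd (gam t))) * Rabs (fst (gam' t)) <= K * Rabs (fst (gam' t))) by (apply Rmult_le_compat_r; lra).
      assert (Rabs (pd 1 (gc g i j) (fst (gam t)) (snd (gam t))) * Rabs (snd (gam' t)) <= K * Rabs (snd (gam' t))) by (apply Rmult_le_compat_r; lra).
      assert (K * (Rabs (fst (gam' t)) + Rabs (snd (gam' t))) <= K * (2 * xi)) by (apply Rmult_le_compat_l; lra). lra. }
    pose proof (BP 0%nat 0%nat) as B00. pose proof (BP 0%nat 1%nat) as B01. pose proof (BP 1%nat 1%nat) as B11.
    set (P00 := pd 0 (gc g 0 0) (fst (gam t)) (snd (gam t)) * fst (gam' t) + pd 1 (gc g 0 0) (fst (gam t)) (snd (gam t)) * snd (gam' t)) in *.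
    set (P01 := pd 0 (gc g 0 1) (fst (gam t)) (snd (gam t)) * fst (gam' t) + pd 1 (gc g 0 1) (fst (gam t)) (snd (gam t)) * snd (gam' t)) in *.
    set (P11 := pd 0 (gc g 1 1) (fst (gam t)) (snd (gam t)) * fst (gam' t) + pd 1 (gc g 1 1) (fst (gam t)) (snd (gam t)) * snd (gam' t)) in *.
    pose proof (bilinear_bound P00 P01 P01 P11 (K * (2 * xi)) (W t) (W t) B00 B01 B01 B11) as BB. cbn [cp] in BB.
    replace (P00 * fst (W t) * fst (W t) + 2 * (P01 * fst (W t) * snd (W t)) + P11 * snd (W t) * snd (W t) + 2 * gq g (gam t) (W' t) (W t))
     with ((P00 * fst (W t) * fst (W t) + P01 * fst (W t) * snd (W t) + P01 * snd (W t) * fst (W t) + P11 * snd (W t) * snd (W t)) + 2 * gq g (gam t) (W' t) (W t)) by ring.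
    eapply Rle_trans; [apply Rabs_triang|]. rewrite (Rabs_mult 2), (Rabs_pos_eq 2) by lra.
    pose proof (mb_gq Hb (gam t) (W' t) (W t)) as BG.
    pose proof (nrm_pos (W t)). pose proof (nrm_pos (W' t)). specialize (NW t). specialize (NW' t).
    assert (0 <= K * (2 * xi)) by (apply Rmult_le_pos; lra).
    assert (K * (2 * xi) * nrm (W t) * nrm (W t) <= K * (2 * xi) * B * B).
    { apply Rmult_le_compat; [apply Rmult_le_pos; lra | lra | apply Rmult_le_compat_l; lra | assumption]. }
    assert (K * nrm (W' t) * nrm (W t) <= K * (2 * xi) * B).
    { apply Rmult_le_compat; [apply Rmult_le_pos; lra | lra | apply Rmult_le_compat_l; lra | assumption]. }
    unfold C3. lra. }
  set (rr := fun t => / sqrt (q t)). set (rr' := fun t => q' t * (- / (2 * q t * sqrt (q t)))).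
  assert (Drr : forall t, is_derive rr t (rr' t)) by (intros t; apply is_derive_inv_sqrt; [apply Dq | apply Hq0]).
  assert (Crr : forall t, continuous rr t) by (intros t; eapply continuous_of_is_derive; apply Drr).
  assert (Cq : forall t, continuous q t) by (intros t; eapply continuous_of_is_derive; apply Dq).
  assert (Hden : forall t, / 4 <= 2 * q t * sqrt (q t)).
  { intros t. specialize (Hq t). specialize (Hsq t). nra. }
  assert (Crr' : forall t, continuous rr' t).
  { intros t. apply continuous_Rmult; [apply Cq'|].
    apply (continuous_opp (fun t => / (2 * q t * sqrt (q t)))).
    apply (continuous_comp (fun t => 2 * q t * sqrt (q t)) Rinv).
    - apply continuous_Rmult; [apply continuous_Rmult; [apply continuous_const | apply Cq]|].
      apply (continuous_comp q sqrt); [apply Cq | apply continuous_sqrt].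
    - apply continuous_Rinv. specialize (Hden t). lra. }
  assert (Brr : forall t, 0 < rr t <= 2).
  { intros t. specialize (Hsq t). unfold rr. split; [apply Rinv_0_lt_compat; lra|].
    rewrite <- (Rinv_inv 2). apply Rinv_le_contravar; lra. }
  assert (Brr' : forall t, Rabs (rr' t) <= 4 * C3 * xi).
  { intros t. unfold rr'. specialize (Hden t). rewrite Rabs_mult, Rabs_Ropp, (Rabs_pos_eq (/ (2 * q t * sqrt (q t)))).
    2:{ apply Rlt_le, Rinv_0_lt_compat. lra. }
    assert (/ (2 * q t * sqrt (q t)) <= 4) by (rewrite <- (Rinv_inv 4); apply Rinv_le_contravar; lra).
    assert (0 < / (2 * q t * sqrt (q t))) by (apply Rinv_0_lt_compat; lra).
    replace (4 * C3 * xi) with (C3 * xi * 4) by ring.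
    apply Rmult_le_compat; [apply Rabs_pos | lra | apply Bq' | assumption]. }
  set (V := fun t => (fst (W t) * rr t, snd (W t) * rr t)).
  set (V' := fun t => (fst (W' t) * rr t + fst (W t) * rr' t, snd (W' t) * rr t + snd (W t) * rr' t)).
  assert (HV : C1curve V V').
  { intros t. destruct (HW t) as (A1 & A2 & A3 & A4). destruct (CW t) as [A5 A6]. unfold V, V'; cbn [fst snd].
    split; [exact (is_derive_Rmult _ _ _ _ _ A1 (Drr t))|].
    split; [exact (is_derive_Rmult _ _ _ _ _ A2 (Drr t))|].
    split.
    - exact (continuous_Rplus _ _ _ (continuous_Rmult _ _ _ A3 (Crr t)) (continuous_Rmult _ _ _ A5 (Crr' t))).
    - exact (continuous_Rplus _ _ _ (continuous_Rmult _ _ _ A4 (Crr t)) (continuous_Rmult _ _ _ A6 (Crr' t))). }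
  assert (NV : forall t, nrm (V t) <= 2 * B).
  { intros t. unfold V. replace (nrm (fst (W t) * rr t, snd (W t) * rr t)) with (Rabs (rr t) * nrm (W t))
      by (unfold nrm; cbn [fst snd]; rewrite !Rabs_mult; ring).
    specialize (Brr t). rewrite Rabs_pos_eq by lra. apply Rmult_le_compat; [lra | apply nrm_pos | lra | apply NW]. }
  assert (NV' : forall t, nrm (V' t) <= C4 * xi).
  { intros t. unfold V'.
    eapply Rle_trans; [apply (nrm_add (fst (W' t) * rr t, snd (W' t) * rr t) (fst (W t) * rr' t, snd (W t) * rr' t))|].
    replace (nrm (fst (W' t) * rr t, snd (W' t) * rr t)) with (Rabs (rr t) * nrm (W' t))
      by (unfold nrm; cbn [fst snd]; rewrite !Rabs_mult; ring).
    replace (nrm (fst (W t) * rr' t, snd (W t) * rr' t)) with (nrm (W t) * Rabs (rr' t))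
      by (unfold nrm; cbn [fst snd]; rewrite !Rabs_mult; ring).
    specialize (Brr t). rewrite (Rabs_pos_eq (rr t)) by lra.
    assert (rr t * nrm (W' t) <= 2 * (2 * xi)) by (apply Rmult_le_compat; [lra | apply nrm_pos | lra | apply NW']).
    assert (nrm (W t) * Rabs (rr' t) <= B * (4 * C3 * xi)) by (apply Rmult_le_compat; [apply nrm_pos | apply Rabs_pos | apply NW | apply Brr']).
    unfold C4. lra. }
  assert (S0 : s 0 = 0) by (unfold s; rewrite Rmult_0_r; apply sin_0).
  assert (S1 : s 1 = 1) by (unfold s; rewrite Rmult_1_r; apply sin_PI2).
  assert (G0 : gam 0 = x) by (unfold gam; rewrite S0; destruct x; cbn [fst snd]; f_equal; ring).
  assert (G1 : gam 1 = y) by (unfold gam, dx; rewrite S1, (surjective_pairing y); cbn [fst snd]; f_equal; ring).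
  assert (W0 : W 0 = v) by (unfold W; rewrite S0; destruct v; cbn [fst snd]; f_equal; ring).
  assert (W1 : W 1 = w) by (unfold W, dv; rewrite S1, (surjective_pairing w); cbn [fst snd]; f_equal; ring).
  replace (Lam * (2 * C5) * xi) with (Lam * (2 * (C5 * xi))) by ring.
  assert (V0 : V 0 = v).
  { unfold V, rr, q. rewrite G0, W0, Hv, sqrt_1, Rinv_1. destruct v; cbn [fst snd]. f_equal; ring. }
  assert (V1 : V 1 = w).
  { unfold V, rr, q. rewrite G1, W1, Hy, sqrt_1, Rinv_1. destruct w; cbn [fst snd]. f_equal; ring. }
  apply (distS_le_path g (x, v) (y0, w) k1 k2 gam gam' V V' (C5 * xi) Hg Hgam HV) with (lam := lam) (K := K); try assumption.
  - intros t _. unfold unitvec; cbn [fst snd].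
    replace (gq g (gam t) (V t) (V t)) with (q t * (rr t * rr t)) by (unfold q, V, gq; simpl; ring).
    unfold rr. rewrite <- Rinv_mult, sqrt_sqrt by (apply Rlt_le, Hq0). apply Rinv_r. specialize (Hq0 t). lra.
  - now rewrite G0, V0.
  - rewrite G1, V1. reflexivity.
  - apply Rmult_le_pos; lra.
  - intros t _. specialize (Ngam' t). assert (2 * xi <= C5 * xi) by (apply Rmult_le_compat_r; lra). lra.
  - intros t _. unfold cov; cbn [cp].
    eapply Rle_trans; [apply (nrm_add (V' t) (quad_chr g 0 (gam t) (gam' t) (V t), quad_chr g 1 (gam t) (gam' t) (V t)))|].
    unfold nrm at 2; cbn [fst snd].
    pose proof (mb_chr Hb 0%nat (gam t) (gam' t) (V t)). pose proof (mb_chr Hb 1%nat (gam t) (gam' t) (V t)).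
    assert (K * nrm (gam' t) * nrm (V t) <= K * (2 * xi) * (2 * B)).
    { apply Rmult_le_compat; [apply Rmult_le_pos; [lra | apply nrm_pos] | apply nrm_pos | apply Rmult_le_compat_l; [lra | apply Ngam'] | apply NV]. }
    specialize (NV' t). unfold C5. lra.
Qed.

(** * Spanning sets *)

(** Scales are fixed in the order [eps], [xi], [h], [e], [r], each from the previous ones and the
    metric, before [T] appears. The net must reach time [T + 1] because velocities at [t] are read
    off from positions at [t] and [t + h]. *)
Lemma trace_dyn_close g lam Lam K eps : is_torus_metric g -> metric_bounds g lam Lam K -> 0 < eps ->
  let kap := / Lam in let V := / lam in let M := 2 * (K * / lam * / lam) in
  exists e r, 0 < e <= 1 /\ 0 < r /\ forall T (a b : curve) P, 0 <= T ->
    min_geodesic g (fst a) (snd a) -> min_geodesic g (fst b) (snd b) ->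
    dl1 (fst a 0) (fst b 0) <= e -> dl1 (snd a 0) (snd b 0) <= e ->
    (forall t x, 0 <= t <= T + 1 -> dl1 x (fst a t) <= e -> exists p, In p P /\ dl1 p x <= r / 4) ->
    eqtrace (left_of V (tube kap V M)) P a b ->
    forall t k1 k2 l1 l2 x y, 0 <= t <= T -> fst a t = tr k1 k2 x -> fst b t = tr l1 l2 y ->
      distS g (x, snd a t) (y, snd b t) <= eps.
Proof.
  intros Hg Hb Heps kap V M.
  pose proof (mb_lam Hb) as Hl. pose proof (mb_K Hb) as HK. pose proof (mb_Lam Hb) as HLam.
  assert (Hkap : 0 < kap) by now apply Rinv_0_lt_compat.
  assert (HV : 0 < V) by now apply Rinv_0_lt_compat.
  assert (HM : 0 < M) by (unfold M; fold V; repeat apply Rmult_lt_0_compat; lra).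
  destruct (distS_close g lam Lam K Hg Hb) as (C & xi0 & HC & Hxi0 & HdS).
  set (xi := Rmin xi0 (eps / C)).
  assert (Hxi : 0 < xi) by (apply Rmin_pos; [assumption | now apply Rdiv_lt_0_compat]).
  assert (HCxi : C * xi <= eps).
  { apply Rle_trans with (C * (eps / C)); [apply Rmult_le_compat_l; [lra | apply Rmin_r] | right; field; lra]. }
  set (h := Rmin 1 (xi / (4 * M))).
  assert (Hh : 0 < h) by (apply Rmin_pos; [lra | apply Rdiv_lt_0_compat; lra]).
  assert (Hh1 : h <= 1) by apply Rmin_l.
  assert (HhM : 2 * M * h <= xi / 2).
  { apply Rle_trans with (2 * M * (xi / (4 * M))); [apply Rmult_le_compat_l; [lra | apply Rmin_r] | right; field; lra]. }
  set (Cd := drift Lam kap V).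
  assert (HCd : 0 < Cd).
  { pose proof (drift_ge Lam kap V HLam Hkap HV). assert (0 < V * Lam) by now apply Rmult_lt_0_compat. unfold Cd; lra. }
  (* The entries serve in turn: [e <= 1], the hypothesis [e <= kap / 2] of the parameter matching,
     the velocity estimate with increment [h], and the exclusion of a sign switch. *)
  set (e := Rmin (Rmin 1 (kap / 2)) (Rmin (xi * h / (4 * Cd)) (kap ^ 2 / (16 * M * Cd)))).
  assert (HMCd : 0 < M * Cd) by now apply Rmult_lt_0_compat.
  assert (He : 0 < e).
  { apply Rmin_pos; apply Rmin_pos; try lra; apply Rdiv_lt_0_compat; try lra.
    - now apply Rmult_lt_0_compat.
    - now apply pow_lt. }
  pose proof (Rmin_l (Rmin 1 (kap / 2)) (Rmin (xi * h / (4 * Cd)) (kap ^ 2 / (16 * M * Cd)))) as E1.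
  pose proof (Rmin_r (Rmin 1 (kap / 2)) (Rmin (xi * h / (4 * Cd)) (kap ^ 2 / (16 * M * Cd)))) as E2. fold e in E1, E2.
  pose proof (Rmin_l 1 (kap / 2)). pose proof (Rmin_r 1 (kap / 2)).
  pose proof (Rmin_l (xi * h / (4 * Cd)) (kap ^ 2 / (16 * M * Cd))) as E3.
  pose proof (Rmin_r (xi * h / (4 * Cd)) (kap ^ 2 / (16 * M * Cd))) as E4.
  assert (HCe1 : Cd * e <= xi * h / 4).
  { apply Rle_trans with (Cd * (xi * h / (4 * Cd))); [apply Rmult_le_compat_l; lra | right; field; lra]. }
  assert (HCe2 : Cd * e < kap ^ 2 / (8 * M)).
  { apply Rle_lt_trans with (Cd * (kap ^ 2 / (16 * M * Cd))); [apply Rmult_le_compat_l; lra|].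
    replace (Cd * (kap ^ 2 / (16 * M * Cd))) with (kap ^ 2 / (8 * M) / 2) by (field; lra).
    assert (0 < kap ^ 2 / (8 * M)) by (apply Rdiv_lt_0_compat; [now apply pow_lt | lra]). lra. }
  assert (HCe3 : Cd * e <= xi) by nra.
  assert (HVk : 0 < 4 * V / kap + / 4).
  { assert (0 < 4 * V / kap) by (apply Rdiv_lt_0_compat; lra). lra. }
  assert (Htube : 0 < tube kap V M).
  { apply Rmin_pos; apply Rdiv_lt_0_compat; try lra.
    - apply Rmult_lt_0_compat; [now apply pow_lt|]. apply Rdiv_lt_0_compat; [now apply pow_lt|].
      apply Rmult_lt_0_compat; [lra | now apply Rmult_lt_0_compat].
    - now apply pow_lt.
    - assert (0 < M * V ^ 2) by (apply Rmult_lt_0_compat; [assumption | now apply pow_lt]). lra. }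
  (* The first entry leaves room for balls of radius [r / 4] inside the tube; the second keeps the
     normal points at height [V * r] and these balls within [e] of the curve. *)
  set (r := Rmin (4 / 5 * tube kap V M) (e / (4 * V / kap + / 4))).
  assert (Hr : 0 < r) by (apply Rmin_pos; [lra | now apply Rdiv_lt_0_compat]).
  assert (Hr1 : 5 / 4 * r <= tube kap V M).
  { pose proof (Rmin_l (4 / 5 * tube kap V M) (e / (4 * V / kap + / 4))) as Q. fold r in Q. lra. }
  assert (Hr2 : 4 * V / kap * r + r / 4 <= e).
  { replace (4 * V / kap * r + r / 4) with ((4 * V / kap + / 4) * r) by (field; lra).
    apply Rle_trans with ((4 * V / kap + / 4) * (e / (4 * V / kap + / 4))); [apply Rmult_le_compat_l; [lra | apply Rmin_r]|].
    set (z := 4 * V / kap + / 4) in *. right. field. lra. }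
  exists e, r. split; [lra|]. split; [assumption|].
  intros T a b P HT Ha Hb' Hx0 Hu0 Hnet Heq t k1 k2 l1 l2 x y Ht Ex Ey.
  pose proof (min_geodesic_good g lam Lam K _ _ Hg Hb Ha) as Ga. pose proof (min_geodesic_good g lam Lam K _ _ Hg Hb Hb') as Gb.
  fold kap V M in Ga, Gb.
  assert (Hset : forall s, 0 <= s <= T + 1 -> exists s', dl1 (fst a s) (fst b s') <= e).
  { intros s Hs. apply (equal_trace_close kap V M a b (tube kap V M) r e P s Ga Gb); try assumption; [lra|].
    intros z Hz. now apply (Hnet s z Hs). }
  assert (Hpar : forall s, 0 <= s <= T + 1 -> dl1 (fst a s) (fst b s) <= Cd * e).
  { apply (close_parametrization g lam Lam K kap V M (fst a) (snd a) (fst b) (snd b) e (T + 1) Hg Hb);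
      try assumption; [apply Ha | apply Hb' | lra]. }
  assert (Hvel : dl1 (snd a t) (snd b t) <= xi).
  { eapply Rle_trans; [apply (close_velocity kap V M (fst a) (snd a) (fst b) (snd b) t h (Cd * e) Ga Gb Hh); apply Hpar; lra|].
    assert (2 * (Cd * e) / h <= xi / 2).
    { apply Rmult_le_reg_r with h; [assumption|]. replace (2 * (Cd * e) / h * h) with (2 * (Cd * e)) by (field; lra). lra. }
    lra. }
  eapply Rle_trans; [|exact HCxi].
  apply (HdS x y (snd a t) (snd b t) (l1 - k1)%Z (l2 - k2)%Z xi).
  - rewrite <- (gq_tr g k1 k2 x) by assumption. rewrite <- Ex. apply Ha.
  - rewrite <- (gq_tr g l1 l2 y) by assumption. rewrite <- Ey. apply Hb'.
  - split; [lra | apply Rmin_l].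
  - pose proof (Hpar t ltac:(lra)) as Hp. rewrite Ex, Ey in Hp.
    replace (dl1 x (tr (l1 - k1) (l2 - k2) y)) with (dl1 (tr k1 k2 x) (tr l1 l2 y)); [lra|].
    unfold dl1, tr; cbn [fst snd]. rewrite !minus_IZR. f_equal; f_equal; ring.
  - exact Hvel.
Qed.

(** * Grids, cells and maximal separated families *)

Lemma grid_1d (N m : nat) : (0 < m)%nat -> exists l : list R, length l = (2 * N * m + 1)%nat /\
  forall x, Rabs x <= INR N -> exists y, In y l /\ Rabs (y - x) <= / INR m.
Proof.
  intros Hm. assert (Hm' : 0 < INR m) by (apply lt_0_INR; lia).
  exists (map (fun i => INR i / INR m - INR N) (seq 0 (2 * N * m + 1))).
  split; [now rewrite length_map, length_seq|].
  intros x Hx. apply Rabs_le_between in Hx.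
  set (z := (x + INR N) * INR m).
  assert (Hz0 : 0 <= z) by (apply Rmult_le_pos; lra).
  assert (Hz1 : z <= INR (2 * N * m)).
  { rewrite !mult_INR. simpl (INR 2). unfold z. apply Rmult_le_compat_r; lra. }
  destruct (archimed z) as [A1 A2].
  assert (Hup : (0 <= up z - 1)%Z).
  { assert (0 < up z)%Z by (apply lt_IZR; lra). lia. }
  (* [up z] is the integer strictly above [z] by at most 1, so [i] is within 1 of [z] and does not
     exceed it; this keeps the node in the list at the right end. *)
  set (i := Z.to_nat (up z - 1)).
  assert (Hi : INR i = IZR (up z) - 1) by (unfold i; rewrite INR_IZR_INZ, Z2Nat.id, minus_IZR by assumption; reflexivity).
  exists (INR i / INR m - INR N). split.
  - apply (in_map (fun i => INR i / INR m - INR N)). apply in_seq. split; [lia|].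
    assert (i <= 2 * N * m)%nat; [|lia]. apply INR_le. lra.
  - assert (E : INR i / INR m - INR N - x = (INR i - z) * / INR m) by (unfold z; field; lra).
    rewrite E, Rabs_mult, (Rabs_pos_eq (/ INR m)) by (apply Rlt_le, Rinv_0_lt_compat; assumption).
    rewrite <- (Rmult_1_l (/ INR m)) at 2. apply Rmult_le_compat_r; [apply Rlt_le, Rinv_0_lt_compat; assumption|].
    apply Rabs_le. lra.
Qed.

Lemma grid_2d (N m : nat) : (0 < m)%nat -> exists G : list (R * R), length G = ((2 * N * m + 1) * (2 * N * m + 1))%nat /\
  forall x, nrm x <= INR N -> exists p, In p G /\ dl1 p x <= 2 * / INR m.
Proof.
  intros Hm. destruct (grid_1d N m Hm) as (l & Hl & Hnet). exists (list_prod l l).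
  split; [now rewrite length_prod, Hl|].
  intros x Hx. unfold nrm in Hx. pose proof (Rabs_pos (fst x)). pose proof (Rabs_pos (snd x)).
  destruct (Hnet (fst x) ltac:(lra)) as (y1 & H1 & D1). destruct (Hnet (snd x) ltac:(lra)) as (y2 & H2 & D2).
  exists (y1, y2). split; [now apply in_prod | unfold dl1; cbn [fst snd]; lra].
Qed.

Lemma inv_INR_small e : 0 < e -> exists m : nat, (0 < m)%nat /\ 2 * / INR m <= e.
Proof.
  intros He. destruct (archimed_cor1 (e / 2) ltac:(lra)) as (m & Hm & Hm0). exists m. split; [lia | lra].
Qed.

(** Membership in [inST] speaks of some lift; translations are isometries and preserve the geodesic
    equation, so every lift is minimal. *)
Lemma inST_min_geodesic g v c u : is_torus_metric g -> inST g v -> geodesic g c u -> (c 0, u 0) = v -> min_geodesic g c u.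
Proof.
  intros Hg (k1 & k2 & Hunit & Hmin) Hc <-. unfold shift, unitvec in *; cbn [fst snd] in *.
  change (fst (c 0) + IZR k1, snd (c 0) + IZR k2) with (tr k1 k2 (c 0)) in *. rewrite gq_tr in Hunit by assumption.
  split; [now apply unit_geodesic_intro|].
  pose proof (Hmin (fun t => tr k1 k2 (c t)) u (geodesic_tr g k1 k2 c u Hg Hc) eq_refl eq_refl) as Hm.
  intros s t. rewrite <- (dist_tr g k1 k2) by assumption. apply Hm.
Qed.

(** An uncovered point is added as long as there is one, and the bound [B] stops this. New points go
    to the front, so that separation and covering use [rel] in the same direction, symmetric or
    not. *)
Lemma maximal_separated {A : Type} (C : A -> Prop) (rel : A -> A -> Prop) (B : nat) :
  (forall G, (forall w, In w G -> C w) -> ForallOrdPairs (fun v w => ~ rel v w) G -> (length G <= B)%nat) ->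
  exists G, (forall w, In w G -> C w) /\ (length G <= B)%nat /\ forall v, C v -> exists w, In w G /\ rel v w.
Proof.
  intros HB.
  assert (H : forall n, (exists G, (forall w, In w G -> C w) /\ ForallOrdPairs (fun v w => ~ rel v w) G /\ length G = n) \/
     exists G, (forall w, In w G -> C w) /\ (length G <= B)%nat /\ forall v, C v -> exists w, In w G /\ rel v w).
  { induction n as [|n [(G & HC & HF & Hl)|HG]]; [left| |now right].
    - exists []. split; [intros w []|]. split; [constructor | reflexivity].
    - destruct (classic (forall v, C v -> exists w, In w G /\ rel v w)) as [Hall|Hn].
      + right. exists G. split; [assumption|]. split; [now apply HB | assumption].
      + left. apply not_all_ex_not in Hn. destruct Hn as [v Hv].
        assert (Cv : C v) by (apply NNPP; intros Hc; apply Hv; contradiction).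
        exists (v :: G). split; [intros w [<-|Hw]; [assumption | now apply HC]|].
        split; [|simpl; lia]. constructor; [|assumption]. rewrite Forall_forall. intros w Hw Hr.
        apply Hv. intros _. now exists w. }
  destruct (H (S B)) as [(G & HC & HF & Hl)|HG]; [|assumption].
  pose proof (HB G HC HF). lia.
Qed.

Lemma cover_by_cells {A B : Type} (C : A -> B -> Prop) (rel : A -> A -> Prop) (good : A -> Prop) (cells : list B) (n : nat) :
  (forall q, In q cells -> exists G, (forall w, In w G -> good w) /\ (length G <= n)%nat /\ forall v, C v q -> exists w, In w G /\ rel v w) ->
  (forall v, good v -> exists q, In q cells /\ C v q) ->
  exists G, (forall w, In w G -> good w) /\ (length G <= length cells * n)%nat /\ forall v, good v -> exists w, In w G /\ rel v w.
Proof.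
  intros Hcell Hcov.
  assert (H : exists G, (forall w, In w G -> good w) /\ (length G <= length cells * n)%nat /\
     forall v q, In q cells -> C v q -> exists w, In w G /\ rel v w).
  { clear Hcov. induction cells as [|q cells IHc].
    - exists []. split; [intros w []|]. split; [simpl; lia | intros v q []].
    - destruct IHc as (G & HG & Hl & Hs); [intros q' Hq'; apply Hcell; now right|].
      destruct (Hcell q ltac:(now left)) as (G' & HG' & Hl' & Hs'). exists (G' ++ G). split; [|split].
      + intros w Hw. apply in_app_or in Hw. destruct Hw; auto.
      + rewrite length_app. simpl. lia.
      + intros v q' [<-|Hq'] Hv.
        * destruct (Hs' v Hv) as (w & Hw & Hr). exists w. split; [apply in_or_app; now left | assumption].
        * destruct (Hs v q' Hq' Hv) as (w & Hw & Hr). exists w. split; [apply in_or_app; now right | assumption]. }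
  destruct H as (G & HG & Hl & Hs). exists G. split; [assumption|]. split; [assumption|].
  intros v Hv. destruct (Hcov v Hv) as (q & Hq & Hc). now apply (Hs v q).
Qed.

(** The centre [q] is a bare grid node and may fail to be a unit vector. The radius [e / 2] makes
    any two lifts in one cell [e]-close. *)
Definition in_cell (g : metric2) (e : R) (v : TB) (q : TB) : Prop :=
  inST g v /\ exists k1 k2, dl1 (tr k1 k2 (fst v)) (fst q) <= e / 2 /\ dl1 (snd v) (snd q) <= e / 2.

(** Lifts start near the centre of the cell, which makes them comparable in the plane. The last
    clause ties the lift to every geodesic issuing from [v], as the quantifiers of [dyn_close]
    require. *)
Definition lifts_to (g : metric2) (e : R) (q v : TB) (d : curve) : Prop :=
  min_geodesic g (fst d) (snd d) /\ dl1 (fst d 0) (fst q) <= e / 2 /\ dl1 (snd d 0) (snd q) <= e / 2 /\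
  exists k1 k2, forall c u, geodesic g c u -> (c 0, u 0) = v -> forall t, fst d t = tr k1 k2 (c t) /\ snd d t = u t.

Lemma lift_exists g e q v c u : is_torus_metric g -> in_cell g e v q -> geodesic g c u -> (c 0, u 0) = v ->
  exists d, lifts_to g e q v d.
Proof.
  intros Hg (Hin & k1 & k2 & H1 & H2) Hc E. pose proof (inST_min_geodesic g v c u Hg Hin Hc E) as Hm. subst v.
  exists (fun t => tr k1 k2 (c t), u). unfold lifts_to; cbn [fst snd] in *.
  split; [now apply min_geodesic_tr|]. split; [assumption|]. split; [assumption|].
  exists k1, k2. intros c2 u2 Hc2 E2 t.
  pose proof (inST_min_geodesic g (c 0, u 0) c2 u2 Hg Hin Hc2 E2) as Hm2. injection E2 as E3 E4.
  destruct (unit_geodesic_unique g c u c2 u2 Hg (proj1 Hm) (proj1 Hm2) (eq_sym E3) (eq_sym E4) t) as [-> ->]. auto.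
Qed.

(** Separated vectors of one cell have lifts with pairwise distinct traces on the net, so
    [trace_bound] limits their number. *)
Lemma cell_separated_bound g lam Lam K eps e r T q (N m : nat) (G : list TB) :
  is_torus_metric g -> metric_bounds g lam Lam K ->
  let kap := / Lam in let V := / lam in let M := 2 * (K * / lam * / lam) in
  0 < e <= 1 -> 0 < r -> 0 <= T -> nrm (fst q) <= 3 -> (0 < m)%nat -> 2 * / INR m <= r / 8 ->
  V * (T + 1) + 5 <= INR N ->
  (forall (a b : curve) P,
    min_geodesic g (fst a) (snd a) -> min_geodesic g (fst b) (snd b) ->
    dl1 (fst a 0) (fst b 0) <= e -> dl1 (snd a 0) (snd b 0) <= e ->
    (forall t x, 0 <= t <= T + 1 -> dl1 x (fst a t) <= e -> exists p, In p P /\ dl1 p x <= r / 4) ->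
    eqtrace (left_of V (tube kap V M)) P a b ->
    forall t k1 k2 l1 l2 x y, 0 <= t <= T -> fst a t = tr k1 k2 x -> fst b t = tr l1 l2 y ->
      distS g (x, snd a t) (y, snd b t) <= eps) ->
  (forall v, In v G -> in_cell g e v q) -> ForallOrdPairs (fun v w => ~ dyn_close g T eps v w) G ->
  (length G <= ((2 * N * m + 1) * (2 * N * m + 1) + 1) ^ 31)%nat.
Proof.
  intros Hg Hb kap V M He Hr HT Hq Hm Hmr HN Hclose HG Hsep.
  set (Bd := (((2 * N * m + 1) * (2 * N * m + 1) + 1) ^ 31)%nat).
  assert (HBd : (1 <= Bd)%nat) by (unfold Bd; apply Nat.le_succ_l, Nat.neq_0_lt_0, Nat.pow_nonzero; lia).
  destruct (Nat.le_gt_cases (length G) 1) as [H1|H1]; [lia|].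
  (* [dyn_close] holds vacuously if one of the vectors has no geodesic, so its failure supplies
     geodesics from both. With at least two members in [G], every member occurs in such a pair. *)
  assert (Hpair : forall v w, ~ dyn_close g T eps v w ->
     (exists c u, geodesic g c u /\ (c 0, u 0) = v) /\ (exists c u, geodesic g c u /\ (c 0, u 0) = w)).
  { intros v w Hn. split; apply NNPP; intros Hx; apply Hn; intros c u c2 u2 Hc E Hc2 E2 t Ht; exfalso; apply Hx; eauto. }
  assert (Hgeo : forall v, In v G -> exists c u, geodesic g c u /\ (c 0, u 0) = v).
  { destruct G as [|a [|b G]]; simpl in H1; try lia. inversion Hsep as [|x l Hx Hl]; subst.
    rewrite Forall_forall in Hx. intros v [<-|Hv].
    - apply (Hpair a b). apply Hx. now left.
    - apply (Hpair a v). now apply Hx. }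
  assert (Hinh : inhabited curve) by exact (inhabits (fun _ => (0, 0), fun _ => (0, 0))).
  set (dat := fun v => epsilon Hinh (lifts_to g e q v)).
  assert (Hdat : forall v, In v G -> lifts_to g e q v (dat v)).
  { intros v Hv. apply epsilon_spec. destruct (Hgeo v Hv) as (c & u & Hc & E). exact (lift_exists g e q v c u Hg (HG v Hv) Hc E). }
  set (F := map dat G).
  assert (HF : forall d, In d F -> exists v, In v G /\ d = dat v).
  { intros d Hd. apply in_map_iff in Hd. destruct Hd as (v & <- & Hv). now exists v. }
  assert (Hgood : forall d, In d F -> good_curve kap V M (fst d) (snd d)).
  { intros d Hd. destruct (HF d Hd) as (v & Hv & ->). apply (min_geodesic_good g lam Lam K); try assumption. apply (Hdat v Hv). }
  destruct (grid_2d N m Hm) as (Gr & HGl & HGn).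
  (* Grid mesh and displacement off the curves contribute [r / 8] each to the required density
     [r / 4]. *)
  destruct (avoid_curves_net kap V M F Gr (r / 8) Hgood ltac:(lra)) as (P & HPl & HPav & HPn).
  assert (HFl : length F = length G) by apply length_map.
  rewrite <- HFl. unfold Bd. rewrite <- HGl, <- HPl.
  apply (trace_bound kap V M (tube kap V M) F P Hgood).
  - intros a b Ha Hb'. destruct (HF a Ha) as (v & Hv & ->). destruct (HF b Hb') as (w & Hw & ->).
    apply (min_geodesics_meet g _ (snd (dat v)) _ (snd (dat w))); [assumption | apply (Hdat v Hv) | apply (Hdat w Hw)].
  - exact HPav.
  - assert (Hneq : forall v w, In v G -> In w G -> ~ dyn_close g T eps v w -> ~ eqtrace (left_of V (tube kap V M)) P (dat v) (dat w)).
    { intros v w Hv Hw Hn Heq. apply Hn.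
      destruct (Hdat v Hv) as (Mv & Xv & Uv & k1 & k2 & Kv). destruct (Hdat w Hw) as (Mw & Xw & Uw & l1 & l2 & Kw).
      intros c u c2 u2 Hc E Hc2 E2 t Ht.
      destruct (Kv c u Hc E t) as [Ev Eu]. destruct (Kw c2 u2 Hc2 E2 t) as [Ew Eu2].
      rewrite <- Eu, <- Eu2. apply (Hclose (dat v) (dat w) P) with (k1 := k1) (k2 := k2) (l1 := l1) (l2 := l2); try assumption.
      - pose proof (dl1_triang (fst (dat v) 0) (fst q) (fst (dat w) 0)). rewrite (dl1_sym (fst q)) in *. lra.
      - pose proof (dl1_triang (snd (dat v) 0) (snd q) (snd (dat w) 0)). rewrite (dl1_sym (snd q)) in *. lra.
      - intros s x Hs Hx.
        (* The point is within 1 of a lift that has moved at most [V * (T + 1)] from a start within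
           1/2 of [fst q], of norm at most 3; hence the 5 in the size of the grid. *)
        assert (Hnx : nrm x <= INR N).
        { pose proof (good_up (min_geodesic_good g lam Lam K _ _ Hg Hb Mv) s 0) as Hup. fold V in Hup.
          rewrite Rminus_0_r, Rabs_pos_eq in Hup by lra.
          assert (HV : 0 < V) by (apply Rinv_0_lt_compat, (mb_lam Hb)).
          assert (V * s <= V * (T + 1)) by (apply Rmult_le_compat_l; lra).
          assert (En : forall p, nrm p = dl1 p (0, 0)) by (intros p; unfold nrm, dl1; cbn [fst snd]; now rewrite !Rminus_0_r).
          rewrite En in *. pose proof (dl1_triang x (fst (dat v) s) (0, 0)).
          pose proof (dl1_triang (fst (dat v) s) (fst (dat v) 0) (0, 0)). pose proof (dl1_triang (fst (dat v) 0) (fst q) (0, 0)). lra. }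
        destruct (HGn x Hnx) as (p0 & Hp0 & D0). destruct (HPn p0 Hp0) as (p & Hp & Dp).
        exists p. split; [assumption|]. pose proof (dl1_triang p p0 x). lra. }
    unfold F. clear -Hsep Hneq. revert Hneq. induction Hsep as [|v G Hv HG IH]; intros Hneq; simpl; constructor.
    + rewrite Forall_forall in *. intros d Hd. apply in_map_iff in Hd. destruct Hd as (w & <- & Hw).
      apply Hneq; [now left | now right | now apply Hv].
    + apply IH. intros a b Ha Hb. apply Hneq; now right.
Qed.

Lemma cells_cover g lam Lam K e : is_torus_metric g -> metric_bounds g lam Lam K -> 0 < e <= 1 ->
  exists cells : list TB, (forall q, In q cells -> nrm (fst q) <= 3) /\
    forall v, inST g v -> exists q, In q cells /\ in_cell g e v q.
Proof.
  intros Hg Hb He.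
  destruct (inv_INR_small (e / 2) ltac:(lra)) as (m & Hm & Hme).
  destruct (grid_2d 2 m Hm) as (Gx & _ & HGx).
  destruct (archimed_cor1 lam (mb_lam Hb)) as (n & Hn & Hn0).
  destruct (grid_2d n m Hm) as (Gw & _ & HGw).
  (* Translated base points lie in the unit square, of norm at most 2, and the node chosen is within
     1/2 of them. Discarding nodes of norm above 3 bounds all centres and loses none of these. *)
  set (f := fun p : R * R => if Rle_dec (nrm p) 3 then true else false).
  exists (list_prod (filter f Gx) Gw). split.
  - intros [x w] Hq. apply in_prod_iff in Hq. destruct Hq as [Hx _]. apply filter_In in Hx. destruct Hx as [_ Hx].
    unfold f in Hx. cbn [fst]. destruct (Rle_dec (nrm x) 3); [assumption | discriminate].
  - intros v Hv. destruct (frac_in_unit (fst (fst v))) as [k1 H1]. destruct (frac_in_unit (snd (fst v))) as [k2 H2].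
    assert (Hnx : nrm (tr k1 k2 (fst v)) <= INR 2).
    { unfold nrm, tr; cbn [fst snd]. rewrite !Rabs_pos_eq by lra. simpl (INR 2). lra. }
    assert (Hnw : nrm (snd v) <= INR n).
    { destruct Hv as (l1 & l2 & Hu & _). unfold unitvec in Hu. cbn [shift fst snd] in Hu.
      eapply Rle_trans; [apply (nrm_unit g lam Lam K _ _ Hb Hu)|].
      rewrite <- (Rinv_inv (INR n)). apply Rinv_le_contravar; [apply Rinv_0_lt_compat, lt_0_INR; lia | lra]. }
    destruct (HGx _ Hnx) as (x & Hx & Dx). destruct (HGw _ Hnw) as (w & Hw & Dw).
    exists (x, w). split.
    + apply in_prod; [|assumption]. apply filter_In. split; [assumption|].
      unfold f. destruct (Rle_dec (nrm x) 3) as [|Hn3]; [reflexivity|]. exfalso. apply Hn3.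
      assert (En : forall p, nrm p = dl1 p (0, 0)) by (intros p; unfold nrm, dl1; cbn [fst snd]; now rewrite !Rminus_0_r).
      rewrite En in *. simpl (INR 2) in Hnx. pose proof (dl1_triang x (tr k1 k2 (fst v)) (0, 0)). lra.
    + split; [assumption|]. exists k1, k2. cbn [fst snd]. rewrite (dl1_sym _ x), (dl1_sym _ w). lra.
Qed.

(** The number of cells does not depend on [T]. Each cell costs a power 31 of a net whose size is
    quadratic in [T]. *)
Lemma spanning_set_bound g eps : is_torus_metric g -> 0 < eps ->
  exists A, 1 <= A /\ forall T, 0 <= T -> exists G : list TB,
    (forall w, In w G -> inST g w) /\ INR (length G) <= A * (A * (T + 1)) ^ 62 /\
    (forall v, inST g v -> exists w, In w G /\ dyn_close g T eps v w).
Proof.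
  intros Hg Heps. destruct (torus_metric_bounds g Hg) as (lam & Lam & K & Hb).
  destruct (trace_dyn_close g lam Lam K eps Hg Hb Heps) as (e & r & He & Hr & Hclose).
  destruct (cells_cover g lam Lam K e Hg Hb He) as (cells & Hcn & Hcov).
  destruct (inv_INR_small (r / 8) ltac:(lra)) as (m & Hm & Hmr).
  set (V := / lam) in *. assert (HV : 0 < V) by (apply Rinv_0_lt_compat, (mb_lam Hb)).
  assert (Hm' : 1 <= INR m) by (apply (le_INR 1); lia).
  (* One constant for two purposes: it exceeds the number of cells, and since [N] is at most
     [(V + 6) (T + 1)], it gives [2 N m + 2 <= A (T + 1)], whose square bounds the number of net
     points plus one. *)
  set (A := INR (length cells) + 2 * (V + 6) * INR m + 2).
  assert (HA1 : 0 <= 2 * (V + 6) * INR m) by (apply Rmult_le_pos; lra).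
  pose proof (pos_INR (length cells)) as Hcp.
  exists A. split; [unfold A; lra|]. intros T HT.
  assert (HN : exists N : nat, V * (T + 1) + 5 <= INR N <= V * (T + 1) + 6).
  { set (z := V * (T + 1) + 5). assert (Hz : 0 <= z) by (unfold z; assert (0 <= V * (T + 1)) by (apply Rmult_le_pos; lra); lra).
    destruct (archimed z) as [Z1 Z2]. exists (Z.to_nat (up z)).
    rewrite INR_IZR_INZ, Z2Nat.id by (apply le_IZR; lra). unfold z in *. lra. }
  destruct HN as (N & HN1 & HN2).
  set (Bd := (((2 * N * m + 1) * (2 * N * m + 1) + 1) ^ 31)%nat).
  destruct (cover_by_cells (in_cell g e) (dyn_close g T eps) (inST g) cells Bd) as (G & HG & Hl & Hs).
  - intros q Hq. destruct (maximal_separated (fun v => in_cell g e v q) (dyn_close g T eps) Bd) as (G & HG & Hl & Hs).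
    + intros G HG Hsep.
      apply (cell_separated_bound g lam Lam K eps e r T q N m G Hg Hb He Hr HT (Hcn q Hq) Hm Hmr HN1); try assumption.
      intros a b P. now apply Hclose.
    + exists G. split; [intros w Hw; apply (HG w Hw)|]. split; assumption.
  - exact Hcov.
  - exists G. split; [assumption|]. split; [|assumption].
    apply le_INR in Hl. eapply Rle_trans; [exact Hl|]. rewrite mult_INR.
    assert (HB : INR Bd <= (A * (T + 1)) ^ 62).
    { unfold Bd. rewrite pow_INR. change 62%nat with (2 * 31)%nat. rewrite pow_mult. apply pow_incr.
      split; [apply pos_INR|]. rewrite plus_INR, mult_INR, plus_INR, !mult_INR.
      replace (INR 2) with 2 by (simpl; ring). replace (INR 1) with 1 by reflexivity.
      set (x := 2 * INR N * INR m).
      assert (Hx : 0 <= x) by (unfold x; repeat apply Rmult_le_pos; try lra; apply pos_INR).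
      assert (Hxle : x + 2 <= A * (T + 1)).
      { assert (HNle : INR N <= (V + 6) * (T + 1)) by nra.
        assert (x <= 2 * ((V + 6) * (T + 1)) * INR m).
        { unfold x. apply Rmult_le_compat_r; lra. }
        unfold A. assert (0 <= INR (length cells) * (T + 1)) by (apply Rmult_le_pos; lra). nra. }
      apply Rle_trans with ((x + 2) ^ 2); [nra|]. apply pow_incr. lra. }
    apply Rmult_le_compat; [assumption | apply pos_INR | unfold A; lra | assumption].
Qed.

(** * The entropy estimate *)

Lemma ln_poly_sublinear A e : 1 <= A -> 0 < e -> exists T0, 1 <= T0 /\ forall T, T0 <= T ->
  ln (A * (A * (T + 1)) ^ 62) <= e * T.
Proof.
  intros HA He.
  (* The logarithm lies below its tangent, used at [a (T + 1)]. The 62 factors then contribute slope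
     [62 * a], half of [e], and the constants fit into the other half for large [T]. *)
  set (a := e / 124). assert (Ha : 0 < a) by (unfold a; lra).
  set (c := ln A + 62 * (ln A + (a - 1 - ln a))).
  exists (Rmax 1 (2 * c / e)). split; [apply Rmax_l|]. intros T HT.
  pose proof (Rmax_l 1 (2 * c / e)). pose proof (Rmax_r 1 (2 * c / e)).
  assert (HT1 : 0 < T + 1) by lra. assert (HAT : 0 < A * (T + 1)) by (apply Rmult_lt_0_compat; lra).
  rewrite ln_mult; [|lra|now apply pow_lt]. rewrite ln_pow by assumption. rewrite ln_mult by lra.
  assert (Hln : ln (T + 1) <= a * T + (a - 1 - ln a)).
  { assert (Hl : ln (a * (T + 1)) <= a * (T + 1) - 1).
    { assert (Hp : 0 < a * (T + 1)) by now apply Rmult_lt_0_compat.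
      pose proof (exp_ineq1_le (ln (a * (T + 1)))) as Hx. rewrite exp_ln in Hx by assumption. lra. }
    rewrite ln_mult in Hl by assumption. lra. }
  simpl (INR 62). replace (INR 62) with 62 by (simpl; lra).
  assert (Hc : c <= e / 2 * T).
  { apply Rle_trans with (e / 2 * (2 * c / e)); [right; field; lra | apply Rmult_le_compat_l; lra]. }
  unfold c in Hc. unfold a in *. lra.
Qed.

(** [ln] takes the value 0 outside its domain; a spanning number 0, the case of an empty [inST],
    thus has rate 0. *)
Lemma ln_nonpos x : x <= 0 -> ln x = 0.
Proof. intros Hx. unfold ln. destruct (Rlt_dec 0 x); [exfalso; lra | reflexivity]. Qed.

Lemma rate_nonneg g T eps : 0 < T -> Rbar_le (Finite 0) (rate g T eps).
Proof.
  intros HT. unfold rate, span_num.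
  match goal with |- context [Glb_Rbar ?E] => pose proof (Glb_Rbar_correct E) as [H1 H2]; set (S := E) in * end.
  destruct (Glb_Rbar S) as [x| |]; simpl; [|exact I|].
  - apply Rmult_le_pos; [|apply Rlt_le, Rinv_0_lt_compat; assumption].
    destruct (Rle_dec x 0) as [Hx|Hx].
    + rewrite ln_nonpos by assumption. apply Rle_refl.
    + assert (Hx1 : Rbar_le (Finite 1) (Finite x)).
      { apply H2. intros y Hy. pose proof (H1 y Hy) as Hxy. destruct Hy as (G & -> & _). simpl in *.
        destruct G as [|w G]; [simpl in Hxy; lra|]. apply (le_INR 1). simpl. lia. }
      simpl in Hx1. rewrite <- ln_1. destruct (Req_dec x 1) as [->|Hne]; [apply Rle_refl|].
      apply Rlt_le, ln_increasing; lra.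
  - apply (H2 (Finite 0)). intros y (G & -> & _). apply pos_INR.
Qed.

Lemma rate_le g T eps (G : list TB) b : 0 < T -> 1 <= b ->
  (forall w, In w G -> inST g w) -> (forall v, inST g v -> exists w, In w G /\ dyn_close g T eps v w) ->
  INR (length G) <= b -> Rbar_le (rate g T eps) (Finite (ln b / T)).
Proof.
  intros HT Hb HG Hs Hl. unfold rate, span_num.
  match goal with |- context [Glb_Rbar ?E] => pose proof (proj1 (Glb_Rbar_correct E)) as H1; set (S := E) in * end.
  assert (HS : S (INR (length G))) by (exists G; auto).
  specialize (H1 _ HS). destruct (Glb_Rbar S) as [x| |]; simpl in *; [|contradiction|exact I].
  apply Rmult_le_compat_r; [apply Rlt_le, Rinv_0_lt_compat; assumption|].
  destruct (Rle_dec x 0) as [Hx|Hx].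
  - rewrite (ln_nonpos x Hx), <- ln_1.
    destruct (Req_dec b 1) as [->|]; [apply Rle_refl | apply Rlt_le, ln_increasing; lra].
  - destruct (Req_dec x b) as [->|]; [apply Rle_refl | apply Rlt_le, ln_increasing; lra].
Qed.

Theorem mainTheorem1 (g : metric2) (Hg : is_torus_metric g) : htop_zero g.
Proof.
  (* The estimate holds for every positive [eps]; the threshold 1 is arbitrary. *)
  intros e He. exists 1. split; [lra|]. intros eps [Heps _].
  destruct (spanning_set_bound g eps Hg Heps) as (A & HA & Hspan).
  destruct (ln_poly_sublinear A (e / 2) HA ltac:(lra)) as (T0 & HT0 & HT).
  unfold limsup_rate, Rbar_glb. destruct (Rbar_ex_glb _) as [l [Hlb Hglb]]. cbn [proj1_sig].
  split.
  - apply Rbar_lt_le_trans with (Finite 0); [simpl; lra|].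
    (* Every tail of times contains the positive time [Rmax T1 1], where the rate is nonnegative, so
       every supremum and hence their infimum is nonnegative. *)
    apply Hglb. intros a (T1 & Ea). rewrite Ea. unfold Rbar_lub. destruct (Rbar_ex_lub _) as [u [Hub Hlub]]. cbn [proj1_sig].
    apply Rbar_le_trans with (rate g (Rmax T1 1) eps).
    + apply rate_nonneg. pose proof (Rmax_r T1 1). lra.
    + apply Hub. exists (Rmax T1 1). split; [apply Rmax_l | reflexivity].
  - apply Rbar_le_lt_trans with (Finite (e / 2)); [|simpl; lra].
    (* The infimum is bounded by the single tail starting at [T0], from which on the logarithm of
       the polynomial is at most [e / 2 * T]. *)
    eapply Rbar_le_trans; [apply Hlb; exists T0; reflexivity|].
    unfold Rbar_lub. destruct (Rbar_ex_lub _) as [u [Hub Hlub]]. cbn [proj1_sig].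
    apply Hlub. intros b (T & HTT & Eb). rewrite Eb. clear b Eb.
    destruct (Hspan T ltac:(lra)) as (G & HG & Hl & Hs).
    eapply Rbar_le_trans; [apply (rate_le g T eps G (A * (A * (T + 1)) ^ 62)); try assumption; [lra|]|].
    + assert (1 <= (A * (T + 1)) ^ 62) by (apply pow_R1_Rle; nra). nra.
    + simpl. apply Rmult_le_reg_r with T; [lra|]. unfold Rdiv at 1. rewrite Rmult_assoc, Rinv_l, Rmult_1_r by lra.
      apply HT. assumption.
Qed.
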